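(* Let $(\Sigma,\mu)$ be a measure space with a ball-basis $\mathscr{B}$. If $T$ is a $\mathbb{B}$-valued multilinear bounded oscillation operator with respect to $\mathscr{B}$ and $r\in[1,\infty)$ such that $T$ is bounded from $L^r(\Sigma,\mu)\times\cdots\times L^r(\Sigma,\mu)$ to $L^{\frac rm,\infty}(\Sigma,\mu)$, then there exists $\gamma>0$ such that for all $B\in\mathscr{B}$ and $f_i\in L^\infty_c(\Sigma,\mu)$ with $\operatorname{supp}(f_i)\subset B$, $1\le i\le m$, $$\mu\big(\{x\in B:|T(\vec f)(x)|>t\,\mathcal{M}_{\mathscr{B},r}(\vec f)(x)\}\big)\lesssim e^{-\gamma t}\mu(B)$$ for all $t>0$. If in addition $A_{\infty,\mathscr{B}}$ satisfies the sharp reverse H\''older property, then for any $\alpha\in\{0,1\}^m$ (and $\mathbf{b}=(b_1,\ldots,b_m)$ a vector of measurable functions), $$\mu\big(\{x\in B:|[T,\mathbf{b}]_\alpha(\vec f)(x)|>t\,\mathcal{M}_{\mathscr{B},r}(\vec{f^*})(x)\}\big)\lesssim e^{-\left(\frac{\gamma t}{\|\mathbf{b}\|_\tau}\right)^{\frac1{|\tau|+1}}}\mu(B)$$ for all $t>0$, where $\tau=\{i:\alpha_i\ne0\}$, $\|\mathbf{b}\|_\tau=\prod_{i\in\tau}\|b_i\|_{\operatorname{osc}_{\exp L}}$, $\vec{f^*}=(f_1^*,\ldots,f_m^* )$ with $f_i^*=\big(M_{\mathscr{B}}^{\lfloor r\rfloor}(|f_i|^r)\big)^{1/r}$, $i=1,\ldots,m$,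 and $\lfloor r\rfloor$ denotes the minimal integer no less than $r$.
   Context: Convention. $X\lesssim Y$ means $X\le CY$ with a constant $C>0$ independent of $B$, $\vec f$, $\mathbf{b}$ and $t$. $L^\infty_c(\Sigma,\mu)$ is the set of bounded measurable functions with bounded support, where a set is bounded if it is contained in some $B\in\mathscr{B}$. Ball-basis. A family $\mathscr{B}$ of measurable subsets of a measure space $(\Sigma,\mu)$ is a ball-basis if: (B1) $0<\mu(B)<\infty$ for all $B\in\mathscr{B}$; (B2) for all $x,y\in\Sigma$ some $B\in\mathscr{B}$ contains both; (B3) for every $\varepsilon>0$ and measurable $E$ there is a finite or infinite sequence $\{B_k\}\subset\mathscr{B}$ with $\mu(E\Delta\bigcup_kB_k)<\varepsilon$; (B4) for each $B\in\mathscr{B}$ there is $B^*\in\mathscr{B}$ such that $\mu(B^* )\le\mathfrak{C}_0\mu(B)$, $\bigcup\{B'\in\mathscr{B}:B'\cap B\ne\emptyset,\ \mu(B')\le2\mu(B)\}\subset B^*$, and $A\subset B\Rightarrow A^*\subset B^*$, where $\mathfrak{C}_0\ge1$ is a universal constant. Notation. $\vec f=(f_1,\ldots,f_m)$, $\vec f\mathbf{1}_E=(f_1\mathbf{1}_E,\ldots,f_m\mathbf{1}_E)$, $\langle f\rangle_{B,r}:=(\frac1{\mu(B)}\int_B|f|^rd\mu)^{1/r}$, $\lfloor f\rfloor_{B,r}:=\sup_{B'\in\mathscr{B},\,B'\supset B}\langle f\rangle_{B',r}$. An operator $T$ is $m$-sublinear if in each entry $|T(\ldots,\lambda f_i,\ldots)|=|\lambda||T(\ldots,f_i,\ldots)|$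 and $|T(\ldots,f_i+g_i,\ldots)|\le|T(\ldots,f_i,\ldots)|+|T(\ldots,g_i,\ldots)|$. Bounded oscillation operators. Let $\mathbb{B}$ be a Banach space. $T$ is a $\mathbb{B}$-valued multilinear bounded oscillation operator with respect to $\mathscr{B}$ and $r\in[1,\infty)$ if there exist constants $\mathfrak{C}_1(T),\mathfrak{C}_2(T)\in(0,\infty)$ and a $\mathbb{B}$-valued $m$-linear operator $\mathcal{T}$ with $T(\vec f)(x)=\|\mathcal{T}(\vec f)(x)\|_{\mathbb{B}}$ for every $x\in\Sigma$ (or, in the case $\mathbb{B}=\mathbb{R}$, $\mathcal{T}=T$ is a real-valued $m$-linear or $m$-sublinear operator) such that for all $\vec f\in L^r(\Sigma,\mu)^m$: (T1) for every $B_0\in\mathscr{B}$ with $B_0^*\subsetneq\Sigma$, there exists $B\in\mathscr{B}$ with $B\supsetneq B_0$ so that $\sup_{x\in B_0}\|\mathcal{T}(\vec f\mathbf{1}_{B^*})(x)-\mathcal{T}(\vec f\mathbf{1}_{B_0^*})(x)\|_{\mathbb{B}}\le\mathfrak{C}_1(T)\prod_{i=1}^m\langle f_i\rangle_{B^*,r}$; (T2) for every $B\in\mathscr{B}$, $\sup_{x,x'\in B}\|(\mathcal{T}(\vec f)-\mathcal{T}(\vec f\mathbf{1}_{B^*}))(x)-(\mathcal{T}(\vec f)-\mathcal{T}(\vec f\mathbf{1}_{B^*}))(x')\|_{\mathbb{B}}\le\mathfrak{C}_2(T)\prod_{i=1}^m\lfloor f_i\rfloor_{B,r}$. Maximal operators.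 $\mathcal{M}_{\mathscr{B},r}(\vec f)(x):=\sup_{B\in\mathscr{B}:x\in B}\prod_{i=1}^m\langle f_i\rangle_{B,r}$ if $x\in\bigcup_{B\in\mathscr{B}}B$ and $0$ otherwise; $M_{\mathscr{B}}$ is the case $m=1$, $r=1$, and $M_{\mathscr{B}}^k$ is its $k$-fold iterate. Commutators. Whenever it makes sense, $[T,\mathbf{b}]_{ke_i}(\vec f)(x):=T(f_1,\ldots,(b_i(x)-b_i)^kf_i,\ldots,f_m)(x)$ and $[T,\mathbf{b}]_\alpha:=[\cdots[[T,\mathbf{b}]_{\alpha_1e_1},\mathbf{b}]_{\alpha_2e_2}\cdots,\mathbf{b}]_{\alpha_me_m}$, i.e. $[T,\mathbf{b}]_\alpha(\vec f)(x)=T\big((b_1(x)-b_1)^{\alpha_1}f_1,\ldots,(b_m(x)-b_m)^{\alpha_m}f_m\big)(x)$. Oscillation spaces. $\|f\|_{\exp L,B}:=\inf\{\lambda>0:\frac1{\mu(B)}\int_B(e^{|f|/\lambda}-1)\,d\mu\le1\}$; $\operatorname{osc}_{\exp L}$ is the collection of $f\in L^1_{\mathrm{loc}}(\Sigma,\mu)$ with $\|f\|_{\operatorname{osc}_{\exp L}}:=\sup_{B\in\mathscr{B}}\|f-f_B\|_{\exp L,B}<\infty$, where $f_B:=\frac1{\mu(B)}\int_Bf\,d\mu$. Weights. A weight is a measurable $w$ with $0<w<\infty$ a.e. For $1<p<\infty$, $[w]_{A_{p,\mathscr{B}}}:=\sup_{B\in\mathscr{B}}(\frac1{\mu(B)}\int_Bw\,d\mu)(\frac1{\mu(B)}\int_Bw^{1-p'}d\mu)^{p-1}$;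 $[w]_{A_{1,\mathscr{B}}}:=\|(M_{\mathscr{B}}w)w^{-1}\|_{L^\infty}$; $A_{p,\mathscr{B}}$ is the class of weights for which this is finite; $A_{\infty,\mathscr{B}}:=\bigcup_{p\ge1}A_{p,\mathscr{B}}$ with $[w]_{A_{\infty,\mathscr{B}}}:=\inf\{[w]_{A_{p,\mathscr{B}}}:w\in A_{p,\mathscr{B}}\}$. For $1<s<\infty$, $w\in RH_{s,\mathscr{B}}$ means $[w]_{RH_{s,\mathscr{B}}}:=\sup_{B\in\mathscr{B}}(\frac1{\mu(B)}\int_Bw^sd\mu)^{1/s}(\frac1{\mu(B)}\int_Bw\,d\mu)^{-1}<\infty$. $A_{\infty,\mathscr{B}}$ satisfies the sharp reverse H\''older property if there exists a constant $c_0>0$ such that for every $w\in A_{\infty,\mathscr{B}}$ one has $w\in RH_{r_w,\mathscr{B}}$ with $r_w=1+c_0[w]_{A_{\infty,\mathscr{B}}}^{-1}$. *)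

(* Defs.v *)
From mathcomp Require Import all_boot all_order all_algebra.
From mathcomp Require Import all_classical all_reals all_analysis.
From mathcomp Require Import measurable_realfun.

Set Implicit Arguments.
Unset Strict Implicit.
Unset Printing Implicit Defensive.

Import Order.TTheory GRing.Theory Num.Theory.
Import numFieldNormedType.Exports.

Local Open Scope classical_set_scope.
Local Open Scope ring_scope.

(* In [ball_approx] a finite or infinite sequence of balls is a countable
   family of balls.  In [ball_star] only the values of [star] on balls
   are constrained. *)
Record ball_basis {d : measure_display} {T : measurableType d} {R : realType}
    (mu : {measure set T -> \bar R}) := BallBasis {
  balls : set (set T) ;
  star : set T -> set T ;
  star_cst : R ;
  star_cst_ge1 : 1 <= star_cst ;
  ball_measurable : forall B, balls B -> measurable B ;
  ball_measure : forall B, balls B -> (0 < mu B < +oo)%E ;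
  ball_join : forall x y : T, exists B, [/\ balls B, B x & B y] ;
  ball_approx : forall (e : R) (E : set T), 0 < e -> measurable E ->
    exists F : set (set T), [/\ countable F, F `<=` balls &
      (mu (E `+` \bigcup_(B in F) B) < e%:E)%E] ;
  ball_star : forall B, balls B ->
    [/\ balls (star B),
        (mu (star B) <= star_cst%:E * mu B)%E,
        \bigcup_(B' in [set B' | [/\ balls B', B' `&` B !=set0 &
                                     (mu B' <= 2%:E * mu B)%E]]) B' `<=` star B
      & forall A, balls A -> A `<=` B -> star A `<=` star B]
}.

Section Notions.
Context {d : measure_display} {T : measurableType d} {R : realType}.
Context {mu : {measure set T -> \bar R}} (BB : ball_basis mu).

Definition avg (B : set T) (F : T -> \bar R) : \bar R :=
  ((mu B)^-1 * \int[mu]_(x in B) F x)%E.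

Definition avgr (r : R) (B : set T) (F : T -> \bar R) : \bar R :=
  (avg B (fun x => `|F x| `^ r) `^ r^-1)%E.

Definition avgr_sup (r : R) (B : set T) (F : T -> \bar R) : \bar R :=
  ereal_sup [set avgr r B' F | B' in [set B' | balls BB B' /\ B `<=` B']].

(* Functions are extended-valued so that maximal functions can be iterated.
   Maximal functions need not be measurable; [\int] of a nonnegative function
   is the supremum of the integrals of its simple minorants. *)
Definition maximal (r : R) (m : nat) (F : 'I_m -> T -> \bar R) (x : T) : \bar R :=
  if x \in \bigcup_(B in balls BB) B then
    ereal_sup [set (\prod_(i < m) avgr r B (F i))%E |
               B in [set B | balls BB B /\ B x]]
  else 0%E.

Definition maximal1 (F : T -> \bar R) : T -> \bar R :=
  maximal 1 (fun _ : 'I_1 => F).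

Definition fstar (r : R) (f : T -> R) (x : T) : \bar R :=
  (iter `|Num.ceil r|%N maximal1 (fun y => (`|f y| `^ r)%:E) x `^ r^-1)%E.

Definition Linfc (f : T -> R) : Prop :=
  [/\ measurable_fun setT f, exists M : R, forall x, `|f x| <= M &
      exists2 B, balls BB B & [set x | f x != 0] `<=` B].

Definition tuple_Lr (r : R) (m : nat) (f : 'I_m -> T -> R) : Prop :=
  forall i, f i \in Lfun mu r%:E.

(* m-ary operators; only their values on L^r x ... x L^r matter, and these are
   functions defined at every point. *)
Definition operator (m : nat) (V : Type) : Type := ('I_m -> T -> R) -> T -> V.

Definition multilinear (r : R) (m : nat) (V : normedModType R)
    (A : operator m V) : Prop :=
  forall (f : 'I_m -> T -> R) (i : 'I_m) (g : T -> R) (a : R),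
    tuple_Lr r f -> g \in Lfun mu r%:E ->
    forall x, A (dfwith f i (fun y => a * f i y + g y)) x
              = a *: A f x + A (dfwith f i g) x.

Definition multisublinear (r : R) (m : nat) (A : operator m R) : Prop :=
  forall (f : 'I_m -> T -> R) (i : 'I_m), tuple_Lr r f ->
    (forall (a : R) x, `|A (dfwith f i (fun y => a * f i y)) x| = `|a| * `|A f x|) /\
    (forall g : T -> R, g \in Lfun mu r%:E -> forall x,
      `|A (dfwith f i (fun y => f i y + g y)) x|
        <= `|A f x| + `|A (dfwith f i g) x|).

Definition restr (m : nat) (f : 'I_m -> T -> R) (E : set T) : 'I_m -> T -> R :=
  fun i x => f i x * \1_E x.

Definition cond_T1 (r : R) (m : nat) (V : normedModType R) (A : operator m V)
    (C : R) (f : 'I_m -> T -> R) : Prop :=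
  forall B0, balls BB B0 -> star BB B0 `<` setT ->
    exists B, [/\ balls BB B, B0 `<` B &
      (ereal_sup [set (`|A (restr f (star BB B)) x
                         - A (restr f (star BB B0)) x|)%:E | x in B0]
        <= C%:E * \prod_(i < m) avgr r (star BB B) (EFin \o f i))%E].

Definition cond_T2 (r : R) (m : nat) (V : normedModType R) (A : operator m V)
    (C : R) (f : 'I_m -> T -> R) : Prop :=
  forall B, balls BB B ->
    (ereal_sup [set (`|(A f z.1 - A (restr f (star BB B)) z.1)
                       - (A f z.2 - A (restr f (star BB B)) z.2)|)%:E |
                z in B `*` B]
      <= C%:E * \prod_(i < m) avgr_sup r B (EFin \o f i))%E.

Definition bounded_oscillation_conds (r : R) (m : nat) (V : normedModType R)
    (A : operator m V) : Prop :=
  exists C1 C2 : R, [/\ 0 < C1, 0 < C2 &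
    forall f, tuple_Lr r f -> cond_T1 r A C1 f /\ cond_T2 r A C2 f].

(* [bounded_oscillation r m V S]: S is a V-valued multilinear bounded
   oscillation operator.  The second constructor is the extra alternative
   available when V is the scalar field. *)
Inductive bounded_oscillation (r : R) (m : nat) :
    completeNormedModType R -> operator m R -> Prop :=
| bounded_oscillation_norm (V : completeNormedModType R) (S : operator m R)
    (A : operator m V) of
    multilinear r A &
    (forall f, tuple_Lr r f -> forall x, S f x = `|A f x|) &
    bounded_oscillation_conds r A :
    bounded_oscillation r V S
| bounded_oscillation_scalar (S : operator m R) of
    @multilinear r m R S \/ multisublinear r S &
    @bounded_oscillation_conds r m R S :
    bounded_oscillation r R S.

Definition weakLnorm (p : R) (g : T -> R) : \bar R :=
  ereal_sup [set (l%:E * mu [set x | (l < `|g x|)%R] `^ p^-1)%E |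
             l in [set l : R | 0 < l]].

Definition weak_bounded (r : R) (m : nat) (S : operator m R) : Prop :=
  exists2 C : R, 0 < C & forall f, tuple_Lr r f ->
    measurable_fun setT (S f) /\
    (weakLnorm (r / m%:R) (S f)
      <= C%:E * \prod_(i < m) 'N[mu]_(r%:E)[EFin \o f i])%E.

Definition commutator (m : nat) (S : operator m R) (b : 'I_m -> T -> R)
    (alpha : 'I_m -> nat) : operator m R :=
  fun f x => S (fun i y => (b i x - b i y) ^+ alpha i * f i y) x.

Definition expL_norm (B : set T) (f : T -> R) : \bar R :=
  ereal_inf [set l%:E | l in [set l : R | 0 < l /\
    (avg B (fun x => (expR (`|f x| / l) - 1)%:E) <= 1)%E]].

Definition osc_norm (f : T -> R) : \bar R :=
  ereal_sup [set expL_norm B (fun x => f x - fine (avg B (EFin \o f))) |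
             B in balls BB].

Definition osc_expL (f : T -> R) : Prop :=
  [/\ measurable_fun setT f,
      forall B, balls BB B -> mu.-integrable B (EFin \o f) &
      (osc_norm f < +oo)%E].

(* The product of the norms over tau, equal to +oo as soon as one b i, i in tau,
   lies outside osc_exp L (even if another norm is 0). *)
Definition osc_norm_prod (m : nat) (b : 'I_m -> T -> R) (tau : {set 'I_m}) : \bar R :=
  if `[< forall i, i \in tau -> osc_expL (b i) >]
  then (\prod_(i in tau) osc_norm (b i))%E else +oo%E.

Definition weight (w : T -> \bar R) : Prop :=
  measurable_fun setT w /\ {ae mu, forall x, (0 < w x < +oo)%E}.

Definition Ap_cst (p : R) (w : T -> \bar R) : \bar R :=
  if p == 1 then Lnorm mu +oo (fun x => maximal1 w x * (w x)^-1)%E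
  else
    ereal_sup [set (avg B w
                    * avg B (fun x => w x `^ (1 - p / (p - 1))%R) `^ (p - 1)%R)%E |
               B in balls BB].

Definition Ap (p : R) (w : T -> \bar R) : Prop :=
  weight w /\ (Ap_cst p w < +oo)%E.

Definition Ainfty (w : T -> \bar R) : Prop := exists2 p : R, 1 <= p & Ap p w.

Definition Ainfty_cst (w : T -> \bar R) : \bar R :=
  ereal_inf [set Ap_cst p w | p in [set p : R | 1 <= p /\ Ap p w]].

Definition RH_cst (s : R) (w : T -> \bar R) : \bar R :=
  ereal_sup [set (avgr s B w * (avg B w)^-1)%E | B in balls BB].

Definition RH (s : R) (w : T -> \bar R) : Prop := (RH_cst s w < +oo)%E.

(* 1 <= Ainfty_cst w < +oo on Ainfty, so [fine] loses nothing. *)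
Definition sharp_reverse_Holder : Prop :=
  exists2 c0 : R, 0 < c0 &
    forall w, Ainfty w -> RH (1 + c0 / fine (Ainfty_cst w)) w.

End Notions.

(* Main.v *)
Require Import Defs.
From mathcomp Require Import all_boot all_order all_algebra.
From mathcomp Require Import all_classical all_reals all_analysis.
From mathcomp Require Import measurable_realfun ess_sup_inf.
From mathcomp Require Import ring lra.
Import Order.TTheory GRing.Theory Num.Theory.
Import numFieldNormedType.Exports.
Local Open Scope classical_set_scope.
Local Open Scope ring_scope.


(** Both estimates come from one stopping-time iteration.  Let [D] be a ball and
    [g] an input supported in its star.  By the weak type of the operator and of
    the maximal function, outside of a set [E] of small measure relative to [D]
    the operator is bounded by the product of the averages of the entries over
    the star of [D], and no ball that sticks out of [E] sees much larger averages.
    Balls at least half of which lies in [E], maximal up to a factor 2 and made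
    disjoint by Vitali's selection ([vitali_stopping]), have stars that cover
    almost all of [E]; a density argument replaces differentiation
    ([exists_dense_ball]).  On such a star [D'] the operator applied to [g]
    differs from the operator applied to [g] restricted to the star of [D'] by a
    bounded multiple of averages over balls around the point ([descent]): the
    first oscillation condition gives a successor [B] of [D'], the stopping rule
    gives a point of [B] outside of the exceptional sets, and the second condition
    carries the estimate there.  Successors may be arbitrarily larger than [D'];
    when that happens they see the whole support and the second condition is not
    needed.  As the sets [D'] fill at most a fraction exp(-1) of [D], the set where
    [k] units of the threshold are exceeded has measure at most exp(-k) times that
    of [D] ([decay]).

    A commutator at [x] is the operator applied to inputs multiplied by
    [b_i(x) - b_i].  The multipliers are frozen at their means over the current
    ball, which gives inputs independent of [x]; the expansion of the product
    ([sublinear_expansion]) returns to the value at [x], at the price of a factor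
    [u] for each multiplier as long as [b_i(x)] is within [u n_i] of the mean.  The
    remaining points form a set of measure at most a multiple of exp(-u).  Hence
    [k] steps at the truncation level [u] reach a threshold of order
    [u^|tau| k], and [u = k] gives the exponent 1/(|tau|+1) ([commutator_rate]).

    The iteration compares the operator with a function that dominates products
    of amplitudes, that is of averages of [f_i] and of [f_i] weighted by the
    normalized oscillation of [b_i].  Without multipliers this is the multilinear
    maximal function.  With them the weight is exponentially integrable, and
    Young's inequality reduces the matter to an L (log L)^r bound for [|f_i|^r] by
    iterates of the maximal function.  This rests on the reverse weak type
    estimate ([reverse_weak_type]), for which a ball must have a larger ball of
    comparable measure outside of its star ([gap_bound]).  Here the sharp reverse
    Holder property enters: if there were arbitrarily large gaps, a sum of
    multiples of indicators of isolated balls would be a weight whose A_1 constant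
    stays bounded, so that a fixed exponent larger than 1 would be admissible for
    it, although its mean of that order over suitable balls is much larger than
    its mean ([tower_not_reverse_Holder], [gap_bound_of_sharp]). *)

(** * Coverings in a ball-basis *)

Section Covering.
Set Implicit Arguments.
Unset Strict Implicit.
Context {d : measure_display} {T : measurableType d} {R : realType}.
Context {mu : {measure set T -> \bar R}} (BB : ball_basis mu).
Local Open Scope ereal_scope.

Lemma star_ball B : balls BB B -> balls BB (star BB B).
Proof. by move=> /ball_star[]. Qed.

Lemma le_mu_star B : balls BB B -> mu (star BB B) <= (star_cst BB)%:E * mu B.
Proof. by move=> /ball_star[]. Qed.

Lemma ball_lty B : balls BB B -> mu B < +oo.
Proof. by move=> /ball_measure/andP[]. Qed.

Lemma ball_gt0 B : balls BB B -> 0 < mu B.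
Proof. by move=> /ball_measure/andP[]. Qed.

Lemma ball_fin_num B : balls BB B -> mu B \is a fin_num.
Proof. by move=> bB; rewrite ge0_fin_numE// ball_lty. Qed.

Lemma ball_nonempty B : balls BB B -> B !=set0.
Proof.
move=> bB; apply/set0P/eqP => B0; move: (ball_gt0 bB).
by rewrite B0 measure0 ltxx.
Qed.

Lemma sub_star B A : balls BB B -> balls BB A -> A `&` B !=set0 ->
  mu A <= 2%:E * mu B -> A `<=` star BB B.
Proof.
move=> bB bA AB le2; have [_ _ H _] := ball_star bB.
by move=> x Ax; apply: H; exists A.
Qed.

Lemma ball_le2 B : balls BB B -> mu B <= 2%:E * mu B.
Proof. by move=> bB; rewrite lee_pemull// lee1n. Qed.

Lemma sub_star_self B : balls BB B -> B `<=` star BB B.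
Proof.
move=> bB; apply: sub_star => //; last exact: ball_le2.
by rewrite setIid; exact: ball_nonempty.
Qed.

Lemma star_subset A B : balls BB A -> balls BB B -> A `<=` B ->
  star BB A `<=` star BB B.
Proof. by move=> bA bB; have [_ _ _ H] := ball_star bB; exact: H. Qed.

Lemma le_mu_ball A B : balls BB A -> balls BB B -> A `<=` B -> mu A <= mu B.
Proof. by move=> bA bB AB; apply: le_measure; rewrite ?inE; [exact: (ball_measurable bA)|exact: (ball_measurable bB)|]. Qed.

(** The supremum of the measures over a family of balls need not be attained;
    a factor 2 makes up for it, and the star absorbs this factor. *)
Lemma near_sup_ball (G : set (set T)) (M : \bar R) : G `<=` balls BB -> G !=set0 ->
  M < +oo -> (forall A, G A -> mu A <= M) ->
  exists2 B, G B & forall A, G A -> mu A <= 2%:E * mu B.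
Proof.
move=> GB [A0 GA0] Moo GM.
pose s := ereal_sup [set mu A | A in G].
have sM : s <= M by apply: ge_ereal_sup => _ [A GA <-]; exact: GM.
have s0 : 0 < s.
  by apply: (lt_le_trans (ball_gt0 (GB _ GA0))); apply: ereal_sup_ubound; exists A0.
have sfin : s \is a fin_num by rewrite gt0_fin_numE//; exact: le_lt_trans sM Moo.
have : (fine s / 2)%:E < s.
  rewrite -[ltRHS]fineK// lte_fin; have : (0 < fine s)%R by rewrite fine_gt0// s0 -ge0_fin_numE// ltW.
  lra.
move=> /ereal_sup_gt[_ [B GB' <-] sB]; exists B => // A GA.
apply: (@le_trans _ _ s); first by apply: ereal_sup_ubound; exists A.
rewrite -(fineK sfin) -(fineK (ball_fin_num (GB _ GB'))) -EFinM lee_fin.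
move: sB; rewrite -(fineK (ball_fin_num (GB _ GB'))) lte_fin; lra.
Qed.

(** The greedy Vitali selection; domination of the measures of the balls by
    the integrals of one integrable function makes the process exhaust [G]. *)
Lemma vitali_selection (G : set (set T)) (h : T -> \bar R) :
  G `<=` balls BB -> measurable_fun setT h -> (forall x, 0 <= h x) ->
  \int[mu]_x h x < +oo -> (forall A, G A -> mu A <= \int[mu]_(x in A) h x) ->
  exists (F : nat -> set T) (I : set nat),
    [/\ forall n, I n -> G (F n), trivIset I F &
        forall A, G A -> exists2 n, I n & A `<=` star BB (F n)].
Proof.
move=> GB mh h0 hoo Gh.
have mball A : G A -> measurable A by move=> /GB; exact: ball_measurable.
have intA A : measurable A -> \int[mu]_(x in A) h x <= \int[mu]_x h x.
  by move=> mA; apply: ge0_subset_integral.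
pose cand (U : set T) := [set A | G A /\ A `&` U = set0].
have /choice[nxt nxtP] : forall U : set T, exists A : set T,
    (cand U !=set0 -> cand U A /\ forall B, cand U B -> mu B <= 2%:E * mu A) /\
    (~ (cand U !=set0) -> A = set0).
  move=> U; have [U0|U0] := pselect (cand U !=set0); last by exists set0.
  have [||A UA AP] := @near_sup_ball (cand U) (\int[mu]_x h x) _ U0 hoo.
  - by move=> A [/GB].
  - move=> A [GA _]; apply: (le_trans (Gh _ GA)); apply: intA; exact: mball.
  by exists A; split.
(* the union of the balls chosen before the n-th choice *)
pose st := fix st n := if n is k.+1 then st k `|` nxt (st k) else set0.
pose F n := nxt (st n).
have stE n : st n = \big[setU/set0]_(k < n) F k.
  by elim: n => [|n IH]; rewrite ?big_ord0// big_ord_recr /= -IH.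
have FP n : F n = set0 \/ (G (F n) /\ F n `&` st n = set0).
  have [c0|c0] := pselect (cand (st n) !=set0); [right|left].
    by have [/(_ c0)[]] := nxtP (st n).
  by have [_ /(_ c0)] := nxtP (st n).
have Fsub k n : (k < n)%N -> F k `<=` st n.
  by move=> kn x Fx; rewrite stE; by rewrite -bigcup_mkord; exists k.
have tF : trivIset setT F.
  apply/trivIsetP.
  have H i j : (i < j)%N -> F i `&` F j = set0.
    move=> ij; have [->|[_ e]] := FP j; first by rewrite setI0.
    by rewrite -subset0 => x [xi xj]; rewrite -e; split => //; exact: Fsub xi.
  move=> i j _ _; rewrite neq_ltn => /orP[ij|ij]; first exact: H.
  by rewrite setIC; exact: H.
exists F, [set n | G (F n)]; split => //; first exact: sub_trivIset tF.
move=> A GA.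
have [dis|/existsNP dis] := pselect (forall n, A `&` F n = set0); last first.
  have exn : exists n, `[< A `&` F n <> set0 >].
    by have [n0 n0P] := dis; exists n0; apply/asboolP.
  case: (ex_minnP exn) => n /asboolP nP nmin.
  have cA : cand (st n) A.
    split=> //; rewrite -subset0 stE -bigcup_mkord => x [Ax [k /= kn Fkx]].
    have : `[< A `&` F k <> set0 >].
      by apply/asboolP/eqP/set0P; exists x.
    by move=> /nmin; rewrite leqNgt kn.
  have [/(_ (ex_intro _ _ cA))[[GF _] Fmax] _] := nxtP (st n).
  exists n => //; apply: sub_star; [exact: GB|exact: GB| |exact: Fmax].
  by apply/set0P/eqP.
(* otherwise [A] competes at every choice, so infinitely many disjoint balls are
   chosen, of measure at least half of that of [A]; but the integral of [h]
   bounds the sum of their measures *)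
exfalso.
have cA n : cand (st n) A.
  split=> //; rewrite -subset0 stE -bigcup_mkord => x [Ax [k /= kn Fkx]].
  have : (A `&` F k) x by [].
  by rewrite dis.
have GF n : G (F n) /\ mu A <= 2%:E * mu (F n).
  by have [/(_ (ex_intro _ _ (cA n)))[[GF _] Fmax] _] := nxtP (st n); split => //; exact: Fmax.
have mF n : measurable (F n) by apply: mball; case: (GF n).
have sumF n : \sum_(k < n) mu (F k) <= \int[mu]_x h x.
  apply: (@le_trans _ _ (\int[mu]_(x in \big[setU/set0]_(k < n) F k) h x)).
    rewrite ge0_integral_bigsetU//=; last 3 first.
    - exact: index_enum_uniq.
    - apply/trivIsetP => i j _ _ ij; move/trivIsetP : tF; apply => //.
    - exact: measurable_funTS.
    apply: lee_sum => k _; apply: Gh; by case: (GF k).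
  by apply: intA; exact: bigsetU_measurable.
have A0 : 0 < mu A by exact: ball_gt0 (GB _ GA).
have Afin : mu A \is a fin_num by exact: ball_fin_num (GB _ GA).
have hfin : \int[mu]_x h x \is a fin_num.
  by rewrite ge0_fin_numE//; exact: integral_ge0.
have a0 : (0 < fine (mu A))%R by rewrite fine_gt0// A0 ltey_eq Afin.
have key n : (n%:R * (fine (mu A) / 2) <= fine (\int[mu]_x h x))%R.
  rewrite -lee_fin (fineK hfin); apply: le_trans (sumF n).
  apply: (@le_trans _ _ (\sum_(k < n) (fine (mu A) / 2)%:E)).
    by rewrite sumEFin lee_fin big_const_ord iter_addr_0 mulr_natl.
  apply: lee_sum => k _; have [GFk] := GF k.
  have fk := ball_fin_num (GB _ GFk).
  rewrite -(fineK Afin) -(fineK fk) -EFinM !lee_fin; lra.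
have := key (Num.trunc (fine (\int[mu]_x h x) / (fine (mu A) / 2))).+1.
rewrite leNgt -ltr_pdivrMr ?divr_gt0// => /negP; apply.
exact: truncnS_gt.
Qed.

(** Enlarging each ball of [G] within [G] until its measure is maximal up to a
    factor two turns a Vitali family into one of stopping balls: a ball
    containing [F n] and sticking out of its star is no longer in [G]. *)
Lemma vitali_stopping (G : set (set T)) (h : T -> \bar R) :
  G `<=` balls BB -> measurable_fun setT h -> (forall x, 0 <= h x) ->
  \int[mu]_x h x < +oo -> (forall A, G A -> mu A <= \int[mu]_(x in A) h x) ->
  exists (F : nat -> set T) (I : set nat),
    [/\ forall n, I n -> G (F n), trivIset I F,
        forall A, G A -> exists2 n, I n & A `<=` star BB (F n) &
        forall n A, I n -> G A -> F n `<=` A -> A `<=` star BB (F n)].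
Proof.
move=> GB mh h0 hoo Gh.
pose stop := [set A | G A /\ forall B, G B -> A `<=` B -> mu B <= 2%:E * mu A].
have extend A : G A -> exists2 B, stop B & A `<=` B.
  move=> GA; have [|||B [GB' AB] BP] := @near_sup_ball [set B | G B /\ A `<=` B] (\int[mu]_x h x) _ _ hoo.
  - by move=> B [/GB].
  - by exists A; split.
  - move=> B [GB' _]; apply: (le_trans (Gh _ GB')).
    by apply: ge0_subset_integral => //; exact: (ball_measurable (GB _ GB')).
  exists B => //; split => // C GC BC; apply: BP; split => //; exact: subset_trans BC.
have [||F [I [FI tF Fcov]]] := @vitali_selection stop h _ mh h0 hoo.
- by move=> A [/GB].
- by move=> A [/Gh].
exists F, I; split => //.
- by move=> n /FI[].
- move=> A /extend[B stB AB]; have [n In Bn] := Fcov _ stB.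
  by exists n => //; exact: subset_trans Bn.
- move=> n A /FI[GF stF] GA FA; apply: sub_star; [exact: GB|exact: GB| |exact: stF].
  by rewrite (setIidr FA); exact: ball_nonempty (GB _ GF).
Qed.

Lemma sum_star_le (h : T -> \bar R) (F : nat -> set T) (I : set nat) :
  measurable_fun setT h -> (forall x, 0 <= h x) ->
  (forall n, I n -> balls BB (F n)) -> trivIset I F ->
  (forall n, I n -> mu (F n) <= \int[mu]_(x in F n) h x) ->
  \sum_(n <oo | n \in I) mu (star BB (F n)) <=
    (star_cst BB)%:E * \int[mu]_(x in \bigcup_(n in I) F n) h x.
Proof.
move=> mh h0 FB tF Fh.
pose F' n := if n \in I then F n else set0.
have mF' n : measurable (F' n).
  by rewrite /F'; case: ifPn => // /[!inE] /FB; exact: ball_measurable.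
have tF' : trivIset setT F'.
  apply/trivIsetP => i j _ _ ij; rewrite /F'; case: ifPn => [/[!inE] Ii|]; last by rewrite set0I.
  case: ifPn => [/[!inE] Ij|]; last by rewrite setI0.
  by move/trivIsetP : tF; apply.
have -> : \bigcup_(n in I) F n = \bigcup_n F' n.
  apply/seteqP; split => x [n].
    by move=> In Fx; exists n => //; rewrite /F' mem_set.
  by move=> _; rewrite /F'; case: ifPn => // /[!inE] In Fx; exists n.
rewrite ge0_integral_bigcup//; last exact: measurable_funTS.
rewrite -nneseriesZl; last first.
  by move=> n _; exact: integral_ge0.
rewrite [leLHS]eseries_mkcond; apply: lee_nneseries => n _.
  by case: ifPn.
rewrite /F'; case: ifPn => [/[!inE] In|_]; last by rewrite integral_set0 mule0.
apply: (le_trans (le_mu_star (FB _ In))); apply: lee_wpmul2l; last exact: Fh.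
by rewrite lee_fin (le_trans _ (star_cst_ge1 BB)).
Qed.

Lemma le_mu_bigcup (A : nat -> set T) (I : set nat) :
  (forall n, I n -> measurable (A n)) ->
  mu (\bigcup_(n in I) A n) <= \sum_(n <oo | n \in I) mu (A n).
Proof.
move=> mA; pose A' n := if n \in I then A n else set0.
have mA' n : measurable (A' n).
  by rewrite /A'; case: ifPn => // /[!inE] /mA.
have -> : \sum_(n <oo | n \in I) mu (A n) = \sum_(n <oo) mu (A' n).
  by rewrite [LHS]eseries_mkcond; apply: eq_eseriesr => n _; rewrite /A'; case: ifPn; rewrite ?measure0.
apply: measure_sigma_subadditive => //.
  exact: bigcup_measurable.
by move=> x [n In Ax]; exists n => //; rewrite /A' mem_set.
Qed.

Lemma integral_indicZ (c : R) (D E : set T) : (0 <= c)%R ->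
  measurable D -> measurable E ->
  \int[mu]_(x in D) (c * \1_E x)%:E = c%:E * mu (E `&` D).
Proof.
move=> c0 mD mE; under eq_integral do rewrite EFinM.
rewrite ge0_integralZl_EFin// ?integral_indic//.
by apply/measurable_EFinP; exact: measurable_indic.
Qed.

(** The form of the covering lemma behind every weak type estimate. *)
Lemma vitali_cover (G : set (set T)) (h : T -> \bar R) :
  G `<=` balls BB -> measurable_fun setT h -> (forall x, 0 <= h x) ->
  \int[mu]_x h x < +oo -> (forall A, G A -> mu A <= \int[mu]_(x in A) h x) ->
  exists U, [/\ measurable U, forall A, G A -> A `<=` U &
    mu U <= (star_cst BB)%:E * \int[mu]_x h x].
Proof.
move=> GB mh h0 hoo Gh.
have [F [I [FI tF Fcov]]] := vitali_selection GB mh h0 hoo Gh.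
have bF n : I n -> balls BB (F n) by move=> /FI /GB.
have mS n : I n -> measurable (star BB (F n)).
  by move=> /bF /star_ball; exact: ball_measurable.
exists (\bigcup_(n in I) star BB (F n)); split.
- exact: bigcup_measurable.
- by move=> A /Fcov[n In An] x /An; exists n.
- apply: le_trans (le_mu_bigcup mS) _.
  apply: le_trans (sum_star_le mh h0 bF tF _) _; first by move=> n /FI /Gh.
  apply: lee_wpmul2l; first by rewrite lee_fin (le_trans _ (star_cst_ge1 BB)).
  apply: ge0_subset_integral => //.
  by apply: bigcup_measurable => n /bF; exact: ball_measurable.
Qed.

Lemma countable_bigcup_measurable (F : set (set T)) :
  countable F -> (forall A, F A -> measurable A) -> measurable (\bigcup_(A in F) A).
Proof.
move=> /pfcard_geP[->|[f]] mF; first by rewrite bigcup_set0.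
have -> : \bigcup_(A in F) A = \bigcup_n f n.
  apply/seteqP; split=> x.
    by move=> [A FA Ax]; have [n _ fA] := 'surj_f FA; exists n => //; rewrite fA.
  by move=> [n _ fx]; exists (f n) => //; exact: funS.
by apply: bigcup_measurable => n _; apply: mF; exact: funS.
Qed.

(** A weak substitute for the density theorem: if every ball were mostly
    outside [E], the Vitali lemma applied to a family of balls approximating
    [E] would show that this family has small total measure. *)
Lemma exists_dense_ball (E : set T) : measurable E -> 0 < mu E -> mu E < +oo ->
  exists2 A, balls BB A & mu A <= 2%:E * mu (E `&` A).
Proof.
move=> mE E0 Eoo; apply: contrapT => nodense.
have thin A : balls BB A -> mu A <= 2%:E * mu (A `\` E).
  move=> bA; have mA := ball_measurable bA.
  have : ~~ (mu A <= 2%:E * mu (E `&` A)) by apply/negP => h; apply: nodense; exists A.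
  rewrite -ltNge.
  have fin (X : set T) : measurable X -> X `<=` A -> mu X \is a fin_num.
    move=> mX XA; rewrite ge0_fin_numE//; apply: le_lt_trans (ball_lty bA).
    by apply: le_measure; rewrite ?inE.
  have -> : mu A = mu (A `\` E) + mu (E `&` A) by rewrite setIC -measureDI.
  have f1 : mu (A `\` E) \is a fin_num by apply: fin => //; exact: measurableD.
  have f2 : mu (E `&` A) \is a fin_num by apply: fin => //; exact: measurableI.
  rewrite -(fineK f1) -(fineK f2) -EFinD -!EFinM lte_fin lee_fin; lra.
have Efin : mu E \is a fin_num by rewrite ge0_fin_numE.
have e0 : (0 < fine (mu E))%R by rewrite fine_gt0// E0 Eoo.
set C0 := star_cst BB; have C1 : (1 <= C0)%R := star_cst_ge1 BB.
pose e := (fine (mu E) / (2 * (2 * C0 + 1)))%R.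
have egt0 : (0 < e)%R by rewrite /e divr_gt0//; lra.
have [F [cF FB EF]] := ball_approx BB egt0 mE.
set U := \bigcup_(B in F) B in EF.
have mU : measurable U.
  by apply: countable_bigcup_measurable => // A /FB; exact: ball_measurable.
have mUE : measurable (U `\` E) by exact: measurableD.
have mEU : measurable (E `\` U) by exact: measurableD.
have mY : measurable (E `+` U) by exact: measurableU.
have ltUE : mu (U `\` E) < e%:E.
  by apply: le_lt_trans EF; apply: le_measure; rewrite ?inE// => x; right.
have ltEU : mu (E `\` U) < e%:E.
  by apply: le_lt_trans EF; apply: le_measure; rewrite ?inE// => x; left.
have [||||V [mV FV muV]] := @vitali_cover F (fun x => (2 * \1_(U `\` E) x)%:E) FB.
- by apply/measurable_EFinP; apply: measurable_funM => //; exact: measurable_indic.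
- by move=> x; rewrite lee_fin mulr_ge0.
- rewrite integral_indicZ// setIT; apply: lte_mul_pinfty => //.
  by apply: lt_le_trans ltUE _; rewrite leey.
- move=> A FA; have mA := ball_measurable (FB _ FA).
  rewrite integral_indicZ//; apply: (le_trans (thin _ (FB _ FA))).
  apply: lee_wpmul2l => //; apply: le_measure; rewrite ?inE//.
  - exact: measurableD.
  - exact: measurableI.
  - by move=> x [Ax nEx]; split => //; split => //; exists A.
move: muV; rewrite integral_indicZ// setIT => muV.
have EUV : mu E <= mu V + mu (E `\` U).
  apply: (@le_trans _ _ (mu (V `|` (E `\` U)))).
    apply: le_measure; rewrite ?inE//; first exact: measurableU.
    move=> x Ex; have [[A FA Ax]|nUx] := pselect (U x); first by left; exact: FV Ax.
    by right.
  by rewrite measureU2.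
have fUE : mu (U `\` E) \is a fin_num by rewrite ge0_fin_numE// (lt_le_trans ltUE)// leey.
have fEU : mu (E `\` U) \is a fin_num by rewrite ge0_fin_numE// (lt_le_trans ltEU)// leey.
have := le_trans EUV (leeD2r _ muV).
move: ltUE ltEU; rewrite -(fineK fUE) -(fineK fEU) -(fineK Efin) -!EFinM -EFinD !lte_fin lee_fin => h1 h2 h3.
have : ((2 * C0 + 1) * e = fine (mu E) / 2)%R.
  rewrite /e; move: (fine (mu E)) C1 => y; clear; move: C0 => c c1.
  by field; lra.
by rewrite -/C0 in h3 *; nra.
Qed.

(** The stopping-time decomposition that replaces the Calderon-Zygmund cubes.
    Jumps of the measure may be arbitrarily large, so that the average of [h]
    over the chosen balls has no upper bound; only the balls sticking out of
    their stars are controlled. *)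
Lemma calderon_zygmund_balls (h : T -> \bar R) :
  measurable_fun setT h -> (forall x, 0 <= h x) -> \int[mu]_x h x < +oo ->
  exists (F : nat -> set T) (I : set nat),
    [/\ forall n, I n -> balls BB (F n) /\ mu (F n) <= \int[mu]_(x in F n) h x,
        trivIset I F,
        mu ([set x | 2%:E <= h x] `\` \bigcup_(n in I) star BB (F n)) = 0,
        forall n A, I n -> balls BB A -> F n `<=` A -> ~ A `<=` star BB (F n) ->
          \int[mu]_(x in A) h x < mu A &
        \sum_(n <oo | n \in I) mu (star BB (F n)) <=
          (star_cst BB)%:E * \int[mu]_(x in \bigcup_(n in I) F n) h x].
Proof.
move=> mh h0 hoo.
pose G := [set A | balls BB A /\ mu A <= \int[mu]_(x in A) h x].
have [||F [I [FI tF Fcov Fstop]]] := @vitali_stopping G h _ mh h0 hoo.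
- by move=> A [].
- by move=> A [].
exists F, I; split => //.
- set U := \bigcup_(n in I) _.
  have mU : measurable U.
    by apply: bigcup_measurable => n /FI[/star_ball bF _]; exact: (ball_measurable bF).
  have mh2 : measurable [set x | 2%:E <= h x].
    by rewrite -[X in measurable X]setTI; exact: emeasurable_fun_c_infty.
  set X := _ `\` U; have mX : measurable X by exact: measurableD.
  have leX A : measurable A -> 2%:E * mu (X `&` A) <= \int[mu]_(x in A) h x.
    move=> mA; rewrite -integral_indicZ//; apply: ge0_le_integral => //.
    - by apply: measurable_funTS; apply/measurable_EFinP; apply: measurable_funM.
    - exact: measurable_funTS.
    - move=> x _; rewrite indicE; case: (boolP (x \in X)) => [|_]; last by rewrite mulr0.
      by rewrite inE mulr1 => -[].
  apply/eqP; rewrite eq_le measure_ge0 andbT leNgt; apply/negP => X0.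
  have Xoo : mu X < +oo.
    have := le_lt_trans (leX _ measurableT) hoo; rewrite setIT => h2.
    rewrite ltey; apply/eqP => Xoo; move: h2; rewrite Xoo.
    by rewrite gt0_muley// ltxx.
  (* a ball half of which lies in [X] has been covered *)
  have [A bA dA] := exists_dense_ball mX X0 Xoo.
  have [|n In An] := Fcov A.
    by split => //; apply: (le_trans dA); apply: leX; exact: (ball_measurable bA).
  suff XA0 : X `&` A = set0.
    by move: dA; rewrite XA0 measure0 mule0 leNgt ball_gt0.
  by rewrite -subset0 => x [[_ +] Ax]; apply; exists n => //; exact: An.
- move=> n A In bA FA; apply: contra_notT; rewrite -leNgt => leA.
  exact: (Fstop n).
- apply: sum_star_le => // n /FI[] //.
Qed.

End Covering.

(** * Averages of order r *)

Section Averages.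
Set Implicit Arguments.
Unset Strict Implicit.
Context {d : measure_display} {T : measurableType d} {R : realType}.
Context {mu : {measure set T -> \bar R}} (BB : ball_basis mu).
Variable r : R.
Hypothesis hr : 1 <= r.
Implicit Types (f g h : T -> R) (A B : set T).

Let r0 : 0 < r. Proof. exact: lt_le_trans hr. Qed.
Let rn0 : r != 0. Proof. by rewrite gt_eqF. Qed.
Let ri0 : 0 <= r^-1. Proof. by rewrite invr_ge0 ltW. Qed.

Local Notation N f := (Lnorm mu r%:E (EFin \o f%R)).

Lemma LnormE_real f : N f = ((\int[mu]_x (`|f x| `^ r)%:E) `^ r^-1)%E.
Proof. by rewrite unlock /Lnorm; congr (_ `^ _)%E; apply: eq_integral => x _; rewrite /= poweR_EFin. Qed.

Lemma measurable_normr_powR D f : measurable_fun D f ->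
  measurable_fun D (fun x => (`|f x| `^ r)%:E).
Proof.
move=> mf; apply/measurable_EFinP.
apply: (@measurableT_comp _ _ _ _ _ _ (fun x : R => x `^ r)) => //.
exact: measurableT_comp.
Qed.

Lemma le_Lnorm_norm f g : measurable_fun setT f -> measurable_fun setT g ->
  (forall x, `|f x| <= `|g x|) -> (N f <= N g)%E.
Proof.
move=> mf mg fg; rewrite (LnormE_real f) (LnormE_real g); apply: gt0_ler_poweR => //.
- by rewrite in_itv/= leey andbT integral_ge0 ?leey// => x _; rewrite lee_fin powR_ge0.
- by rewrite in_itv/= leey andbT integral_ge0 ?leey// => x _; rewrite lee_fin powR_ge0.
apply: ge0_le_integral => //; do ?exact: measurable_normr_powR.
by move=> x _; rewrite lee_fin ge0_ler_powR// ?nnegrE// ltW.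
Qed.

Lemma LnormZ_real f (c : R) : measurable_fun setT f ->
  N (fun x => c * f x) = (`|c|%:E * N f)%E.
Proof.
move=> mf; rewrite !LnormE_real.
under eq_integral do rewrite normrM powRM// EFinM.
rewrite ge0_integralZl_EFin ?powR_ge0//; last exact: measurable_normr_powR.
rewrite poweRM ?lee_fin ?powR_ge0//; last first.
  by apply: integral_ge0 => x _; rewrite lee_fin powR_ge0.
by rewrite poweR_EFin -powRrM mulfV// powRr1.
Qed.

(** Minkowski's inequality, in the form suited to entries a g + h. *)
Lemma le_Lnorm_lincomb f g h (s t : R) : measurable_fun setT f ->
  measurable_fun setT g -> measurable_fun setT h -> 0 <= s -> 0 <= t ->
  (forall x, `|f x| <= s * `|g x| + t * `|h x|) ->
  (N f <= s%:E * N g + t%:E * N h)%E.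
Proof.
move=> mf mg mh s0 t0 fgh.
have mn (u : T -> R) c : measurable_fun setT u -> measurable_fun setT (fun x => c * `|u x|).
  by move=> mu'; apply: measurable_funM => //; exact: measurableT_comp.
have NE (u : T -> R) c : measurable_fun setT u -> 0 <= c ->
    N (fun x => c * `|u x|) = (c%:E * N u)%E.
  move=> mu' c0; rewrite LnormZ_real; last exact: measurableT_comp.
  have E : (\int[mu]_x (`| `|u x| | `^ r)%:E = \int[mu]_x (`|u x| `^ r)%:E)%E.
    by apply: eq_integral => x _; rewrite normr_id.
  by rewrite (ger0_norm c0) [in LHS]LnormE_real [in RHS]LnormE_real E.
rewrite -!NE//.
apply: le_trans (minkowski_EFin _ _ _ _) => //; try exact: mn.
apply: le_Lnorm_norm => //; first by apply: measurable_funD; exact: mn.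
by move=> x; rewrite [leRHS]ger0_norm ?addr_ge0 ?mulr_ge0//; exact: fgh.
Qed.

Lemma LfunP_real f : f \in Lfun mu r%:E <-> measurable_fun setT f /\ (N f < +oo)%E.
Proof.
split; first by move=> /andP[]; rewrite !inE.
by move=> [mf Nf]; apply/andP; split; rewrite inE.
Qed.

Lemma Lfun_measurable f : f \in Lfun mu r%:E -> measurable_fun setT f.
Proof. by move=> /LfunP_real[]. Qed.

Lemma Lfun_lincomb f g h (s t : R) : measurable_fun setT f ->
  g \in Lfun mu r%:E -> h \in Lfun mu r%:E -> 0 <= s -> 0 <= t ->
  (forall x, `|f x| <= s * `|g x| + t * `|h x|) -> f \in Lfun mu r%:E.
Proof.
move=> mf /LfunP_real[mg Ng] /LfunP_real[mh Nh] s0 t0 fgh; apply/LfunP_real; split => //.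
apply: le_lt_trans (le_Lnorm_lincomb mf mg mh s0 t0 fgh) _.
by rewrite lte_add_pinfty ?lte_mul_pinfty// lee_fin.
Qed.

Lemma Lfun_le f g : measurable_fun setT f -> g \in Lfun mu r%:E ->
  (forall x, `|f x| <= `|g x|) -> f \in Lfun mu r%:E.
Proof.
move=> mf gL fg; apply: (Lfun_lincomb mf gL gL (@ler01 R) (lexx (0 : R))) => x.
by rewrite mul1r mul0r addr0.
Qed.

Lemma Lfun_lin f g (a : R) : f \in Lfun mu r%:E -> g \in Lfun mu r%:E ->
  (fun x => a * f x + g x) \in Lfun mu r%:E.
Proof.
move=> fL gL; apply: (Lfun_lincomb _ fL gL (normr_ge0 a) (@ler01 R)) => [|x].
  apply: measurable_funD (Lfun_measurable gL).
  by apply: measurable_funM (Lfun_measurable fL).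
by rewrite mul1r -normrM ler_normD.
Qed.

Lemma Lfun_indic f A : measurable A -> f \in Lfun mu r%:E ->
  (fun x => f x * \1_A x) \in Lfun mu r%:E.
Proof.
move=> mA fL; apply: (Lfun_le _ fL) => [|x].
  by apply: measurable_funM (Lfun_measurable fL) _; exact: measurable_indic.
by rewrite normrM ler_piMr// indicE; case: (_ \in _); rewrite ?normr1 ?normr0.
Qed.

(** A bounded function with bounded support, multiplied by a locally
    r-integrable one, is the shape of all the inputs of the operator. *)
Lemma Lfun_bounded_mul f h B (M : R) : balls BB B -> measurable_fun setT f ->
  measurable_fun setT h -> (forall x, `|f x| <= M) -> (forall x, f x != 0 -> B x) ->
  (\int[mu]_(x in B) (`|h x| `^ r)%:E < +oo)%E ->
  (fun x => h x * f x) \in Lfun mu r%:E.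
Proof.
move=> bB mf mh fM fB hB; have mB := ball_measurable bB.
have mhf : measurable_fun setT (fun x => h x * f x) by exact: measurable_funM.
apply/LfunP_real; split => //; rewrite LnormE_real; apply: poweR_lty.
have M0 (x : T) : 0 <= M by exact: le_trans (normr_ge0 _) (fM x).
apply: (@le_lt_trans _ _ (\int[mu]_(x in B) ((M `^ r)%:E * (`|h x| `^ r)%:E))%E).
  rewrite [leRHS]integral_mkcond; apply: ge0_le_integral => //.
  - exact: measurable_normr_powR.
  - apply/(measurable_restrictT _ _).1 => //; apply: measurable_funeM.
    by apply: measurable_funTS; exact: measurable_normr_powR.
  move=> x _; rewrite patchE; case: ifPn => [|/negP xB].
    rewrite inE => Bx; rewrite -EFinM lee_fin -powRM// ?(M0 x)//.
    apply: ge0_ler_powR; rewrite ?nnegrE ?mulr_ge0 ?(M0 x) ?(ltW r0)//.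
    by rewrite normrM mulrC ler_wpM2r.
  have -> : f x = 0.
    by apply/eqP; apply: contraT => /fB xB'; exfalso; apply: xB; rewrite inE.
  by rewrite mulr0 normr0 powR0.
rewrite ge0_integralZl_EFin ?powR_ge0//.
- by rewrite lte_mul_pinfty// lee_fin powR_ge0.
- by apply: measurable_funTS; exact: measurable_normr_powR.
Qed.

(** The real value of [avgr], meaningful for functions of class L^r. *)
Definition lavg B f : R := fine (avgr (mu:=mu) r B (EFin \o f)).

Definition ballm B : R := fine (mu B).

Lemma ballmE B : balls BB B -> mu B = (ballm B)%:E.
Proof. by move=> bB; rewrite /ballm fineK// (ball_fin_num bB). Qed.

Lemma ballm_gt0 B : balls BB B -> 0 < ballm B.
Proof. by move=> bB; rewrite -lte_fin -(ballmE bB) (ball_gt0 bB). Qed.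

Lemma avgr_Lnorm B f : balls BB B -> measurable_fun setT f ->
  avgr (mu:=mu) r B (EFin \o f) =
  (((ballm B)^-1 `^ r^-1)%:E * N (fun x => f x * \1_B x))%E.
Proof.
move=> bB mf; have B0 := ballm_gt0 bB; have mB := ball_measurable bB.
rewrite /avgr /avg LnormE_real (ballmE bB) inver gt_eqF// poweRM; last 2 first.
- by rewrite lee_fin invr_ge0 ltW.
- by apply: integral_ge0 => x _; exact: poweR_ge0.
rewrite poweR_EFin.
have -> // : (\int[mu]_(x in B) `|(EFin \o f) x| `^ r = \int[mu]_x (`|f x * \1_B x| `^ r)%:E)%E.
rewrite integral_mkcond; apply: eq_integral => x _.
rewrite patchE indicE; case: ifPn => _; first by rewrite mulr1 poweR_EFin.
by rewrite mulr0 normr0 powR0.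
Qed.

Lemma Lnorm_fin_num f : f \in Lfun mu r%:E -> N f \is a fin_num.
Proof. by move=> /LfunP_real[_ Nf]; rewrite ge0_fin_numE ?Lnorm_ge0. Qed.

Lemma lavgE B f : balls BB B -> f \in Lfun mu r%:E ->
  avgr (mu:=mu) r B (EFin \o f) = (lavg B f)%:E.
Proof.
move=> bB fL; rewrite /lavg fineK// (avgr_Lnorm bB (Lfun_measurable fL)).
by rewrite fin_numM// Lnorm_fin_num//; exact: Lfun_indic (ball_measurable bB) fL.
Qed.

Lemma lavg_ge0 B f : 0 <= lavg B f.
Proof. by rewrite /lavg fine_ge0// poweR_ge0. Qed.

Lemma le_lavg_lincomb B f g h (s t : R) : balls BB B ->
  f \in Lfun mu r%:E -> g \in Lfun mu r%:E -> h \in Lfun mu r%:E ->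
  0 <= s -> 0 <= t ->
  (forall x, B x -> `|f x| <= s * `|g x| + t * `|h x|) ->
  lavg B f <= s * lavg B g + t * lavg B h.
Proof.
move=> bB fL gL hL s0 t0 fgh; have mB := ball_measurable bB.
suff: (avgr (mu:=mu) r B (EFin \o f) <= s%:E * avgr (mu:=mu) r B (EFin \o g) +
    t%:E * avgr (mu:=mu) r B (EFin \o h))%E.
  by rewrite (lavgE bB fL) (lavgE bB gL) (lavgE bB hL) -!EFinM -EFinD lee_fin.
rewrite (avgr_Lnorm bB (Lfun_measurable fL)) (avgr_Lnorm bB (Lfun_measurable gL)).
rewrite (avgr_Lnorm bB (Lfun_measurable hL)).
set c := (ballm B)^-1 `^ r^-1.
rewrite (muleCA s%:E) (muleCA t%:E) -ge0_muleDr; last 2 first.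
- by rewrite mule_ge0// ?lee_fin// Lnorm_ge0.
- by rewrite mule_ge0// ?lee_fin// Lnorm_ge0.
apply: lee_wpmul2l; first by rewrite lee_fin powR_ge0.
apply: le_Lnorm_lincomb => //.
- exact: Lfun_measurable (Lfun_indic mB fL).
- exact: Lfun_measurable (Lfun_indic mB gL).
- exact: Lfun_measurable (Lfun_indic mB hL).
move=> x; rewrite indicE; case: (boolP (x \in B)) => [|_].
  by rewrite inE !mulr1; exact: fgh.
by rewrite !mulr0 normr0 !mulr0 addr0.
Qed.

Lemma le_lavg B f g : balls BB B -> f \in Lfun mu r%:E -> g \in Lfun mu r%:E ->
  (forall x, B x -> `|f x| <= `|g x|) -> lavg B f <= lavg B g.
Proof.
move=> bB fL gL fg; have := le_lavg_lincomb bB fL gL gL (@ler01 R) (lexx (0 : R)).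
by rewrite mul1r mul0r addr0; apply => x /fg; rewrite mul1r mul0r addr0.
Qed.

Lemma integral_lavg B f : balls BB B -> f \in Lfun mu r%:E ->
  (\int[mu]_(x in B) (`|f x| `^ r)%:E = ((lavg B f) `^ r * ballm B)%:E)%E.
Proof.
move=> bB fL; have B0 := ballm_gt0 bB.
rewrite EFinM -poweR_EFin -(lavgE bB)// /avgr -poweRrM mulVf// poweRe1; last first.
  rewrite /avg (ballmE bB) inver gt_eqF// mule_ge0 ?lee_fin ?invr_ge0 ?(ltW B0)//.
  by apply: integral_ge0 => x _; exact: poweR_ge0.
rewrite /avg (ballmE bB) inver gt_eqF// muleAC -EFinM mulVf ?gt_eqF// mul1e.
by apply: eq_integral.
Qed.

Lemma Lnorm_supported B f : balls BB B -> f \in Lfun mu r%:E ->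
  (forall x, f x != 0 -> B x) -> N f = (lavg B f * (ballm B) `^ r^-1)%:E.
Proof.
move=> bB fL fB; have B0 := ballm_gt0 bB.
have -> : lavg B f * ballm B `^ r^-1 = (lavg B f `^ r * ballm B) `^ r^-1.
  by rewrite powRM ?powR_ge0 ?ltW// -powRrM mulfV// powRr1 ?lavg_ge0.
rewrite -poweR_EFin -(integral_lavg bB fL) LnormE_real; congr (_ `^ _)%E.
rewrite [RHS]integral_mkcond; apply: eq_integral => x _.
rewrite patchE; case: ifPn => // /negP xB.
have -> : f x = 0.
  by apply/eqP; apply: contraT => /fB xB'; exfalso; apply: xB; rewrite inE.
by rewrite normr0 powR0.
Qed.

(** The average decreases when the ball grows beyond the support. *)
Lemma lavg_supported_le A B f : balls BB A -> balls BB B -> A `<=` B ->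
  f \in Lfun mu r%:E -> (forall x, f x != 0 -> A x) -> lavg B f <= lavg A f.
Proof.
move=> bA bB AB fL fA; have A0 := ballm_gt0 bA; have B0 := ballm_gt0 bB.
have : N f = N f by [].
rewrite {1}(Lnorm_supported bA fL fA) (Lnorm_supported bB fL) => [[e]|x /fA /AB//].
have hAB : ballm A `^ r^-1 <= ballm B `^ r^-1.
  apply: ge0_ler_powR; rewrite ?nnegrE ?(ltW A0) ?(ltW B0)//.
  by rewrite -lee_fin -(ballmE bA) -(ballmE bB) (le_mu_ball bA bB AB).
rewrite -(ler_pM2r (powR_gt0 r^-1 B0)) -e.
by rewrite ler_wpM2l// lavg_ge0.
Qed.

End Averages.

Arguments lavg {d T R} mu r B f.
Arguments ballm {d T R} mu B.

Global Opaque lavg ballm.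

(** * Multi-sublinear operators of weak type *)

Section Operators.
Set Implicit Arguments.
Unset Strict Implicit.
Context {d : measure_display} {T : measurableType d} {R : realType}.
Context {mu : {measure set T -> \bar R}} (BB : ball_basis mu).
Variables (r : R) (m : nat).
Hypothesis hr : 1 <= r.

(** The common part of the linear and of the sublinear case: one entry of the
    form a u + v can be split at the level of norms. *)
Definition entrywise_sublinear (V : normedModType R) (A : operator m V) : Prop :=
  forall (f : 'I_m -> T -> R) (i : 'I_m) (g : T -> R) (a : R) (x : T),
    tuple_Lr (mu:=mu) r f -> g \in Lfun mu r%:E ->
    `|A (dfwith f i (fun y => a * f i y + g y)) x|
      <= `|a| * `|A f x| + `|A (dfwith f i g) x|.

Lemma dfwith_dfwith (f : 'I_m -> T -> R) i u v :
  dfwith (dfwith f i u) i v = dfwith f i v.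
Proof.
apply/functional_extensionality_dep => j; have [<-|ij] := eqVneq i j.
  by rewrite !dfwithin.
by rewrite !dfwithout.
Qed.

Lemma dfwith_tuple_Lr (f : 'I_m -> T -> R) i u : tuple_Lr (mu:=mu) r f ->
  u \in Lfun mu r%:E -> tuple_Lr (mu:=mu) r (dfwith f i u).
Proof.
move=> fL uL j; have [<-|ij] := eqVneq i j; first by rewrite dfwithin.
by rewrite dfwithout.
Qed.

Lemma bounded_oscillation_sublinear (V : completeNormedModType R) (S : operator m R) :
  bounded_oscillation BB r V S ->
  exists (W : normedModType R) (A : operator m W),
    [/\ entrywise_sublinear A,
        forall f, tuple_Lr (mu:=mu) r f -> forall x, `|S f x| = `|A f x| &
        bounded_oscillation_conds BB r A].
Proof.
case=> [{}V {}S A linA SA condA|{}S linS condS].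
  exists V, A; split => //.
  - move=> f i g a x fL gL; rewrite linA//.
    by apply: le_trans (ler_normD _ _) _; rewrite normrZ.
  - by move=> f fL x; rewrite SA// normr_id.
exists R, S; split => // f i g a x fL gL.
case: linS => [linS|subS].
  rewrite linS//; apply: le_trans (ler_normD _ _) _.
  by rewrite normrZ.
have [hom _] := subS f i fL.
have afL : (fun y => a * f i y) \in Lfun mu r%:E.
  by apply: (Lfun_le hr _ (Lfun_scale a hr (fL i))) => [|y];
    [apply: measurable_funM => //; exact: Lfun_measurable (fL i)|rewrite /= mulrC].
have f'L := dfwith_tuple_Lr i fL afL.
have [_ /(_ g gL x)] := subS _ i f'L.
by rewrite dfwithin !dfwith_dfwith hom.
Qed.

(** Expanding every entry a_i p_i + q_i.  The entries are treated one after
    the other; [b] records the choice made for those still to come. *)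
Lemma sublinear_expansion (V : normedModType R) (A : operator m V)
    (p q : 'I_m -> T -> R) (a P Q : 'I_m -> R) (L : R) (x : T) :
  entrywise_sublinear A -> tuple_Lr (mu:=mu) r p -> tuple_Lr (mu:=mu) r q ->
  (forall b : 'I_m -> bool, `|A (fun i => if b i then p i else q i) x|
      <= L * \prod_(i < m) (if b i then P i else Q i)) ->
  `|A (fun i y => a i * p i y + q i y) x| <= L * \prod_(i < m) (`|a i| * P i + Q i).
Proof.
move=> subA pL qL H.
pose e (i : 'I_m) y := a i * p i y + q i y.
have eL i : e i \in Lfun mu r%:E by exact: Lfun_lin.
pose h j (b : 'I_m -> bool) (i : 'I_m) : T -> R :=
  if (i < j)%N then e i else if b i then p i else q i.
pose H' j (b : 'I_m -> bool) (i : 'I_m) : R :=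
  if (i < j)%N then `|a i| * P i + Q i else if b i then P i else Q i.
suff main : forall j, (j <= m)%N -> forall b, `|A (h j b) x| <= L * \prod_(i < m) H' j b i.
  have := main m (leqnn m) xpredT.
  have -> : h m xpredT = (fun i y => a i * p i y + q i y).
    by apply/funext => i; rewrite /h ltn_ord.
  by under eq_bigr do rewrite /H' ltn_ord.
have hL j b : tuple_Lr (mu:=mu) r (h j b).
  by move=> i; rewrite /h; case: ifP => // _; case: ifP.
elim=> [_ b|j IH jm b].
  exact: H.
pose i0 : 'I_m := Ordinal jm.
pose upd (c : bool) (i : 'I_m) := if i == i0 then c else b i.
have ne i : i != i0 -> (i < j.+1)%N = (i < j)%N.
  by move=> ii0; rewrite ltnS leq_eqVlt (_ : (i == j :> nat) = (i == i0))// (negbTE ii0).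
have hE c i : i != i0 -> h j.+1 b i = h j (upd c) i.
  by move=> ii0; rewrite /h ne// /upd (negbTE ii0).
have H'E c i : i != i0 -> H' j.+1 b i = H' j (upd c) i.
  by move=> ii0; rewrite /H' ne// /upd (negbTE ii0).
have hi0 c : h j (upd c) i0 = if c then p i0 else q i0.
  by rewrite /h /= ltnn /upd eqxx.
have H'i0 c : H' j (upd c) i0 = if c then P i0 else Q i0.
  by rewrite /H' /= ltnn /upd eqxx.
have e1 : h j.+1 b = dfwith (h j (upd true)) i0 (fun y => a i0 * h j (upd true) i0 y + q i0 y).
  apply/funext => i; have [<-|ii0] := eqVneq i0 i.
    by rewrite dfwithin hi0 /h /= ltnSn.
  by rewrite dfwithout//; apply: hE; rewrite eq_sym.
have e2 : dfwith (h j (upd true)) i0 (q i0) = h j (upd false).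
  apply/funext => i; have [<-|ii0] := eqVneq i0 i.
    by rewrite dfwithin hi0.
  by rewrite dfwithout//= -hE 1?eq_sym// -hE// eq_sym.
rewrite e1; apply: le_trans (subA _ _ _ _ _ (hL _ _) (qL _)) _; rewrite e2.
have jm' := ltnW jm.
apply: le_trans (lerD (ler_wpM2l (normr_ge0 _) (IH jm' _)) (IH jm' _)) _.
rewrite [X in _ <= L * X](bigD1 i0)//= [X in _ * (L * X)](bigD1 i0)//= [X in _ + L * X](bigD1 i0)//=.
rewrite !H'i0 /H' /= ltnSn.
rewrite (eq_bigr _ (fun i ii0 => esym (H'E true i ii0))).
rewrite [X in _ + L * (_ * X) <= _](eq_bigr _ (fun i ii0 => esym (H'E false i ii0))).
rewrite /H'; set X := \prod_(_ < _ | _) _.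
by rewrite le_eqVlt; apply/orP; left; apply/eqP; ring.
Qed.

Lemma measurable_superlevel (f : T -> R) (c : R) : measurable_fun setT f ->
  measurable [set x | c < f x].
Proof.
move=> mf; rewrite -[X in measurable X]setTI.
have -> : [set x | c < f x] = [set x | (c%:E < (EFin \o f) x)%E].
  by apply/seteqP; split => x; rewrite /= lte_fin.
by apply: emeasurable_fun_o_infty => //; exact/measurable_EFinP.
Qed.

(** The weak type estimate becomes scale invariant when the level is measured
    in terms of the averages over a ball containing the supports. *)
Lemma weak_level (S : operator m R) (e : R) : (0 < m)%N ->
  weak_bounded (mu:=mu) r S -> 0 < e ->
  exists2 L : R, 0 < L & forall (p : 'I_m -> T -> R) (P : set T),
    tuple_Lr (mu:=mu) r p -> balls BB P -> (forall i x, p i x != 0 -> P x) ->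
    measurable_fun setT (S p) /\
    (mu [set x | (L * \prod_(i < m) lavg mu r P (p i) < `|S p x|)%R] <= e%:E * mu P)%E.
Proof.
move=> m0 [C C0 HC] e0.
have r0 : 0 < r by exact: lt_le_trans hr.
have mr0 : 0 < m%:R :> R by rewrite ltr0n.
set s := (r / m%:R)^-1; have s0 : 0 < s by rewrite invr_gt0 divr_gt0.
have sE : s = r^-1 * m%:R by rewrite /s invf_div mulrC.
exists (C / e `^ s); first by rewrite divr_gt0// powR_gt0.
move=> p P pL bP pP; have [mS wS] := HC p pL; split => //.
have P0 := ballm_gt0 bP.
set a := \prod_(i < m) _.
have a0 : 0 <= a by apply: prodr_ge0 => i _; exact: lavg_ge0.
have prodN : (\prod_(i < m) 'N[mu]_(r%:E)[EFin \o p i] = (a * ballm mu P `^ s)%:E)%E.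
  rewrite (eq_bigr (fun i => (lavg mu r P (p i) * ballm mu P `^ r^-1)%:E)); last first.
    by move=> i _; rewrite (Lnorm_supported hr bP (pL i) (pP i)).
  rewrite prodEFin big_split/= -/a; congr ((_ * _)%:E).
  by rewrite prodr_const card_ord -powR_mulrn ?powR_ge0// -powRrM -sE.
have mlev (l : R) : measurable [set x | l < `|S p x|].
  by apply: measurable_superlevel; exact: measurableT_comp.
have key (l : R) : 0 < l -> (l%:E * (mu [set x | (l < `|S p x|)%R]) `^ s <= (C * (a * ballm mu P `^ s))%:E)%E.
  move=> l0; rewrite EFinM -prodN; apply: le_trans wS.
  by apply: ereal_sup_ubound; exists l.
(* if an average is zero then all the levels of [S p] are null *)
have [a00|an0] := eqVneq a 0.
  rewrite a00 mulr0.
  suff -> : mu [set x | 0 < `|S p x|] = 0%E by rewrite mule_ge0// lee_fin ltW.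
  have -> : [set x | 0 < `|S p x|] = \bigcup_n [set x | n.+1%:R^-1 < `|S p x|].
    apply/seteqP; split => x /=.
      move=> sx; exists (Num.trunc (`|S p x|^-1)) => //=.
      by rewrite invf_plt ?posrE// truncnS_gt.
    by move=> [n _ /=]; apply: lt_trans; rewrite invr_gt0.
  apply/eqP; rewrite eq_le measure_ge0 andbT.
  apply: le_trans (le_mu_bigcup (I:=setT) _) _; first by move=> n _; exact: mlev.
  rewrite eseries0// => n _ _; have n0 : 0 < n.+1%:R^-1 :> R by rewrite invr_gt0.
  have := key _ n0; rewrite a00 mul0r mulr0.
  move=> h; apply: (poweR_eq0_eq0 (r:=s)); first exact: measure_ge0.
  apply/eqP; rewrite eq_le poweR_ge0 andbT.
  by move: h; rewrite -lee_pdivlMl// mule0.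
have {}a0 : 0 < a by rewrite lt_neqAle eq_sym an0.
set l := C / e `^ s * a.
have l0 : 0 < l by rewrite /l mulr_gt0// divr_gt0// powR_gt0.
have := key l l0; set M := mu _ => h.
have : (M `^ s <= (e * ballm mu P)%:E `^ s)%E.
  rewrite poweR_EFin powRM ?(ltW e0) ?(ltW P0)//.
  have h' : (M `^ s <= (l^-1 * (C * (a * ballm mu P `^ s)))%:E)%E.
    by rewrite EFinM lee_pdivlMl.
  apply: le_trans h' _; rewrite lee_fin /l le_eqVlt; apply/orP; left; apply/eqP.
  by field; rewrite an0 !gt_eqF// powR_gt0.
rewrite (ballmE bP) -EFinM => h2.
have := gt0_ler_poweR (r:=s^-1) _ _ _ h2.
rewrite -!poweRrM mulfV ?(gt_eqF s0)// !poweRe1//.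
- apply; first by rewrite invr_ge0 ltW.
    by rewrite in_itv; apply/andP; split; [exact: poweR_ge0|exact: leey].
  by rewrite in_itv; apply/andP; split; [exact: poweR_ge0|exact: leey].
- by rewrite lee_fin mulr_ge0// ltW.
- exact: measure_ge0.
Qed.

End Operators.

(** * Exponentially integrable oscillations *)

Section Oscillation.
Set Implicit Arguments.
Unset Strict Implicit.
Context {d : measure_display} {T : measurableType d} {R : realType}.
Context {mu : {measure set T -> \bar R}} (BB : ball_basis mu).

Definition mean (B : set T) (b : T -> R) : R := fine (avg (mu:=mu) B (EFin \o b)).

(** [n] is a strict upper bound of the norm of [b] in osc_exp L, unfolded. *)
Definition osc_le (b : T -> R) (n : R) : Prop :=
  [/\ 0 < n, measurable_fun setT b,
      forall B, balls BB B -> mu.-integrable B (EFin \o b) &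
      forall B, balls BB B ->
        (\int[mu]_(x in B) (expR (`|b x - mean B b| / n) - 1)%:E <= mu B)%E].

Lemma measurable_expR_osc D (b : T -> R) (c n : R) : measurable_fun setT b ->
  measurable_fun D (fun x => expR (`|b x - c| / n)).
Proof.
move=> mb; apply: measurable_funTS; apply: measurableT_comp; first exact: measurable_expR.
apply: measurable_funM => //; apply: measurableT_comp => //.
exact: measurable_funB.
Qed.

Lemma osc_expL_osc_le (b : T -> R) (n : R) (B : set T) : balls BB B ->
  osc_expL BB b -> (osc_norm BB b < n%:E)%E -> osc_le b n.
Proof.
move=> bB [mb ib _] bn.
have H A : balls BB A -> 0 < n /\
    (\int[mu]_(x in A) (expR (`|b x - mean A b| / n) - 1)%:E <= mu A)%E.
  move=> bA; have mA := ball_measurable bA.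
  have : (expL_norm (mu:=mu) A (fun x => (b x - mean A b)%R) < n%:E)%E.
    by apply: le_lt_trans bn; apply: ereal_sup_ubound; exists A.
  move=> /ereal_inf_lt[_ [l [l0 Hl] <-]]; rewrite lte_fin => ln.
  have n0 := lt_trans l0 ln; split => //.
  have A0 := ballm_gt0 bA.
  move: Hl; rewrite /avg (ballmE bA) inver gt_eqF// lee_pdivrMl// mule1.
  apply: le_trans; apply: ge0_le_integral => //.
  - by move=> x _; rewrite lee_fin subr_ge0 -expR0 ler_expR mulr_ge0// invr_ge0 ltW.
  - by apply/measurable_EFinP; apply: measurable_funB => //; exact: measurable_expR_osc.
  - by apply/measurable_EFinP; apply: measurable_funB => //; exact: measurable_expR_osc.
  - move=> x _; rewrite lee_fin lerB// ler_expR ler_wpM2l//.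
    by rewrite lef_pV2 ?posrE// ltW.
split => //; first by case: (H B bB).
by move=> A bA; case: (H A bA).
Qed.

Section OscLe.
Variables (b : T -> R) (n : R).
Hypothesis bn : osc_le b n.
Let n0 : 0 < n. Proof. by case: bn. Qed.
Let mb : measurable_fun setT b. Proof. by case: bn. Qed.
Let ib B : balls BB B -> mu.-integrable B (EFin \o b). Proof. by case: bn => _ _ + _; apply. Qed.

Lemma measurable_osc D (c : R) : measurable_fun D (fun x => (`|b x - c|)%:E).
Proof.
apply: measurable_funTS; apply/measurable_EFinP; apply: measurableT_comp => //.
exact: measurable_funB.
Qed.

Lemma osc_exp B : balls BB B ->
  (\int[mu]_(x in B) (expR (`|b x - mean B b| / n))%:E <= 2%:E * mu B)%E.
Proof.
move=> bB; have mB := ball_measurable bB; have [_ _ _ /(_ B bB) H] := bn.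
have -> : (\int[mu]_(x in B) (expR (`|b x - mean B b| / n))%:E =
   \int[mu]_(x in B) ((expR (`|b x - mean B b| / n) - 1)%:E + 1%:E))%E.
  by apply: eq_integral => x _; rewrite -EFinD subrK.
rewrite ge0_integralD//; last 2 first.
- by move=> x _; rewrite lee_fin subr_ge0 -expR0 ler_expR divr_ge0// ltW.
- by apply/measurable_EFinP; apply: measurable_funB => //; exact: measurable_expR_osc.
rewrite integral_cst// mul1e (ballmE bB) -EFinM mulr_natl mulr2n EFinD.
by rewrite -(ballmE bB); exact: leeD2r.
Qed.

Lemma osc_mean_le B : balls BB B ->
  (\int[mu]_(x in B) (`|b x - mean B b|)%:E <= n%:E * mu B)%E.
Proof.
move=> bB; have mB := ball_measurable bB; have [_ _ _ /(_ B bB) H] := bn.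
rewrite -lee_pdivrMl//; apply: le_trans H.
rewrite -ge0_integralZl_EFin ?invr_ge0 ?(ltW n0)//; last exact: measurable_osc.
apply: ge0_le_integral => //.
- by move=> x _; rewrite -EFinM lee_fin mulr_ge0// invr_ge0 ltW.
- by apply: measurable_funeM; exact: measurable_osc.
- by apply/measurable_EFinP; apply: measurable_funB => //; exact: measurable_expR_osc.
- by move=> x _; rewrite -EFinM lee_fin mulrC lerBrDr addrC expR_ge1Dx.
Qed.

Lemma mean_dist_le B (c : R) : balls BB B ->
  ((`|mean B b - c| * ballm mu B)%:E <= \int[mu]_(x in B) (`|b x - c|)%:E)%E.
Proof.
move=> bB; have mB := ball_measurable bB; have B0 := ballm_gt0 bB.
have ic : mu.-integrable B (EFin \o (fun=> c)).
  apply/integrableP; split; first exact/measurable_EFinP/measurable_cst.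
  rewrite (_ : (fun x => _) = cst (`|c|%:E)); last by apply/funext.
  by rewrite integral_cst// (ballmE bB) -EFinM ltry.
have ibc : mu.-integrable B (EFin \o (fun x => b x - c)).
  by rewrite (_ : _ \o _ = (EFin \o b) \- (EFin \o (fun=> c)))%E//; exact: integrableB (ib bB) ic.
have e : (\int[mu]_(x in B) (b x - c)%:E = ((mean B b - c) * ballm mu B)%:E)%E.
  rewrite (integralB_EFin mB (ib bB) ic) [X in (_ - X)%E](integral_cst mu mB c%:E).
  rewrite (ballmE bB) mulrBl EFinB -EFinM; congr (_ - _)%E.
  have bfin : (\int[mu]_(x in B) (b x)%:E)%E \is a fin_num by exact: integrable_fin_num (ib bB).
  rewrite /mean /avg (ballmE bB) inver gt_eqF//= -(fineK bfin) -EFinM /=.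
  by rewrite mulrAC mulVf ?gt_eqF// mul1r.
apply: le_trans (le_abse_integral mu mB (measurable_int _ ibc)).
by rewrite /comp e /= normrM (gtr0_norm B0).
Qed.

(** Enlarging a ball moves the mean by at most the ratio of the measures. *)
Lemma mean_dist_ball A B : balls BB A -> balls BB B -> A `<=` B ->
  `|mean A b - mean B b| <= n * (ballm mu B / ballm mu A).
Proof.
move=> bA bB AB; have A0 := ballm_gt0 bA.
rewrite mulrA ler_pdivlMr// -lee_fin.
apply: le_trans (mean_dist_le _ bA) _.
apply: (@le_trans _ _ (\int[mu]_(x in B) (`|b x - mean B b|)%:E)%E).
  apply: ge0_subset_integral => //; [exact: ball_measurable bA|exact: ball_measurable bB|].
  exact: measurable_osc.
by apply: le_trans (osc_mean_le bB) _; rewrite (ballmE bB).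
Qed.

Lemma osc_tail B (u : R) : balls BB B ->
  (mu (B `&` [set x | (u * n < `|b x - mean B b|)%R]) <= (2 * expR (- u))%:E * mu B)%E.
Proof.
move=> bB; have mB := ball_measurable bB.
set E := B `&` _.
have mE : measurable E.
  apply: measurableI => //; apply: (@measurable_superlevel _ _ _ (fun x => `|b x - mean B b|)).
  by apply: measurableT_comp => //; exact: measurable_funB.
have h : ((expR u)%:E * mu E <= 2%:E * mu B)%E.
  apply: le_trans (osc_exp bB).
  rewrite -(integral_cst mu mE (expR u)%:E).
  apply: (@le_trans _ _ (\int[mu]_(x in E) (expR (`|b x - mean B b| / n))%:E)%E).
    apply: ge0_le_integral => //.
    - by move=> x _; rewrite lee_fin expR_ge0.
    - by apply/measurable_EFinP; exact: measurable_expR_osc.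
    - by move=> x [_ /= ux]; rewrite lee_fin ler_expR ler_pdivlMr// ltW.
  apply: ge0_subset_integral => //; last by move=> x [].
  by apply/measurable_EFinP; exact: measurable_expR_osc.
rewrite expRN EFinM muleAC muleC.
by rewrite lee_pdivlMl ?expR_gt0.
Qed.

Lemma osc_powR_lty (r c : R) B : 1 <= r -> balls BB B ->
  (\int[mu]_(x in B) (`|b x - c| `^ r)%:E < +oo)%E.
Proof.
move=> hr bB; have mB := ball_measurable bB.
have r0 : 0 < r by exact: lt_le_trans hr.
have zr (z : R) : 0 <= z -> z `^ r <= r `^ r * expR z.
  move=> z0; have -> : expR z = (expR (z / r)) `^ r.
    by rewrite -expRM divfK// gt_eqF.
  rewrite -powRM ?expR_ge0 ?(ltW r0)//; apply: ge0_ler_powR; rewrite ?nnegrE ?(ltW r0)//.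
    by rewrite mulr_ge0 ?expR_ge0// ltW.
  rewrite -ler_pdivrMl// mulrC; apply: le_trans (expR_ge1Dx _).
  by rewrite lerDr.
pose K := n `^ r * r `^ r * expR (`|mean B b - c| / n).
apply: (@le_lt_trans _ _ (K%:E * \int[mu]_(x in B) (expR (`|b x - mean B b| / n))%:E)%E).
  rewrite -ge0_integralZl_EFin ?mulr_ge0 ?powR_ge0 ?expR_ge0//; last first.
    by apply/measurable_EFinP; exact: measurable_expR_osc.
  apply: ge0_le_integral => //.
  - by apply: measurable_normr_powR; apply: measurable_funTS; exact: measurable_funB.
  - by apply: measurable_funeM; apply/measurable_EFinP; exact: measurable_expR_osc.
  move=> x _; rewrite -EFinM lee_fin /K -[leRHS]mulrA -expRD -mulrDl.
  have -> : `|b x - c| `^ r = n `^ r * (`|b x - c| / n) `^ r.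
    by rewrite -powRM ?divr_ge0 ?(ltW n0)// mulrC divfK// gt_eqF.
  rewrite -mulrA ler_wpM2l ?powR_ge0//.
  apply: le_trans (zr _ _) _; first by rewrite divr_ge0// ltW.
  rewrite ler_wpM2l ?powR_ge0// ler_expR ler_wpM2r ?invr_ge0 ?(ltW n0)//.
  by rewrite [leRHS]addrC; apply: le_trans (ler_normD _ _); rewrite addrA subrK.
apply: lte_mul_pinfty; rewrite ?lee_fin ?mulr_ge0 ?powR_ge0 ?expR_ge0//.
by apply: le_lt_trans (osc_exp bB) _; rewrite (ballmE bB) -EFinM ltry.
Qed.

End OscLe.

End Oscillation.

Arguments mean {d T R} mu B b.

Global Opaque mean.

(** * Exceptional sets of weak type *)

Section ExceptionalSets.
Set Implicit Arguments.
Unset Strict Implicit.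
Context {d : measure_display} {T : measurableType d} {R : realType}.
Context {mu : {measure set T -> \bar R}} (BB : ball_basis mu).
Local Notation C0 := (star_cst BB).

Lemma star_cst_gt0 : 0 < C0.
Proof. exact: lt_le_trans (star_cst_ge1 BB). Qed.

Lemma ballm_star B : balls BB B -> ballm mu (star BB B) <= C0 * ballm mu B.
Proof.
move=> bB; rewrite -lee_fin EFinM -!(ballmE (BB:=BB))//; last exact: star_ball.
exact: le_mu_star.
Qed.

Lemma le_ballm A B : balls BB A -> balls BB B -> A `<=` B -> ballm mu A <= ballm mu B.
Proof.
move=> bA bB AB; rewrite -lee_fin -(ballmE bA) -(ballmE bB).
exact: (le_mu_ball bA bB).
Qed.

(** Weak type of the maximal function of order r, for a function supported in
    [P] and at a level proportional to its average over [P]. *)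
Lemma maximal_exceptional_set (r K : R) (phi : T -> R) (P : set T) :
  1 <= r -> 0 < K -> balls BB P -> phi \in Lfun mu r%:E ->
  (forall x, phi x != 0 -> P x) ->
  exists U, [/\ measurable U, (mu U <= (C0 * (K `^ r)^-1)%:E * mu P)%E &
    forall G, balls BB G -> ~ G `<=` U -> lavg mu r G phi <= K * lavg mu r P phi].
Proof.
move=> hr K0 bP phiL phiP; have r0 : 0 < r by exact: lt_le_trans hr.
have mphi := Lfun_measurable phiL.
have mh : measurable_fun setT (fun x => (`|phi x| `^ r)%:E) by exact: measurable_normr_powR.
have intP : (\int[mu]_x (`|phi x| `^ r)%:E = (lavg mu r P phi `^ r * ballm mu P)%:E)%E.
  rewrite -(integral_lavg hr bP phiL) [RHS]integral_mkcond; apply: eq_integral => x _.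
  rewrite patchE; case: ifPn => // /negP xB.
  have -> : phi x = 0.
    by apply/eqP; apply: contraT => /phiP xB'; exfalso; apply: xB; rewrite inE.
  by rewrite normr0 powR0// gt_eqF.
have intG G : balls BB G -> lavg mu r G phi `^ r * ballm mu G <= lavg mu r P phi `^ r * ballm mu P.
  move=> bG; rewrite -lee_fin -intP -(integral_lavg hr bG phiL).
  by apply: ge0_subset_integral => //; exact: ball_measurable bG.
have [a0|an0] := eqVneq (lavg mu r P phi) 0.
  exists set0; split => //.
    by rewrite measure0 mule_ge0// lee_fin mulr_ge0 ?invr_ge0 ?powR_ge0// ltW// star_cst_gt0.
  move=> G bG _; have := intG G bG; rewrite a0 powR0 ?gt_eqF// mul0r mulr0.
  rewrite pmulr_lle0 ?(ballm_gt0 bG)// => h.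
  have : lavg mu r G phi `^ r = 0 by apply/eqP; rewrite eq_le h powR_ge0.
  by move=> /powR_eq0_eq0 ->.
set a := lavg mu r P phi in an0 intP intG *.
have a0 : 0 < a by rewrite lt_neqAle eq_sym an0 lavg_ge0.
have Ka : 0 < (K * a) `^ r by rewrite powR_gt0// mulr_gt0.
pose h x := (((K * a) `^ r)^-1%:E * (`|phi x| `^ r)%:E)%E.
pose G := [set A | balls BB A /\ K * a < lavg mu r A phi].
have [|||||U [mU GU muU]] := @vitali_cover _ _ _ mu BB G h _.
- by move=> A [].
- exact: measurable_funeM.
- by move=> x; rewrite mule_ge0// lee_fin ?powR_ge0// invr_ge0 ltW.
- rewrite ge0_integralZl_EFin ?invr_ge0 ?(ltW Ka)// intP -EFinM ltry//.
- move=> A [bA hA]; have mA := ball_measurable bA.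
  rewrite ge0_integralZl_EFin ?invr_ge0 ?(ltW Ka)//; last exact: measurable_funTS.
  rewrite (integral_lavg hr bA phiL) -EFinM (ballmE bA) lee_fin mulrA.
  rewrite ler_peMl ?(ltW (ballm_gt0 bA))// mulrC ler_pdivlMr// mul1r.
  by apply: ge0_ler_powR; rewrite ?nnegrE ?(ltW r0) ?lavg_ge0 ?(ltW hA) ?mulr_ge0 ?(ltW K0) ?(ltW a0).
exists U; split => //.
  apply: le_trans muU _; rewrite ge0_integralZl_EFin ?invr_ge0 ?(ltW Ka)// intP.
  rewrite (ballmE bP) -!EFinM lee_fin powRM ?(ltW K0) ?(ltW a0)//.
  rewrite le_eqVlt; apply/orP; left; apply/eqP.
  by field; rewrite !gt_eqF// powR_gt0.
move=> A bA nAU; rewrite leNgt; apply/negP => hA; apply: nAU; apply: GU; split => //.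
Qed.

(** A ball over which the mean of [b] is far from [c] carries a large integral
    of |b - c|, so these balls are covered by a set of small measure. *)
Lemma osc_exceptional_set (b : T -> R) (n c l : R) (Q : set T) :
  osc_le BB b n -> 0 < l -> balls BB Q ->
  exists U, [/\ measurable U,
    (mu U <= (C0 / l)%:E * \int[mu]_(x in Q) (`|b x - c|)%:E)%E &
    forall G, balls BB G -> G `<=` Q -> ~ G `<=` U -> `|mean mu G b - c| <= l].
Proof.
move=> bn l0 bQ; have mQ := ball_measurable bQ.
have mo D : measurable_fun D (fun x => (`|b x - c|)%:E) by exact: measurable_osc bn _ _.
pose h x := ((l^-1)%:E * ((fun x => (`|b x - c|)%:E) \_ Q) x)%E.
have hE A : measurable A -> A `<=` Q ->
    (\int[mu]_(x in A) h x = (l^-1)%:E * \int[mu]_(x in A) (`|b x - c|)%:E)%E.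
  move=> mA AQ; rewrite ge0_integralZl_EFin ?invr_ge0 ?(ltW l0)//.
  - congr (_ * _)%E; apply: eq_integral => x /[!inE] Ax.
    by rewrite patchE mem_set//; exact: AQ.
  - by move=> x _; rewrite patchE; case: ifP.
  - by apply: measurable_funTS; apply/(measurable_restrictT _ _).1.
pose G := [set A | [/\ balls BB A, A `<=` Q & l < `|mean mu A b - c|]].
have hT : (\int[mu]_x h x = (l^-1)%:E * \int[mu]_(x in Q) (`|b x - c|)%:E)%E.
  rewrite -hE// [RHS]integral_mkcond; apply: eq_integral => x _.
  by rewrite /h !patchE; case: ifP => //; rewrite mule0.
have [|||||U [mU GU muU]] := @vitali_cover _ _ _ mu BB G h _.
- by move=> A [].
- by apply: measurable_funeM; apply/(measurable_restrictT _ _).1.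
- move=> x; rewrite mule_ge0// ?lee_fin ?invr_ge0 ?(ltW l0)//.
  by rewrite patchE; case: ifP.
- rewrite hT lte_mul_pinfty ?lee_fin ?invr_ge0 ?(ltW l0)//.
  have := osc_powR_lty bn c (lexx 1) bQ.
  by under eq_integral do rewrite powRr1//.
- move=> A [bA AQ hA]; have mA := ball_measurable bA.
  rewrite hE// (ballmE bA) lee_pdivlMl// -EFinM.
  apply: le_trans (mean_dist_le bn c bA); rewrite lee_fin ler_wpM2r ?(ltW hA)//.
  exact: ltW (ballm_gt0 bA).
exists U; split => //.
  by apply: le_trans muU _; rewrite hT muleA -EFinM.
move=> A bA AQ nAU; rewrite leNgt; apply/negP => hA; apply: nAU; apply: GU; split => //.
Qed.

Lemma finite_exceptional_set (I : finType) (U : I -> set T) (e : R) (B : set T) :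
  0 <= e -> balls BB B -> (forall i, measurable (U i) /\ (mu (U i) <= e%:E * mu B)%E) ->
  let E := \bigcup_(i in [set: I]) U i in
  measurable E /\ (mu E <= (#|I|%:R * e)%:E * mu B)%E.
Proof.
move=> e0 bB HU E.
have EE : E = \big[setU/set0]_(i <- enum I) U i.
  by rewrite -bigcup_seq; apply/seteqP; split => x [i _ Ux]; exists i => //=; rewrite mem_enum.
split; first by rewrite EE; apply: bigsetU_measurable => i _; case: (HU i).
rewrite EE cardE; elim: (enum I) => [|i s IH].
  by rewrite big_nil measure0 mul0r mul0e.
rewrite big_cons; apply: (@le_trans _ _ (mu (U i) + mu (\big[setU/set0]_(j <- s) U j))%E).
  apply: measureU2; first by case: (HU i).
  by apply: bigsetU_measurable => j _; case: (HU j).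
rewrite /= -natr1 mulrDl mul1r addrC EFinD ge0_muleDl ?lee_fin ?mulr_ge0//.
by apply: leeD => //; case: (HU i).
Qed.

End ExceptionalSets.

(** * Multipliers frozen at a value *)

Section Descent.
Set Implicit Arguments.
Unset Strict Implicit.
Context {d : measure_display} {T : measurableType d} {R : realType}.
Context {mu : {measure set T -> \bar R}} (BB : ball_basis mu).
Variables (r : R) (m : nat).
Hypothesis hr : 1 <= r.
Local Notation C0 := (star_cst BB).

(** Inputs of the commutator frozen at a value [c] of the multipliers:
    multiplication by c_i - b_i in the entries of [tau].  Taking [c] to be the
    values at a point gives the commutator there, taking means of [b] gives
    functions under control. *)
Definition frozen (tau : {set 'I_m}) (b : 'I_m -> T -> R) (c : 'I_m -> R)
    (g : 'I_m -> T -> R) : 'I_m -> T -> R :=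
  fun i y => (if i \in tau then c i - b i y else 1) * g i y.

Definition means (b : 'I_m -> T -> R) (P : set T) : 'I_m -> R :=
  fun i => mean mu P (b i).

Definition scale (tau : {set 'I_m}) (n : 'I_m -> R) (i : 'I_m) : R :=
  if i \in tau then n i else 1.

Definition gap (tau : {set 'I_m}) (c c' : 'I_m -> R) (i : 'I_m) : R :=
  if i \in tau then c' i - c i else 0.

(** What the i-th entry contributes at the scale of [P] once b_i is normalized
    by n_i.  Products of amplitudes are all that the iteration has to compare
    with a maximal function. *)
Definition amplitude (tau : {set 'I_m}) (b : 'I_m -> T -> R) (n : 'I_m -> R)
    (f : 'I_m -> T -> R) (P : set T) (i : 'I_m) : R :=
  lavg mu r P (f i) + (scale tau n i)^-1 * lavg mu r P (frozen tau b (means b P) f i).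

Definition close (tau : {set 'I_m}) (n : 'I_m -> R) (v : R) (c c' : 'I_m -> R) : Prop :=
  forall i, i \in tau -> `|c' i - c i| <= v * n i.

Lemma restr_frozen tau b c g E :
  restr (frozen tau b c g) E = frozen tau b c (restr g E).
Proof. by apply/funext => i; apply/funext => y; rewrite /restr /frozen mulrA. Qed.

Lemma frozen_shift tau b c c' g :
  frozen tau b c' g = (fun i y => gap tau c c' i * g i y + frozen tau b c g i y).
Proof.
apply/funext => i; apply/funext => y; rewrite /frozen /gap.
by case: ifP => _; ring.
Qed.

Section Fixed.
Variables (tau : {set 'I_m}) (b : 'I_m -> T -> R) (n : 'I_m -> R).
Variables (f : 'I_m -> T -> R) (M : 'I_m -> R) (B0 : set T).
Hypothesis bn : forall i, i \in tau -> osc_le BB (b i) (n i).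
Hypothesis bB0 : balls BB B0.
Hypothesis mf : forall i, measurable_fun setT (f i).
Hypothesis fM : forall i x, `|f i x| <= M i.
Hypothesis fB0 : forall i x, f i x != 0 -> B0 x.

Definition dominated (g : 'I_m -> T -> R) : Prop :=
  forall i, measurable_fun setT (g i) /\ forall y, `|g i y| <= `|f i y|.

Local Notation fr := (frozen tau b).
Local Notation sc := (scale tau n).
Local Notation amp := (amplitude tau b n f).

Lemma dominated_self : dominated f.
Proof. by move=> i; split. Qed.

Lemma dominated_restr g E : measurable E -> dominated g -> dominated (restr g E).
Proof.
move=> mE dg i; have [mg gf] := dg i; split.
  by apply: measurable_funM => //; exact: measurable_indic.
move=> y; apply: le_trans (gf y); rewrite /restr normrM ler_piMr// indicE.
by case: (_ \in _); rewrite ?normr1 ?normr0.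
Qed.

Lemma dominated_Lr g i : dominated g -> g i \in Lfun mu r%:E.
Proof.
move=> dg; have [mg gf] := dg i.
have gM x : `|g i x| <= M i by exact: le_trans (gf x) (fM i x).
have gB x : g i x != 0 -> B0 x.
  move=> gx; apply: (fB0 (i:=i)); apply: contraNneq gx => fx.
  by have := gf x; rewrite fx normr0 normr_le0.
rewrite (_ : g i = fun x => 1 * g i x); last by apply/funext => x; rewrite mul1r.
apply: (Lfun_bounded_mul (BB:=BB) hr (h:=fun=> 1) bB0 mg _ gM gB) => //.
rewrite (_ : (fun x : T => _) = cst 1%E); last first.
  by apply/funext => y; rewrite normr1 powR1.
by rewrite (integral_cst mu (ball_measurable bB0)) (ballmE bB0) mul1e ltry.
Qed.

Lemma frozen_Lr c g i : dominated g -> fr c g i \in Lfun mu r%:E.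
Proof.
move=> dg; have [mg gf] := dg i.
have [itau|itau] := boolP (i \in tau); last first.
  rewrite (_ : fr c g i = g i); first exact: dominated_Lr.
  by apply/funext => x; rewrite /frozen (negbTE itau) mul1r.
have gM x : `|g i x| <= M i by exact: le_trans (gf x) (fM i x).
have gB x : g i x != 0 -> B0 x.
  move=> gx; apply: (fB0 (i:=i)); apply: contraNneq gx => fx.
  by have := gf x; rewrite fx normr0 normr_le0.
rewrite (_ : fr c g i = fun x => (c i - b i x) * g i x); last first.
  by apply/funext => x; rewrite /frozen itau.
have [_ mb _ _] := bn itau.
apply: (Lfun_bounded_mul (BB:=BB) hr (h:=fun y => c i - b i y) bB0 mg _ gM gB).
  exact: measurable_funB.
under eq_integral do rewrite distrC.
exact: (osc_powR_lty (bn itau)).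
Qed.

Lemma scale_gt0 i : 0 < sc i.
Proof. by rewrite /scale; case: ifPn => // /bn[]. Qed.

(** The triangle inequality bounds the average of an entry frozen at [c'] by
    this quantity, in which only averages of functions independent of [c']
    appear: exceptional sets can be chosen before [c'] is known. *)
Definition shifted (P : set T) (c c' : 'I_m -> R) (g : 'I_m -> T -> R) (i : 'I_m) : R :=
  `|gap tau c c' i| * lavg mu r P (g i) + lavg mu r P (fr c g i).

Lemma shifted_ge0 P c c' g i : 0 <= shifted P c c' g i.
Proof. by rewrite addr_ge0 ?mulr_ge0 ?lavg_ge0. Qed.

Lemma lavg_frozen_le P c c' g i : balls BB P -> dominated g ->
  lavg mu r P (fr c' g i) <= shifted P c c' g i.
Proof.
move=> bP dg; have h : forall x, P x -> `|fr c' g i x| <= `|gap tau c c' i| * `|g i x| + 1 * `|fr c g i x|.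
  by move=> x _; rewrite (frozen_shift _ _ c c') mul1r -normrM ler_normD.
have := le_lavg_lincomb hr bP (frozen_Lr c' i dg) (dominated_Lr i dg) (frozen_Lr c i dg)
  (normr_ge0 _) ler01 h.
by rewrite mul1r.
Qed.

Lemma amplitude_ge0 P i : 0 <= amp P i.
Proof. by rewrite addr_ge0 ?mulr_ge0 ?invr_ge0 ?lavg_ge0 ?(ltW (scale_gt0 i)). Qed.

Lemma shifted_le_amplitude P c' v g i : balls BB P -> dominated g -> 0 <= v ->
  close tau n v (means b P) c' ->
  shifted P (means b P) c' g i <= sc i * (if i \in tau then 1 + v else 1) * amp P i.
Proof.
move=> bP dg v0 cl; have [mg gf] := dg i.
have h1 : lavg mu r P (g i) <= lavg mu r P (f i).
  exact: (le_lavg hr bP (dominated_Lr i dg) (dominated_Lr i dominated_self)).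
have h2 : lavg mu r P (fr (means b P) g i) <= lavg mu r P (fr (means b P) f i).
  apply: (le_lavg hr bP (frozen_Lr _ i dg) (frozen_Lr _ i dominated_self)) => x _.
  by rewrite /frozen !normrM ler_wpM2l.
have s0 := scale_gt0 i.
have f0 := lavg_ge0 (mu:=mu) r P (f i).
have q0 := lavg_ge0 (mu:=mu) r P (fr (means b P) f i).
have g0 := lavg_ge0 (mu:=mu) r P (g i).
rewrite /shifted /amplitude.
move: (lavg mu r P (g i)) (lavg mu r P (f i)) (lavg mu r P (fr (means b P) g i)) 
  (lavg mu r P (fr (means b P) f i)) h1 h2 f0 q0 g0 => Lg Lf Qg Qf h1 h2 f0 q0 g0.
rewrite mulrAC mulrDr mulrA mulfV ?gt_eqF// mul1r [leRHS]mulrC mulrDr.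
rewrite /gap /scale; case: ifPn => itau; last first.
  by rewrite normr0 mul0r add0r !mul1r (le_trans h2)// lerDr.
have ni : 0 < n i by move: s0; rewrite /scale itau.
have hg := cl i itau.
apply: lerD; last first.
  by apply: le_trans h2 _; rewrite ler_peMl// lerDl.
apply: (@le_trans _ _ ((v * n i) * Lf)).
  by apply: ler_pM.
by rewrite mulrA ler_wpM2r// ler_wpM2r ?(ltW ni)// lerDr.
Qed.

(** Freezing at a value at distance [v n_i] from the means instead of at the
    means costs a factor 1 + v for each multiplier. *)
Lemma prod_shifted_le P c' v g : balls BB P -> dominated g -> 0 <= v ->
  close tau n v (means b P) c' ->
  \prod_(i < m) shifted P (means b P) c' g i <=
    \prod_(i in tau) n i * (1 + v) ^+ #|tau| * \prod_(i < m) amp P i.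
Proof.
move=> bP dg v0 cl.
have -> : \prod_(i in tau) n i * (1 + v) ^+ #|tau| * \prod_(i < m) amp P i =
    \prod_(i < m) (sc i * (if i \in tau then 1 + v else 1) * amp P i).
  rewrite !big_split/=; congr (_ * _ * _).
    by rewrite big_mkcond.
  by rewrite -prodr_const big_mkcond.
apply: ler_prod => i _; rewrite shifted_ge0/=.
exact: shifted_le_amplitude.
Qed.

End Fixed.
End Descent.

(** * The stopping-time iteration *)

Section OneStep.
Set Implicit Arguments.
Unset Strict Implicit.
Context {d : measure_display} {T : measurableType d} {R : realType}.
Context {mu : {measure set T -> \bar R}} (BB : ball_basis mu).
Variables (r : R) (m : nat).
Hypothesis hr : 1 <= r.
Local Notation C0 := (star_cst BB).
Variables (V : normedModType R) (A : operator (T:=T) (R:=R) m V) (S : operator (T:=T) (R:=R) m R).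
Hypothesis subA : entrywise_sublinear (mu:=mu) r A.
Hypothesis SA : forall f, tuple_Lr (mu:=mu) r f -> forall x, `|S f x| = `|A f x|.
Variables (e1 lam K : R).
Hypothesis e10 : 0 < e1.
Hypothesis lam0 : 0 < lam.
Hypothesis Hlam : forall (p : 'I_m -> T -> R) (P : set T),
  tuple_Lr (mu:=mu) r p -> balls BB P -> (forall i x, p i x != 0 -> P x) ->
  measurable_fun setT (S p) /\
  (mu [set x | (lam * \prod_(i < m) lavg mu r P (p i) < `|S p x|)%R] <= e1%:E * mu P)%E.
Hypothesis K1 : 1 <= K.
Hypothesis HK : 2 * C0 ^+ 6 <= e1 * K.

Variables (tau : {set 'I_m}) (b : 'I_m -> T -> R) (n : 'I_m -> R).
Variables (f : 'I_m -> T -> R) (M : 'I_m -> R) (B0 : set T).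
Hypothesis bn : forall i, i \in tau -> osc_le BB (b i) (n i).
Hypothesis bB0 : balls BB B0.
Hypothesis mf : forall i, measurable_fun setT (f i).
Hypothesis fM : forall i x, `|f i x| <= M i.
Hypothesis fB0 : forall i x, f i x != 0 -> B0 x.
Local Notation fr := (frozen tau b).
Local Notation sh := (shifted (mu:=mu) r tau b).
Local Notation amp := (amplitude (mu:=mu) r tau b n f).
Local Notation dom := (dominated f).
(* The exceptional set of a ball has one piece for each mixture of frozen and
   unfrozen inputs, and three more for each entry. *)
Local Notation pieces := ({ffun 'I_m -> bool} + ('I_m + ('I_m + 'I_m)))%type.

Let frL c g i : dom g -> fr c g i \in Lfun mu r%:E.
Proof. exact: (frozen_Lr hr bn bB0 fM fB0). Qed.
Let gL g i : dom g -> g i \in Lfun mu r%:E.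
Proof. exact: (dominated_Lr hr bB0 fM fB0). Qed.
Let C1 : 1 <= C0. Proof. exact: star_cst_ge1. Qed.
Let C00 : 0 < C0. Proof. exact: star_cst_gt0. Qed.
Let K0 : 0 < K. Proof. exact: lt_le_trans K1. Qed.

Lemma cst_maximal_le : C0 * (K `^ r)^-1 <= e1.
Proof.
rewrite ler_pdivrMr ?powR_gt0//.
have h : K <= K `^ r by rewrite le1r_powR.
apply: (@le_trans _ _ (e1 * K)); last by rewrite ler_wpM2l// ltW.
apply: le_trans HK; apply: (@le_trans _ _ (C0 ^+ 6)); first by rewrite ler_eXnr.
by rewrite ler_peMl// ?ler1n// exprn_ge0// ltW.
Qed.

(** Three stars: the successor of a stopping ball inside [D], when it is not
    large enough to see all of the star of [D], has its star in the third star
    of [D]. *)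
Lemma osc_star3_le D i : balls BB D -> i \in tau ->
  (\int[mu]_(x in star BB (star BB (star BB D)))
     (`|b i x - means (mu:=mu) b (star BB D) i|)%:E <=
   (n i * (2 * C0 ^+ 6) * ballm mu D)%:E)%E.
Proof.
move=> bD itau; have bi := bn itau; have [ni mbi ibi _] := bi.
have b1 := star_ball bD; have b2 := star_ball b1; have b3 := star_ball b2.
set Q := star BB (star BB (star BB D)).
have mQ := ball_measurable b3.
set c := means b (star BB D) i.
have D0 := ballm_gt0 bD; have D10 := ballm_gt0 b1; have Q0 := ballm_gt0 b3.
have DD1 : ballm mu D <= ballm mu (star BB D) by apply: (le_ballm bD b1); exact: (sub_star_self bD).
have QD : ballm mu Q <= C0 ^+ 3 * ballm mu D.
  apply: le_trans (ballm_star b2) _; rewrite !exprS expr0 mulr1 -!mulrA ler_wpM2l ?(ltW C00)//.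
  apply: le_trans (ballm_star b1) _; rewrite ler_wpM2l ?(ltW C00)//.
  exact: ballm_star.
have D1Q : star BB D `<=` Q.
  exact: subset_trans (sub_star_self b1) (sub_star_self b2).
have cQ : `|c - mean mu Q (b i)| <= n i * C0 ^+ 3.
  apply: le_trans (mean_dist_ball bi b1 b3 D1Q) _.
  rewrite ler_wpM2l ?(ltW ni)// ler_pdivrMr//.
  by apply: le_trans QD _; rewrite ler_wpM2l// exprn_ge0// ltW.
apply: (@le_trans _ _ (\int[mu]_(x in Q) ((`|b i x - mean mu Q (b i)|)%:E + (n i * C0 ^+ 3)%:E))%E).
  apply: ge0_le_integral => //.
  - exact: measurable_osc bi _ _.
  - apply: emeasurable_funD; first exact: measurable_osc bi _ _.
    exact: measurable_cst.
  - move=> x _; rewrite -EFinD lee_fin.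
    have -> : b i x - c = (b i x - mean mu Q (b i)) - (c - mean mu Q (b i)) by rewrite opprB addrA subrK.
    by apply: le_trans (ler_normB _ _) _; rewrite lerD2l.
have c30 : 0 <= n i * C0 ^+ 3 by rewrite mulr_ge0 ?(ltW ni)// exprn_ge0// ltW.
rewrite ge0_integralD//; last exact: measurable_osc bi _ _.
rewrite (integral_cst mu mQ (n i * C0 ^+ 3)%:E).
apply: le_trans (leeD (osc_mean_le bi b3) (lexx _)) _.
rewrite (ballmE b3) -!EFinM -EFinD lee_fin -/Q.
have CC : 1 <= C0 ^+ 3 by rewrite exprn_ege1.
have e6 : C0 ^+ 6 = C0 ^+ 3 * C0 ^+ 3 by rewrite -exprD.
rewrite e6; move: (C0 ^+ 3) (ballm mu Q) (ballm mu D) QD D0 CC => c3 q dd qd d0 cc.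
have -> : n i * q + n i * c3 * q = n i * (q * (1 + c3)) by ring.
rewrite -[leRHS]mulrA ler_wpM2l ?(ltW ni)//.
apply: (@le_trans _ _ (c3 * dd * (2 * c3))); last by rewrite le_eqVlt; apply/orP; left; apply/eqP; ring.
have cd : 0 <= c3 * dd by rewrite mulr_ge0 ?(ltW d0)// (le_trans _ cc).
apply: (@le_trans _ _ (c3 * dd * (1 + c3))).
  by rewrite ler_wpM2r// addr_ge0// (le_trans _ cc).
by rewrite ler_wpM2l//; lra.
Qed.

Definition exceptional (D : set T) (g : 'I_m -> T -> R) (E : set T) : Prop :=
  let c := means (mu:=mu) b (star BB D) in
  [/\ measurable E, (mu E <= (#|{: pieces}|%:R * (e1 * C0))%:E * mu D)%E,
    forall x, ~ E x -> forall c',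
      `|A (fr c' g) x| <= lam * \prod_(i < m) sh (star BB D) c c' g i,
    forall G, balls BB G -> ~ G `<=` E -> forall c' i,
      lavg mu r G (fr c' g i) <= K * sh (star BB D) c c' g i &
    forall G, balls BB G -> ~ G `<=` E -> G `<=` star BB (star BB (star BB D)) ->
      close tau n K c (means (mu:=mu) b G)].

(** Each estimate fails on a set of measure a small multiple of that of [D]:
    the one of the operator by its weak type on the mixtures of [g] and of the
    frozen inputs, those of the averages and of the means by the weak type of
    maximal functions, as [K] is large. *)
Lemma exceptional_set D g : balls BB D -> dom g ->
  (forall i x, g i x != 0 -> star BB D x) ->
  exists E, exceptional D g E.
Proof.
move=> bD dg gD; set c := means (mu:=mu) b (star BB D).
have b1 := star_ball bD; have b2 := star_ball b1; have b3 := star_ball b2.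
pose mix (be : 'I_m -> bool) i := if be i then g i else fr c g i.
have mixL be : tuple_Lr (mu:=mu) r (mix be).
  by move=> i; rewrite /mix; case: (be i); [exact: gL|exact: frL].
have frD i x : fr c g i x != 0 -> star BB D x.
  by move=> h; apply: (gD i); apply: contraNneq h => gx; rewrite /frozen gx mulr0.
have mixD be i x : mix be i x != 0 -> star BB D x.
  by rewrite /mix; case: (be i); [exact: gD|exact: frD].
pose good (i : pieces) (U : set T) := match i with
  | inl be => forall x, ~ U x ->
      `|A (mix be) x| <= lam * \prod_(i < m) lavg mu r (star BB D) (mix be i)
  | inr (inl i) => forall G, balls BB G -> ~ G `<=` U ->
      lavg mu r G (g i) <= K * lavg mu r (star BB D) (g i)
  | inr (inr (inl i)) => forall G, balls BB G -> ~ G `<=` U ->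
      lavg mu r G (fr c g i) <= K * lavg mu r (star BB D) (fr c g i)
  | inr (inr (inr i)) => i \in tau -> forall G, balls BB G ->
      G `<=` star BB (star BB (star BB D)) -> ~ G `<=` U ->
      `|means (mu:=mu) b G i - c i| <= K * n i
  end.
have star1 : (e1%:E * mu (star BB D) <= (e1 * C0)%:E * mu D)%E.
  rewrite (ballmE bD) (ballmE b1) -!EFinM lee_fin -[leRHS]mulrA ler_wpM2l ?(ltW e10)//.
  exact: ballm_star.
have max1 : ((C0 * (K `^ r)^-1)%:E * mu (star BB D) <= (e1 * C0)%:E * mu D)%E.
  apply: le_trans star1; rewrite lee_wpmul2r// lee_fin; exact: cst_maximal_le.
have /choice[U HU] : forall i : pieces, exists U,
    [/\ measurable U, (mu U <= (e1 * C0)%:E * mu D)%E & good i U].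
  move=> [be|[i|[i|i]]].
  - have [mS muS] := Hlam (mixL be) b1 (mixD be).
    exists [set x | lam * \prod_(i < m) lavg mu r (star BB D) (mix be i) < `|S (mix be) x|]; split.
    + by apply: (@measurable_superlevel _ _ _ (fun x => `|S (mix be) x|)); exact: measurableT_comp.
    + exact: le_trans muS star1.
    + by move=> x /negP; rewrite -leNgt SA.
  - have [U [mU muU UP]] := maximal_exceptional_set hr K0 b1 (gL i dg) (gD i).
    exists U; split; [exact: mU|exact: le_trans muU max1|exact: UP].
  - have [U [mU muU UP]] := maximal_exceptional_set hr K0 b1 (frL c i dg) (frD i).
    exists U; split; [exact: mU|exact: le_trans muU max1|exact: UP].
  - have [itau|itau] := boolP (i \in tau); last first.
      exists set0; split => //; last by rewrite /good (negbTE itau).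
      by rewrite measure0 mule_ge0// lee_fin mulr_ge0 ?(ltW e10) ?(ltW C00).
    have ni : 0 < n i by case: (bn itau).
    have Kn : 0 < K * n i by rewrite mulr_gt0.
    have [U [mU muU UP]] := osc_exceptional_set (c i) (bn itau) Kn b3.
    exists U; split; [exact: mU| |by move=> _ G bG GD nGU; exact: UP].
    apply: le_trans muU _.
    apply: (@le_trans _ _ ((C0 / (K * n i))%:E * (n i * (2 * C0 ^+ 6) * ballm mu D)%:E)%E).
      apply: lee_wpmul2l; first by rewrite lee_fin divr_ge0 ?(ltW C00) ?(ltW Kn).
      exact: osc_star3_le.
    rewrite (ballmE bD) -!EFinM lee_fin [leLHS]mulrA ler_wpM2r ?(ltW (ballm_gt0 bD))//.
    have -> : C0 / (K * n i) * (n i * (2 * C0 ^+ 6)) = C0 * ((2 * C0 ^+ 6) / K).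
      by field; rewrite !gt_eqF.
    by rewrite mulrC ler_wpM2r ?(ltW C00)// ler_pdivrMr.
have e1C : 0 <= e1 * C0 by rewrite mulr_ge0 ?(ltW e10) ?(ltW C00).
have [mE muE] := finite_exceptional_set e1C bD
  (fun i => let: And3 a b _ := HU i in conj a b).
set E := \bigcup_(i in _) _ in mE muE.
have UE i : U i `<=` E by move=> x Ux; exists i.
have nUE i G : ~ G `<=` E -> ~ G `<=` U i.
  by move=> h h'; apply: h; exact: subset_trans (UE i).
exists E; split => //.
- move=> x Ex c'; rewrite (frozen_shift _ _ c c').
  have gL' : tuple_Lr (mu:=mu) r g by move=> i; exact: gL.
  have fL' : tuple_Lr (mu:=mu) r (fr c g) by move=> i; exact: frL.
  apply: (@sublinear_expansion _ _ _ mu r m hr V A g (fr c g) (gap tau c c')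
    (fun i => lavg mu r (star BB D) (g i)) (fun i => lavg mu r (star BB D) (fr c g i))
    lam x subA gL' fL') => be.
  have [_ _ /(_ x)] := HU (inl [ffun i => be i]).
  have -> : mix [ffun i => be i] = fun i => if be i then g i else fr c g i.
    by apply/funext => i; rewrite /mix ffunE.
  have -> : \prod_(i < m) lavg mu r (star BB D) (if be i then g i else fr c g i) =
      \prod_(i < m) (if be i then lavg mu r (star BB D) (g i) else lavg mu r (star BB D) (fr c g i)).
    by apply: eq_bigr => i _; case: ifP.
  by apply => Ux; apply: Ex; exact: UE Ux.
- move=> G bG nGE c' i.
  have [_ _ h1] := HU (inr (inl i)); have [_ _ h2] := HU (inr (inr (inl i))).
  have {}h1 := h1 G bG (nUE _ _ nGE); have {}h2 := h2 G bG (nUE _ _ nGE).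
  apply: le_trans (lavg_frozen_le hr bn bB0 fM fB0 c c' i bG dg) _.
  rewrite /shifted mulrDr; apply: lerD; last exact: h2.
  move: h1; move: (lavg mu r G (g i)) (lavg mu r _ (g i)) => p q h1.
  by rewrite mulrCA ler_wpM2l.
- move=> G bG nGE GD i itau.
  have [_ _ h] := HU (inr (inr (inr i))).
  by apply: h => //; exact: nUE.
Qed.

Variables (k1 k2 : R).
Hypothesis k10 : 0 < k1.
Hypothesis k20 : 0 < k2.
Hypothesis HT : forall h, tuple_Lr (mu:=mu) r h ->
  cond_T1 BB r A k1 h /\ cond_T2 BB r A k2 h.
(* exceptional sets fill at most half of their ball *)
Hypothesis small : #|{: pieces}|%:R * (e1 * C0) <= 2^-1.

Definition step_cst : R := (2 * lam + k1 + k2 * K ^+ m) * (2 + K) ^+ m.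

Lemma le_prode_fin (u : 'I_m -> \bar R) (v : 'I_m -> R) :
  (forall i, (0 <= u i <= (v i)%:E)%E) ->
  (\prod_(i < m) u i <= (\prod_(i < m) v i)%:E)%E.
Proof.
move=> uv; rewrite -prodEFin.
have : (0 <= \prod_(i < m) u i <= \prod_(i < m) (v i)%:E)%E; last by case/andP.
elim/big_ind2: _ => [|x1 x2 y1 y2 /andP[h1 h2] /andP[h3 h4]|i _]; last exact: uv.
  by rewrite lee01 lexx.
by rewrite mule_ge0//= lee_pmul.
Qed.

Let half_cover (p q z : R) : z <= q + p -> 2 * q < z -> p <= 2^-1 * z -> False.
Proof. by move=> *; lra. Qed.

(** The truncation level [u] dominates the constants as soon as it is at
    least 1. *)
Lemma growth_le u v : 1 <= u -> 0 <= v -> v <= u + K ->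
  (1 + v) ^+ #|tau| <= (2 + K) ^+ m * u ^+ #|tau|.
Proof.
move=> u1 v0 vuK; have u0 : 0 <= u by exact: le_trans u1.
have K20 : 0 <= 2 + K by rewrite addr_ge0// ltW.
apply: (@le_trans _ _ (((2 + K) * u) ^+ #|tau|)).
  rewrite lerXn2r ?nnegrE ?addr_ge0 ?mulr_ge0//.
  have h : 0 <= (1 + K) * (u - 1) by rewrite mulr_ge0 ?subr_ge0// addr_ge0// ltW.
  move: h; rewrite mulrBr mulr1 !mulrDl mul1r => h; lra.
rewrite exprMn ler_wpM2r ?exprn_ge0// ler_weXn2l//; first by move: K1; lra.
by rewrite -[X in (_ <= X)%N](card_ord m) max_card.
Qed.

(** Passing from [D] to a stopping ball [D'] costs a bounded multiple of the
    amplitudes.  The successor [B] of [D'] given by the first condition on the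
    operator may be much larger than [D'].  If its star covers that of [D], the
    first condition alone compares the inputs; otherwise [B] lies at the scale
    of [D] and contains a point outside of the exceptional sets of [D] and [B],
    through which the second condition carries the estimates. *)
Lemma descent D g E D' x u W :
  balls BB D -> dom g -> (forall i y, g i y != 0 -> star BB D y) ->
  exceptional D g E -> balls BB D' -> D x -> D' x ->
  (forall B, balls BB B -> D' `<` B -> (2%:E * mu (B `&` E) < mu B)%E) ->
  1 <= u -> close tau n u (means (mu:=mu) b (star BB D)) (fun i => b i x) ->
  (forall P, balls BB P -> P x -> \prod_(i < m) amp P i <= W) ->
  `|A (fr (fun i => b i x) g) x| <=
    `|A (fr (fun i => b i x) (restr g (star BB D'))) x| +
    step_cst * (\prod_(i in tau) n i * u ^+ #|tau| * W).
Proof.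
move=> bD dg gD [mE muE E1 E2 E3] bD' Dx D'x stop u1 clu HW.
set bx := fun i => b i x; set F := fr bx g.
have b1 := star_ball bD; have D1x : star BB D x by exact: sub_star_self.
have N0 : 0 <= \prod_(i in tau) n i by apply: prodr_ge0 => i /bn[/ltW].
have W0 : 0 <= W.
  by apply: le_trans (HW _ bD Dx); apply: prodr_ge0 => i _; exact: (amplitude_ge0 (BB:=BB)).
set N := \prod_(i in tau) n i in N0 *.
have u0 : 0 <= u by exact: le_trans u1.
set X := N * u ^+ #|tau| * W.
have X0 : 0 <= X by rewrite !mulr_ge0// exprn_ge0.
have K20 : 0 <= 2 + K by rewrite addr_ge0// ltW.
set Y := (2 + K) ^+ m * X.
have Y0 : 0 <= Y by rewrite mulr_ge0// exprn_ge0.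
(* the factor paid for evaluating at [x] when b(x) is within (u + K) n of the means *)
have growth v : 0 <= v -> v <= u + K -> N * (1 + v) ^+ #|tau| * W <= Y.
  move=> v0 vuK; have h := growth_le u1 v0 vuK.
  rewrite /Y /X; move: h; move: ((1 + v) ^+ _) (_ ^+ m) (u ^+ _) => a1 a2 a3 h.
  rewrite -[N * a3 * W]mulrA (mulrCA a2) (mulrA a2) -mulrA ler_wpM2l//.
  by rewrite ler_wpM2r.
have bound P v g' : balls BB P -> P x -> dom g' -> 0 <= v -> v <= u + K ->
    close tau n v (means (mu:=mu) b P) bx ->
    \prod_(i < m) sh P (means (mu:=mu) b P) bx g' i <= Y.
  move=> bP Px dg' v0 vuK cl.
  apply: le_trans (prod_shifted_le hr bn bB0 mf fM fB0 bP dg' v0 cl) _.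
  apply: le_trans (growth v v0 vuK); rewrite ler_wpM2l; last exact: HW.
    by [].
  by rewrite mulr_ge0// exprn_ge0// addr_ge0.
have FL : tuple_Lr (mu:=mu) r F by move=> i; exact: frL.
have step_cstE : step_cst * X = (2 * lam + k1 + k2 * K ^+ m) * Y by rewrite /step_cst /Y mulrA.
have Km0 : 0 <= k2 * K ^+ m by rewrite mulr_ge0 ?exprn_ge0 ?(ltW K0) ?(ltW k20).
rewrite step_cstE.
have [D'T|D'T] := pselect (star BB D' = setT).
  have -> : restr g (star BB D') = g.
    by apply/funext => i; apply/funext => y; rewrite /restr D'T indicT mulr1.
  rewrite lerDl; apply: mulr_ge0 => //; apply: addr_ge0 => //; apply: addr_ge0; last exact: ltW.
  by rewrite mulr_ge0 ?(ltW lam0).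
have D'T' : star BB D' `<` setT by split=> // h; apply: D'T; apply/seteqP; split.
have [HT1 HT2] := HT FL.
have [B [bB D'B supB]] := HT1 D' bD' D'T'.
have bB1 := star_ball bB.
have Bx : B x by case: D'B => h _; exact: h.
have B1x : star BB B x by exact: sub_star_self.
have T1 : `|A (restr F (star BB B)) x - A (restr F (star BB D')) x| <=
    k1 * \prod_(i < m) lavg mu r (star BB B) (F i).
  rewrite -lee_fin EFinM -prodEFin.
  have -> : (\prod_(i < m) (lavg mu r (star BB B) (F i))%:E =
      \prod_(i < m) avgr (mu:=mu) r (star BB B) (EFin \o F i))%E.
    by apply: eq_bigr => i _; rewrite (lavgE hr bB1 (FL i)).
  by apply: le_trans supB; apply: ereal_sup_ubound; exists x.
rewrite (restr_frozen tau b bx g (star BB D')) in T1.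
have [DB|DB] := pselect (star BB D `<=` star BB B).
  have e : restr F (star BB B) = F.
    rewrite /F restr_frozen; congr frozen; apply/funext => i; apply/funext => y.
    rewrite /restr indicE; have [->|gy] := eqVneq (g i y) 0; first by rewrite mul0r.
    by rewrite mem_set ?mulr1//; apply: DB; exact: gD gy.
  rewrite e in T1.
  have h : \prod_(i < m) lavg mu r (star BB B) (F i) <= Y.
    apply: (@le_trans _ _ (\prod_(i < m) sh (star BB D) (means (mu:=mu) b (star BB D)) bx g i)).
      apply: ler_prod => i _; rewrite lavg_ge0/=.
      apply: (@le_trans _ _ (lavg mu r (star BB D) (F i))).
        apply: (lavg_supported_le hr b1 bB1 DB (FL i)) => y Fy.
        by apply: (gD i); apply: contraNneq Fy => gy; rewrite /F /frozen gy mulr0.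
      exact: (lavg_frozen_le hr bn bB0 fM fB0).
    by apply: (bound _ u) => //; rewrite lerDl ltW.
  have := le_trans T1 (ler_wpM2l (ltW k10) h).
  move: (A F x) (A (fr bx (restr g (star BB D'))) x) => p q pq.
  have pq' : `|p| <= `|p - q| + `|q| by apply: le_trans (ler_normD _ _); rewrite subrK.
  apply: le_trans pq' _; rewrite addrC lerD2l; apply: le_trans pq _.
  rewrite ler_wpM2r// addrAC lerDr addr_ge0//.
  by rewrite mulr_ge0 ?(ltW lam0).
have BD : (mu B <= 2%:E * mu (star BB D))%E.
  rewrite leNgt; apply/negP => lt; apply: DB; apply: sub_star => //; first by exists x.
  apply: (@le_trans _ _ (mu B)); last exact: (ball_le2 bB).
  apply: le_trans (ltW lt); exact: (ball_le2 b1).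
have BDD : B `<=` star BB (star BB D) by apply: sub_star => //; exists x.
have b2 := star_ball b1.
have B1Q : star BB B `<=` star BB (star BB (star BB D)) by exact: star_subset.
pose gB := restr g (star BB B).
have dgB : dom gB by apply: dominated_restr => //; exact: ball_measurable bB1.
have gBB i y : gB i y != 0 -> star BB B y.
  rewrite /gB /restr indicE; case: (boolP (y \in _)) => [|_]; first by rewrite inE.
  by rewrite mulr0 eqxx.
have [EB [mEB muEB EB1 _ _]] := exceptional_set bB dgB gBB.
have mB := ball_measurable bB.
(* the stopping rule leaves half of [B] outside of [E], more than [EB] fills *)
have [x' [Bx' nE nEB]] : exists x', [/\ B x', ~ E x' & ~ EB x'].
  apply: contrapT => no.
  have BEE : B `<=` (B `&` E) `|` EB.
    move=> y By; apply: contrapT => /not_orP[h1 h2]; apply: no; exists y; split => //.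
    by move=> Ey; apply: h1.
  have mBE : measurable (B `&` E) by exact: measurableI.
  have h : (mu B <= mu (B `&` E) + mu EB)%E.
    apply: (@le_trans _ _ (mu ((B `&` E) `|` EB))); last exact: measureU2.
    by apply: le_measure; rewrite ?inE//; exact: measurableU.
  have B0' := ballm_gt0 bB; have lt := stop B bB D'B.
  have fBE : mu (B `&` E) \is a fin_num.
    by rewrite ge0_fin_numE//; apply: le_lt_trans (ball_lty bB); exact: measureIl.
  have fEB : mu EB \is a fin_num.
    by rewrite ge0_fin_numE//; apply: le_lt_trans muEB _; rewrite (ballmE bB) -EFinM ltry.
  move: h lt muEB; rewrite (ballmE bB) -(fineK fBE) -(fineK fEB) -EFinD -!EFinM lee_fin lte_fin lee_fin.
  move: (fine _) (fine _) small => p q sm h1 h2 h3.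
  have h4 := le_trans h3 (ler_wpM2r (ltW B0') sm).
  exact: half_cover h1 h2 h4.
have nBE : ~ B `<=` E by move=> h; apply: nE; exact: h.
have cK : close tau n K (means (mu:=mu) b (star BB D)) (means (mu:=mu) b (star BB B)).
  by apply: E3 => // h; apply: nE; apply: h; exact: sub_star_self.
have clB : close tau n (u + K) (means (mu:=mu) b (star BB B)) bx.
  move=> i itau; rewrite mulrDl; apply: le_trans (lerD (clu i itau) (cK i itau)).
  rewrite -[X in _ <= _ + X]normrN; apply: le_trans (ler_normD _ _).
  by rewrite opprB addrA subrK.
have uK0 : 0 <= u + K by rewrite addr_ge0// ltW.
have bB' g' : dom g' -> \prod_(i < m) sh (star BB B) (means (mu:=mu) b (star BB B)) bx g' i <= Y.
  by move=> dg'; apply: (bound _ (u + K)).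
have bD'' : \prod_(i < m) sh (star BB D) (means (mu:=mu) b (star BB D)) bx g i <= Y.
  by apply: (bound _ u) => //; rewrite lerDl ltW.
have T1' : `|A (restr F (star BB B)) x - A (fr bx (restr g (star BB D'))) x| <= k1 * Y.
  apply: le_trans T1 _; rewrite ler_wpM2l ?(ltW k10)//.
  apply: le_trans (bB' g dg); apply: ler_prod => i _; rewrite lavg_ge0/=.
  exact: (lavg_frozen_le hr bn bB0 fM fB0).
have T2 : `|(A F x - A (restr F (star BB B)) x) - (A F x' - A (restr F (star BB B)) x')| <=
    k2 * K ^+ m * Y.
  have : (k2%:E * \prod_(i < m) avgr_sup BB r B (EFin \o F i) <= (k2 * K ^+ m * Y)%:E)%E.
    rewrite -mulrA EFinM; apply: lee_wpmul2l; first by rewrite lee_fin ltW.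
    apply: (@le_trans _ _ (\prod_(i < m) (K * sh (star BB D) (means (mu:=mu) b (star BB D)) bx g i))%:E).
      apply: le_prode_fin => i; apply/andP; split.
        apply: le_trans (ereal_sup_ubound _); last by exists B; split.
        exact: poweR_ge0.
      apply: ge_ereal_sup => _ [G [bG BG] <-].
      rewrite (lavgE hr bG (FL i)) lee_fin; apply: E2 => // h.
      by apply: nBE; exact: subset_trans h.
    rewrite lee_fin big_split/= prodr_const card_ord ler_wpM2l ?exprn_ge0 ?(ltW K0)//.
  move=> hprod; rewrite -lee_fin; apply: le_trans hprod; apply: le_trans (HT2 B bB).
  by apply: ereal_sup_ubound; exists (x, x').
have A1 : `|A F x'| <= lam * Y.
  by apply: le_trans (E1 x' nE bx) _; rewrite ler_wpM2l ?(ltW lam0).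
have A2 : `|A (restr F (star BB B)) x'| <= lam * Y.
  rewrite /F restr_frozen; have h := EB1 x' nEB bx.
  exact: (le_trans h (ler_wpM2l (ltW lam0) (bB' gB dgB))).
move: T1' T2 A1 A2; move: (A F x) (A F x') (A (restr F (star BB B)) x) (A (restr F (star BB B)) x') (A (fr bx (restr g (star BB D'))) x).
move=> p p' q q' s0 T1' T2 A1 A2.
have t1 : `|p| <= `|p - s0| + `|s0| by apply: le_trans (ler_normD _ _); rewrite subrK.
have t2 : `|p - s0| <= `|p - q| + `|q - s0| by exact: ler_distD.
have t3 : `|p - q| <= `|(p - q) - (p' - q')| + `|p' - q'|.
  by apply: le_trans (ler_normD _ _); rewrite subrK.
have t4 : `|p' - q'| <= `|p'| + `|q'| by exact: ler_normB.
have -> : (2 * lam + k1 + k2 * K ^+ m) * Y = 2 * (lam * Y) + k1 * Y + k2 * K ^+ m * Y.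
  by rewrite !mulrDl mulrA.
apply: le_trans t1 _; rewrite addrC lerD2l; apply: le_trans t2 _.
apply: le_trans (lerD t3 T1') _; apply: le_trans (lerD (lerD T2 t4) (lexx _)) _.
apply: le_trans (lerD (lerD (lexx _) (lerD A1 A2)) (lexx _)) _.
move: (k1 * Y) (lam * Y) (k2 * K ^+ m * Y) => y1 y2 y3; clear.
by rewrite mulr_natl mulr2n -addrA addrC.
Qed.

Definition bad_cst : R := m%:R * (2 * C0) / (1 - expR (- 1)).

Variable W : T -> \bar R.
Hypothesis HW : forall x P, balls BB P -> P x -> ((\prod_(i < m) amp P i)%:E <= W x)%E.

Let step_ge_lam : lam <= 2 * lam + k1 + k2 * K ^+ m.
Proof.
have h1 : 0 <= k2 * K ^+ m by rewrite mulr_ge0 ?exprn_ge0 ?(ltW K0) ?(ltW k20).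
by move: (k2 * K ^+ m) h1 k10 lam0 => z; lra.
Qed.

Let sh_ge0 P c c' g i : 0 <= sh P c c' g i. Proof. exact: shifted_ge0. Qed.

Lemma step_cst_gt0 : 0 < step_cst.
Proof.
apply: mulr_gt0; first exact: lt_le_trans lam0 step_ge_lam.
by rewrite exprn_gt0// addr_gt0.
Qed.

Lemma restr_restr (h : 'I_m -> T -> R) Z Z' :
  restr (restr h Z) Z' = restr h (Z `&` Z').
Proof.
by apply/funext => i; apply/funext => y; rewrite /restr -mulrA indicI.
Qed.

(** Where the multipliers are not within [u n_i] of their means the estimates
    are given up; exponential integrability makes this set exponentially small
    in [u]. *)
Lemma bad_set D u : balls BB D -> exists2 Bad : set T,
  measurable Bad /\ (mu Bad <= (m%:R * (2 * C0) * expR (- u))%:E * mu D)%E &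
  forall x, D x -> ~ Bad x ->
    close tau n u (means (mu:=mu) b (star BB D)) (fun i => b i x).
Proof.
move=> bD; have b1 := star_ball bD.
pose U (i : 'I_m) := if i \in tau then
  star BB D `&` [set x | u * n i < `|b i x - mean mu (star BB D) (b i)|] else set0.
have e0 : 0 <= 2 * expR (- u) * C0 by rewrite !mulr_ge0 ?expR_ge0 ?(ltW C00).
have [|mB muB] := @finite_exceptional_set _ _ _ mu BB 'I_m U (2 * expR (- u) * C0) D e0 bD.
  move=> i; rewrite /U; case: ifPn => itau; last first.
    by split => //; rewrite measure0 mule_ge0// lee_fin.
  split.
    apply: measurableI; first exact: ball_measurable b1.
    apply: (@measurable_superlevel _ _ _ (fun x => `|b i x - mean mu (star BB D) (b i)|)).
    have [_ mbi _ _] := bn itau.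
    by apply: measurableT_comp => //; exact: measurable_funB.
  apply: le_trans (osc_tail (bn itau) u b1) _.
  rewrite (ballmE b1) (ballmE bD) -!EFinM lee_fin -[leRHS]mulrA ler_wpM2l ?mulr_ge0 ?expR_ge0//.
  exact: ballm_star.
exists (\bigcup_(i in [set: 'I_m]) U i).
  split => //; move: muB; rewrite card_ord.
  by rewrite (_ : m%:R * (2 * expR (- u) * C0) = m%:R * (2 * C0) * expR (- u))//; ring.
move=> x Dx nB i itau; rewrite leNgt; apply/negP => h; apply: nB; exists i => //.
by rewrite /U itau; split => //; exact: sub_star_self Dx.
Qed.

(** The base estimate: off the exceptional set nothing is left to iterate. *)
Lemma outside_exceptional D g E x u w : balls BB D -> dom g -> exceptional D g E ->
  D x -> ~ E x -> 1 <= u ->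
  close tau n u (means (mu:=mu) b (star BB D)) (fun i => b i x) ->
  (forall P, balls BB P -> P x -> \prod_(i < m) amp P i <= w) ->
  `|A (fr (fun i => b i x) g) x| <= step_cst * (\prod_(i in tau) n i * u ^+ #|tau| * w).
Proof.
move=> bD dg [_ _ E1 _ _] Dx nEx u1 cl Hw.
have b1 := star_ball bD; have D1x : star BB D x by exact: sub_star_self.
have N0 : 0 <= \prod_(i in tau) n i by apply: prodr_ge0 => i /bn[/ltW].
have w0 : 0 <= w.
  by apply: le_trans (Hw _ bD Dx); apply: prodr_ge0 => i _; exact: (amplitude_ge0 (BB:=BB)).
have u0 : 0 <= u by exact: le_trans u1.
have uK : u <= u + K by rewrite lerDl ltW.
have h1 := E1 x nEx (fun i => b i x).
have h2 := prod_shifted_le hr bn bB0 mf fM fB0 b1 dg u0 cl.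
have h3 := growth_le u1 u0 uK.
apply: le_trans h1 _.
have h4 : 0 <= \prod_(i < m) sh (star BB D) (means (mu:=mu) b (star BB D)) (fun i => b i x) g i.
  by apply: prodr_ge0 => i _; exact: sh_ge0.
apply: le_trans (ler_wpM2r h4 step_ge_lam) _.
rewrite /step_cst -[leRHS]mulrA.
have k0 : 0 <= 2 * lam + k1 + k2 * K ^+ m by exact: le_trans (ltW lam0) step_ge_lam.
apply: (ler_wpM2l k0); apply: le_trans h2 _.
have h5 := Hw _ b1 D1x.
have h6 : 0 <= \prod_(i in tau) n i * (1 + u) ^+ #|tau| by rewrite mulr_ge0// exprn_ge0// addr_ge0.
apply: le_trans (ler_wpM2l h6 h5) _.
move: h3 N0 w0; clear; move: ((1 + u) ^+ _) (_ ^+ m) (u ^+ _) (\prod_(_ in _) _) => a1 a2 a3 N h3 N0 w0.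
have -> : a2 * (N * a3 * w) = N * (a2 * a3) * w by ring.
by rewrite ler_wpM2r// ler_wpM2l.
Qed.

Let mu_extU (X Y : set T) : ((mu^*)%mu (X `|` Y) <= (mu^*)%mu X + (mu^*)%mu Y)%E.
Proof. exact: outer_measureU2. Qed.

Let mu_ext_bigcup (X : nat -> set T) :
  ((mu^*)%mu (\bigcup_j X j) <= \sum_(j <oo) (mu^*)%mu (X j))%E.
Proof. exact: outer_measure_sigma_subadditive. Qed.

Let decay_sum (a q y z : R) : 0 < 1 - q ->
  a * y + q * (z + a / (1 - q) * y) = z * q + a / (1 - q) * y.
Proof. by move=> q1; field; rewrite gt_eqF. Qed.

Hypothesis small2 : C0 * (2 * (#|{: pieces}|%:R * (e1 * C0))) <= expR (- 1).

(** The stars of the stopping balls of [D] cover almost all of the exceptional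
    set, and their total measure is at most exp(-1) times that of [D].  By
    [descent] one step from [D] to such a star costs one unit of the threshold,
    so the k-th generation bounds the k-th level; the sets thrown away by
    [bad_set] in the successive generations form a geometric series. *)
Lemma decay k u : 1 <= u -> forall D Z, balls BB D -> measurable Z ->
  Z `<=` star BB D ->
  ((mu^*)%mu [set x | D x /\
     ((step_cst * (\prod_(i in tau) n i * u ^+ #|tau|) * k%:R)%:E * W x <
      (`|A (fr (fun i => b i x) (restr f Z)) x|)%:E)%E] <=
   (expR (- k%:R) + bad_cst * expR (- u))%:E * mu D)%E.
Proof.
move=> u1.
have e1lt : 0 < 1 - expR (- 1) :> R by rewrite subr_gt0 expR_lt1 oppr_lt0.
have badc0 : 0 <= bad_cst by rewrite /bad_cst divr_ge0 ?(ltW e1lt)// !mulr_ge0// ltW.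
have N0 : 0 < \prod_(i in tau) n i by apply: prodr_gt0 => i /bn[].
have u0 : 0 < u by exact: lt_le_trans u1.
set X := \prod_(i in tau) n i * u ^+ #|tau|.
have X0 : 0 < X by rewrite mulr_gt0// exprn_gt0.
elim: k => [|k IH] D Z bD mZ ZD.
  have mD := ball_measurable bD.
  apply: (@le_trans _ _ (mu D)).
    rewrite -(measurable_mu_extE mu mD); apply: le_mu_ext => x [] //.
  rewrite oppr0 expR0 (ballmE bD) -EFinM lee_fin ler_peMl ?(ltW (ballm_gt0 bD))//.
  by rewrite lerDl mulr_ge0// expR_ge0.
set g := restr f Z.
have dg : dom g by apply: dominated_restr => //; exact: dominated_self.
have gD i y : g i y != 0 -> star BB D y.
  rewrite /g /restr indicE; case: (boolP (y \in _)) => [|_]; last by rewrite mulr0 eqxx.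
  by rewrite inE => /ZD.
have [E HE] := exceptional_set bD dg gD; have [mE muE _ _ _] := HE.
(* stopping balls are those at least half of which is exceptional *)
pose h (y : T) : \bar R := (2 * \1_E y)%:E.
have hB B : measurable B -> (\int[mu]_(y in B) h y = 2%:E * mu (E `&` B))%E.
  by move=> mB; rewrite /h integral_indicZ.
have [|||F [I [FI tF Fcov Fstop Fsum]]] := @calderon_zygmund_balls _ _ _ mu BB h.
- by apply/measurable_EFinP; apply: measurable_funM.
- by move=> y; rewrite lee_fin mulr_ge0.
- rewrite hB// setIT; apply: lte_mul_pinfty => //.
  by apply: le_lt_trans muE _; rewrite (ballmE bD) -EFinM ltry.
have [Bad [mBad muBad] BadP] := bad_set u bD.
pose Y j := if j \in I then [set x | star BB (F j) x /\
     ((step_cst * X * k%:R)%:E * W x <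
      (`|A (fr (fun i => b i x) (restr f (Z `&` star BB (star BB (F j))))) x|)%:E)%E] else set0.
set U := \bigcup_(j in I) star BB (F j) in Fcov.
have bF j : I j -> balls BB (star BB (F j)) by move=> /FI[/star_ball].
have mU : measurable U by apply: bigcup_measurable => j /bF; exact: ball_measurable.
have mEU : measurable (E `\` U) by exact: measurableD.
have EU0 : mu (E `\` U) = 0%E.
  rewrite -Fcov; congr (mu (_ `\` _)); apply/seteqP; split => y /=.
    by move=> Ey; rewrite /h indicE mem_set// mulr1.
  rewrite /h indicE; case: (boolP (y \in E)) => [|_]; first by rewrite inE.
  by rewrite mulr0 lee_fin => h2; exfalso; move: h2; rewrite leNgt ltr0n.
set LHS := [set x | _].
have sub : LHS `<=` (E `\` U) `|` Bad `|` \bigcup_j Y j.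
  move=> x [Dx]; set Fx := A _ x => lt.
  have [Bx|nBx] := pselect (Bad x); first by left; right.
  have cl := BadP x Dx nBx.
  have amp0 P : 0 <= \prod_(i < m) amp P i.
    by apply: prodr_ge0 => i _; exact: (amplitude_ge0 r f bn).
  have cst0 : 0 < step_cst * X * k.+1%:R by apply: mulr_gt0; [apply: mulr_gt0; [exact: step_cst_gt0|exact: X0]|rewrite ltr0n].
  have [w Ww] : exists w, W x = w%:E.
    move: lt (HW bD Dx); case: (W x) => [w _ _|lt _|]; first by exists w.
      have c0 : (0 < (step_cst * X * k.+1%:R)%:E)%E by rewrite lte_fin.
      by move: lt; rewrite (gt0_muley c0) => h'; have := le_lt_trans (leey (`|Fx|)%:E) h'; rewrite ltxx.
    by rewrite leeNy_eq.
  have Hw P : balls BB P -> P x -> \prod_(i < m) amp P i <= w.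
    by move=> bP Px; rewrite -lee_fin -Ww; exact: HW.
  have w0 : 0 <= w by exact: le_trans (amp0 D) (Hw D bD Dx).
  move: lt; rewrite Ww -EFinM lte_fin => lt.
  have sXw : 0 <= step_cst * (X * w) by apply: mulr_ge0; [exact: ltW step_cst_gt0|apply: mulr_ge0 => //; exact: ltW X0].
  have lt' : step_cst * (X * w) * k%:R + step_cst * (X * w) < `|Fx|.
    by move: lt; rewrite -natr1 mulrDr mulr1 mulrDl mulrAC !mulrA.
  have [Ex|nEx] := pselect (E x); last first.
    exfalso; have := outside_exceptional bD dg HE Dx nEx u1 cl Hw.
    rewrite -/X -/Fx leNgt => /negP; apply; apply: le_lt_trans lt'.
    by rewrite lerDr mulr_ge0.
  have [[j Ij xj]|nU] := pselect (U x); last by left; left.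
  right; exists j => //; rewrite /Y mem_set//; split => //.
  have [bFj _] := FI j Ij.
  have stop B : balls BB B -> star BB (F j) `<` B -> (2%:E * mu (B `&` E) < mu B)%E.
    move=> bB [sB nB]; rewrite setIC -hB; last exact: ball_measurable bB.
    by apply: (Fstop j) => //; exact: subset_trans (sub_star_self bFj) sB.
  have := descent bD dg gD HE (bF j Ij) Dx xj stop u1 cl Hw.
  rewrite -/X -/Fx restr_restr Ww -EFinM lte_fin => dsc.
  have := lt_le_trans lt' dsc; rewrite ltrD2r => h1.
  by apply: le_lt_trans h1; rewrite mulrAC !mulrA.
apply: le_trans (le_mu_ext mu sub) _.
apply: le_trans (mu_extU _ _) _.
apply: (@le_trans _ _ ((m%:R * (2 * C0) * expR (- u))%:E * mu D +
   (expR (- 1) * (expR (- k%:R) + bad_cst * expR (- u)))%:E * mu D)%E); last first.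
  rewrite (ballmE bD) -!EFinM -EFinD lee_fin -mulrDl ler_wpM2r ?(ltW (ballm_gt0 bD))//.
  rewrite -[k.+1%:R]natr1 opprD expRD.
  by rewrite /bad_cst decay_sum.
apply: leeD.
  apply: le_trans (mu_extU _ _) _.
  by rewrite !measurable_mu_extE// EU0 add0e.
apply: le_trans (mu_ext_bigcup _) _.
pose q := expR (- k%:R) + bad_cst * expR (- u).
have q0 : 0 <= q by rewrite addr_ge0 ?expR_ge0// mulr_ge0// expR_ge0.
apply: (@le_trans _ _ (q%:E * \sum_(j <oo | j \in I) mu (star BB (F j)))%E).
  rewrite -nneseriesZl; last by move=> *; exact: measure_ge0.
  rewrite [leRHS]eseries_mkcond; apply: lee_nneseries => j _; first by move=> _; exact: mu_ext_ge0.
  rewrite /Y; case: ifPn => [/[!inE] Ij|_]; last by rewrite mu_ext0.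
  apply: IH; [exact: bF| |by move=> y []].
  by apply: measurableI => //; exact: ball_measurable (star_ball (bF j Ij)).
apply: le_trans (lee_wpmul2l _ Fsum) _; first by rewrite lee_fin.
apply: (@le_trans _ _ (q%:E * (C0%:E * (2%:E * mu E)))%E).
  apply: lee_wpmul2l; first by rewrite lee_fin.
  apply: lee_wpmul2l; first by rewrite lee_fin ltW.
  rewrite -[E in leRHS]setIT -hB//; apply: ge0_subset_integral => //.
  - by apply: bigcup_measurable => j /FI[bj _]; exact: ball_measurable bj.
  - by apply/measurable_EFinP; apply: measurable_funM.
  - by move=> y _; rewrite lee_fin mulr_ge0.
have -> : (expR (- 1) * (expR (- k%:R) + bad_cst * expR (- u)))%:E = (q%:E * (expR (- 1))%:E)%E.
  by rewrite -EFinM mulrC.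
rewrite -muleA; apply: lee_wpmul2l; first by rewrite lee_fin.
apply: (@le_trans _ _ (C0%:E * (2%:E * ((#|{: pieces}|%:R * (e1 * C0))%:E * mu D)))%E).
  apply: lee_wpmul2l; first by rewrite lee_fin ltW.
  by apply: lee_wpmul2l.
rewrite (ballmE bD) -!EFinM lee_fin !mulrA ler_wpM2r ?(ltW (ballm_gt0 bD))//.
by move: small2; rewrite !mulrA.
Qed.

End OneStep.

(** * Maximal functions and weights *)

Section Maximal.
Set Implicit Arguments.
Unset Strict Implicit.
Context {d : measure_display} {T : measurableType d} {R : realType}.
Context {mu : {measure set T -> \bar R}} (BB : ball_basis mu).
Local Open Scope ereal_scope.

(** Monotonicity of the integral of nonnegative functions that need not be
    measurable. *)
Lemma le_lower_integral (D : set T) (f g : T -> \bar R) :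
  (forall x, D x -> 0 <= f x) -> (forall x, D x -> f x <= g x) ->
  \int[mu]_(x in D) f x <= \int[mu]_(x in D) g x.
Proof.
move=> f0 fg; rewrite !ge0_integralE//; last first.
  by move=> x Dx; exact: le_trans (f0 x Dx) (fg x Dx).
apply: ge_ereal_sup => _ [h hf <-]; apply: ereal_sup_ubound; exists h => // x.
apply: le_trans (hf x) _; rewrite !patchE; case: ifPn => //.
by rewrite inE; exact: fg.
Qed.

Lemma le_avg (B : set T) (f g : T -> \bar R) : balls BB B ->
  (forall x, B x -> 0 <= f x) -> (forall x, B x -> f x <= g x) ->
  avg (mu:=mu) B f <= avg (mu:=mu) B g.
Proof.
move=> bB f0 fg; rewrite /avg; apply: lee_wpmul2l; last exact: le_lower_integral.
by rewrite inve_ge0.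
Qed.

Lemma avg_ge0 (B : set T) (f : T -> \bar R) : (forall x, B x -> 0 <= f x) ->
  0 <= avg (mu:=mu) B f.
Proof. by move=> f0; rewrite /avg mule_ge0 ?inve_ge0// integral_ge0. Qed.

Lemma avgE (B : set T) (f : T -> \bar R) : balls BB B ->
  avg (mu:=mu) B f = ((ballm mu B)^-1)%:E * \int[mu]_(x in B) f x.
Proof.
by move=> bB; rewrite /avg (ballmE bB) inver gt_eqF// (ballm_gt0 bB).
Qed.

Lemma avgr1 (B : set T) (f : T -> \bar R) : (forall x, B x -> 0 <= f x) ->
  avgr (mu:=mu) 1 B f = avg (mu:=mu) B f.
Proof.
move=> f0; rewrite /avgr invr1.
have -> : avg (mu:=mu) B (fun x => `|f x| `^ 1) = avg (mu:=mu) B f.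
  rewrite /avg; congr (_ * _); apply: eq_integral => x; rewrite inE => Bx.
  by rewrite poweRe1// gee0_abs// f0.
by rewrite poweRe1// avg_ge0.
Qed.

Lemma maximal1_ge (f : T -> \bar R) (B : set T) (x : T) : (forall x, 0 <= f x) ->
  balls BB B -> B x -> avg (mu:=mu) B f <= maximal1 BB f x.
Proof.
move=> f0 bB Bx; rewrite /maximal1 /maximal mem_set; last by exists B.
apply: ereal_sup_ubound; exists B => //=.
by rewrite big_ord1 avgr1.
Qed.

Lemma maximal1_le (f : T -> \bar R) (x : T) (y : \bar R) : (forall x, 0 <= f x) ->
  0 <= y -> (forall B, balls BB B -> B x -> avg (mu:=mu) B f <= y) ->
  maximal1 BB f x <= y.
Proof.
move=> f0 y0 H; rewrite /maximal1 /maximal; case: ifPn => // _.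
apply: ge_ereal_sup => _ [B [bB Bx] <-].
by rewrite big_ord1 avgr1//; exact: H.
Qed.

Lemma maximal1_ge0 (f : T -> \bar R) (x : T) : 0 <= maximal1 BB f x.
Proof.
rewrite /maximal1 /maximal; case: ifPn => //; rewrite inE => -[B bB Bx].
apply: (@le_trans _ _ (\prod_(i < 1) avgr (mu:=mu) 1 B f)).
  by rewrite big_ord1 poweR_ge0.
by apply: ereal_sup_ubound; exists B.
Qed.

(** The constants of Muckenhoupt weights are at least 1.  For p > 1 this is
    Jensen's inequality, in the form of the tangent-line inequality
    a^q w^(-q) + q w / a >= 1 + q with q = 1 / (p - 1), where a is the mean of
    w. *)
Lemma Ap_cst_ge1 (p : R) (w : T -> \bar R) (B : set T) (a : R) :
  (1 <= p)%R -> (forall x, 0 <= w x) -> weight (mu:=mu) w -> balls BB B ->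
  (0 < a)%R -> \int[mu]_(x in B) w x = (a * ballm mu B)%:E ->
  1 <= Ap_cst BB p w.
Proof.
move=> p1 w0 [mw aew] bB a0 wa; have B0 := ballm_gt0 bB; have mB := ball_measurable bB.
have avga : avg (mu:=mu) B w = a%:E.
  by rewrite avgE// wa -EFinM mulrC mulfK// gt_eqF.
rewrite /Ap_cst; case: eqP => [_|/eqP pn1].
  have muT : 0 < mu setT.
    apply: lt_le_trans (ball_gt0 bB) _; apply: le_measure; rewrite ?inE//.
  rewrite unlock /Lnorm muT leNgt; apply/negP => lt1.
  set F := abse \o _ in lt1.
  have [q q0 [q1 Fq]] : exists2 q : R, (0 <= q)%R & (q < 1)%R /\ \forall x \ae mu, F x <= q%:E.
    have F0 : 0 <= ess_sup mu F.
      rewrite leNgt; apply/negP => h.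
      have : \forall x \ae mu, False.
        apply: filterS (ess_sup_ge mu F) => x /le_lt_trans/(_ h).
        by rewrite ltNge abse_ge0.
      move=> [N [mN N0]] /= /(_ _)sub; have TN : setT `<=` N.
        by move=> x _; apply: sub.
      by move: muT; rewrite (subset_measure0 measurableT mN TN N0) ltxx.
    have Ffin : ess_sup mu F \is a fin_num.
      by rewrite ge0_fin_numE//; apply: lt_le_trans lt1 _; rewrite leey.
    exists (fine (ess_sup mu F)); first exact: fine_ge0.
    split; first by rewrite -lte_fin fineK.
    by rewrite fineK//; exact: ess_sup_ge.
  have : (a * ballm mu B)%:E <= (q * (a * ballm mu B))%:E.
    rewrite EFinM -(ballmE bB) -(integral_cst mu mB) EFinM -wa -ge0_integralZl//; last first.
      exact: measurable_funTS.
    apply: ae_ge0_le_integral => //.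
    - by move=> x _; rewrite lee_fin ltW.
    - by move=> x _; rewrite mule_ge0.
    - by apply: measurable_funeM; exact: measurable_funTS.
    apply: filterS2 aew Fq => x /andP[wx0 wxoo] Fx Bx.
    have := maximal1_ge w0 bB Bx; rewrite avga => aM.
    have wfin : w x \is a fin_num by rewrite ge0_fin_numE.
    have w1 : (0 < fine (w x))%R by rewrite fine_gt0// wx0 wxoo.
    move: Fx; rewrite /F /= -[w x]fineK// inver gt_eqF// => Fx.
    have h : (a / fine (w x))%:E <= q%:E.
      apply: le_trans Fx; apply: le_trans (lee_abs _); rewrite EFinM lee_wpmul2r//.
      by rewrite lee_fin invr_ge0 ltW.
    by move: h; rewrite lee_fin ler_pdivrMr// -EFinM lee_fin.
  rewrite lee_fin leNgt => /negP; apply.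
  by rewrite gtr_pMl// mulr_gt0.
have p10 : (0 < p - 1)%R by rewrite subr_gt0 lt_neqAle eq_sym pn1.
pose q := ((p - 1)^-1)%R; have q0 : (0 < q)%R by rewrite invr_gt0.
have eE : (1 - p / (p - 1) = - q)%R.
  by rewrite /q; field; rewrite gt_eqF.
set e := (1 - p / (p - 1))%R.
have mwe : measurable_fun B (fun x => w x `^ e).
  apply: (@measurableT_comp _ _ _ _ _ _ (fun y : \bar R => y `^ e)); first exact: measurable_poweR.
  exact: measurable_funTS.
have tangent : {ae mu, forall x, B x ->
    (1 + q)%:E <= (a `^ q)%:E * w x `^ e + (q / a)%:E * w x}.
  apply: filterS aew => x /andP[wx0 wxoo] Bx.
  have wfin : w x \is a fin_num by rewrite ge0_fin_numE.
  have w1 : (0 < fine (w x))%R by rewrite fine_gt0// wx0 wxoo.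
  rewrite -[w x]fineK//; move: (fine (w x)) w1 => y y0.
  rewrite poweR_EFin -!EFinM -EFinD lee_fin /e eE.
  have -> : (a `^ q * y `^ (- q) = expR (- q * ln (y / a)))%R.
    by rewrite powRN /powR !gt_eqF// -expRN -expRD ln_div ?posrE//; congr expR; ring.
  have h1 := expR_ge1Dx (- q * ln (y / a))%R.
  have h2 : (ln (y / a) <= y / a - 1)%R.
    have := @le_ln1Dx R (y / a - 1)%R; rewrite addrCA subrr addr0; apply.
    by rewrite ltrBrDl subrr divr_gt0.
  have h3 := ler_wpM2l (ltW q0) h2.
  have -> : (q / a * y = q * (y / a))%R by rewrite mulrAC mulrA.
  have {}h3 : (q * ln (y / a) <= q * (y / a) - q)%R by rewrite -[X in (_ - X)%R]mulr1 -mulrBr.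
  apply: (@le_trans _ _ (1 + - q * ln (y / a) + q * (y / a))%R); last by rewrite lerD2r.
  by rewrite -addrA lerD2l mulNr [leRHS]addrC lerBrDl -lerBrDr.
set I := \int[mu]_(x in B) (w x `^ e).
have I0 : 0 <= I by apply: integral_ge0 => x _; exact: poweR_ge0.
have key : (ballm mu B)%:E <= (a `^ q)%:E * I.
  have h : ((1 + q) * ballm mu B)%:E <= (a `^ q)%:E * I + (q * ballm mu B)%:E.
    have -> : (q * ballm mu B)%:E = (q / a)%:E * \int[mu]_(x in B) w x.
      by rewrite wa -EFinM mulrA divfK// gt_eqF.
    rewrite EFinM -(ballmE bB) -(integral_cst mu mB) -!ge0_integralZl//.
    - rewrite -ge0_integralD//; last 4 first.
      + by move=> x _; rewrite mule_ge0 ?poweR_ge0// lee_fin powR_ge0.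
      + exact: measurable_funeM.
      + by move=> x _; rewrite mule_ge0// lee_fin divr_ge0 ?(ltW q0) ?(ltW a0).
      + by apply: measurable_funeM; exact: measurable_funTS.
      apply: ae_ge0_le_integral => //.
      + by move=> x _; rewrite lee_fin addr_ge0// ltW.
      + by move=> x _; rewrite adde_ge0// mule_ge0 ?poweR_ge0// lee_fin ?powR_ge0// divr_ge0 ?(ltW q0) ?(ltW a0).
      + apply: emeasurable_funD; first exact: measurable_funeM.
        by apply: measurable_funeM; exact: measurable_funTS.
    - by move=> x _; exact: poweR_ge0.
    - by rewrite lee_fin powR_ge0.
    - exact: measurable_funTS.
    - by rewrite lee_fin divr_ge0 ?(ltW q0) ?(ltW a0).
  have aI0 : 0 <= (a `^ q)%:E * I by rewrite mule_ge0// lee_fin powR_ge0.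
  move: h aI0; case: ((a `^ q)%:E * I) => [z h _|_ _|_ //]; last exact: leey.
  by move: h; rewrite -EFinD !lee_fin mulrDl mul1r lerD2r.
have avgI : (a `^ (- q))%:E <= avg (mu:=mu) B (fun x => w x `^ e).
  rewrite avgE// lee_pdivlMl ?ballm_gt0// powRN -EFinM mulrC EFinM.
  by rewrite lee_pdivrMl ?powR_gt0.
apply: le_trans (ereal_sup_ubound _); last by exists B.
rewrite avga -/e.
have -> : 1 = a%:E * ((a `^ (- q))%:E `^ (p - 1)).
  rewrite poweR_EFin -EFinM -powRrM mulNr mulVf ?gt_eqF// powR_inv1 ?(ltW a0)//.
  by rewrite mulfV// gt_eqF.
apply: lee_wpmul2l; first by rewrite lee_fin ltW.
have av0 : 0 <= avg (mu:=mu) B (fun x => w x `^ e).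
  by apply: avg_ge0 => x _; exact: poweR_ge0.
apply: (gt0_ler_poweR (ltW p10)) => //; rewrite in_itv/= leey andbT//.
by rewrite lee_fin powR_ge0.
Qed.

End Maximal.

(** * The sharp reverse Holder property excludes large gaps between balls *)

Section Gaps.
Set Implicit Arguments.
Unset Strict Implicit.
Context {d : measure_display} {T : measurableType d} {R : realType}.
Context {mu : {measure set T -> \bar R}} (BB : ball_basis mu).
Local Notation C0 := (star_cst BB).

(** Measures of balls do not jump: the next ball after the star of [G] is
    comparable to [G].  The balls of a filtration that is not regular are an
    example without this property. *)
Definition gap_bound (C : R) : Prop := forall G, balls BB G -> star BB G <> setT ->
  exists P, [/\ balls BB P, star BB G `<=` P, ~ P `<=` star BB G &
    ballm mu P <= C * ballm mu G].

(** There is a gap between [H] and [P]: a ball that meets [H] is inside [H] or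
    not much smaller than [P]. *)
Definition isolated (H P : set T) : Prop :=
  [/\ balls BB H, balls BB P, H `<=` P, ~ P `<=` H &
    forall B, balls BB B -> B `&` H !=set0 -> B `<=` H \/ ballm mu P <= 2 * C0 * ballm mu B].

Let C00 : 0 < C0. Proof. exact: star_cst_gt0. Qed.

Lemma sub_starR B A : balls BB B -> balls BB A -> A `&` B !=set0 ->
  ballm mu A <= 2 * ballm mu B -> A `<=` star BB B.
Proof.
move=> bB bA AB le2; apply: sub_star => //.
by rewrite (ballmE bA) (ballmE bB) -EFinM lee_fin.
Qed.

Lemma ball_hull H Q : balls BB H -> balls BB Q -> Q `&` H !=set0 ->
  exists P, [/\ balls BB P, H `<=` P & Q `<=` P].
Proof.
move=> bH bQ QH; have H0 := ballm_gt0 bH; have Q0 := ballm_gt0 bQ.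
have [le2|lt2] := leP (ballm mu Q) (2 * ballm mu H).
  exists (star BB H); split; [exact: star_ball|exact: sub_star_self|exact: sub_starR].
exists (star BB Q); split; [exact: star_ball| |exact: sub_star_self].
by apply: sub_starR => //; [rewrite setIC|lra].
Qed.

Lemma ball_join_hull Q Q' : balls BB Q -> balls BB Q' ->
  exists P, [/\ balls BB P, Q `<=` P & Q' `<=` P].
Proof.
move=> bQ bQ'; have [x Qx] := ball_nonempty bQ; have [y Qy] := ball_nonempty bQ'.
have [B [bB Bx By]] := ball_join BB x y.
have [|P [bP QP BP]] := ball_hull bQ bB; first by exists x.
have [|P' [bP' PP' QP']] := ball_hull bP bQ'; first by exists y; split => //; exact: BP.
by exists P'; split => //; exact: subset_trans QP PP'.
Qed.

Lemma near_inf_ball (G : set (set T)) (l : R) : G `<=` balls BB -> G !=set0 ->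
  0 < l -> (forall A, G A -> l <= ballm mu A) ->
  exists2 B, G B & forall A, G A -> ballm mu B <= 2 * ballm mu A.
Proof.
move=> GB [A0 GA0] l0 Gl.
pose s := inf [set ballm mu A | A in G].
have hinf : has_inf [set ballm mu A | A in G].
  by split; [exists (ballm mu A0), A0|exists l => _ [A GA <-]; exact: Gl].
have ls : l <= s by apply: lb_le_inf; [exact: hinf.1|move=> _ [A GA <-]; exact: Gl].
have s0 : 0 < s by exact: lt_le_trans ls.
have [_ [B GB' <-] sB] := inf_adherent s0 hinf.
exists B => // A GA; apply: le_trans (ltW sB) _.
have : s <= ballm mu A by apply: ge_inf; [exact: hinf.2|exists A].
by rewrite -/s; lra.
Qed.

(** A large gap after a ball separates its star from the almost smallest ball
    that extends this star. *)
Lemma isolated_of_gap (L : R) : ~ (exists C, gap_bound C) ->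
  exists H P, isolated H P /\ L * ballm mu H <= ballm mu P.
Proof.
move=> nogap.
pose C := C0 ^+ 2 + C0 * `|L|.
have C1 : C0 ^+ 2 <= C by rewrite lerDl mulr_ge0// ltW.
have : ~ gap_bound C by move=> h; apply: nogap; exists C.
move=> /existsNP[G /not_implyP[bG /not_implyP[GT nP]]].
set H := star BB G in GT nP.
have bH : balls BB H by exact: star_ball.
have G0 := ballm_gt0 bG; have H0 := ballm_gt0 bH.
have HG : ballm mu H <= C0 * ballm mu G by exact: (ballm_star bG).
pose cand := [set P | [/\ balls BB P, H `<=` P & ~ P `<=` H]].
have candC P : cand P -> C * ballm mu G < ballm mu P.
  by move=> [bP HP PH]; rewrite ltNge; apply/negP => h; apply: nP; exists P.
have cand0 : cand !=set0.
  have [x nHx] : exists x, ~ H x.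
    by apply: contrapT => h; apply: GT; apply/seteqP; split => // x _;
      apply: contrapT => nx; apply: h; exists x.
  have [y Hy] := ball_nonempty bH.
  have [B [bB Bx By]] := ball_join BB x y.
  have [|P [bP HP BP]] := ball_hull bH bB; first by exists y.
  by exists P; split => // PH; apply: nHx; apply: PH; exact: BP.
have [||P [bP HP PH] Pmin] := near_inf_ball (G:=cand) _ cand0 H0.
- by move=> A [].
- by move=> A [bA HA _]; exact: (le_ballm bH bA).
exists H, P; split.
  split => // B bB BH; have [BsubH|nBH] := pselect (B `<=` H); [by left|right].
  have [le2|lt2] := leP (ballm mu B) (2 * ballm mu H).
    exfalso.
    have BsH : B `<=` star BB H by exact: sub_starR.
    have cs : cand (star BB H).
      by split; [exact: star_ball|exact: sub_star_self|move=> h; apply: nBH; exact: subset_trans h].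
    have := candC _ cs; rewrite ltNge => /negP; apply.
    apply: le_trans (ballm_star bH) _.
    apply: (@le_trans _ _ (C0 ^+ 2 * ballm mu G)).
      by rewrite expr2 -mulrA ler_wpM2l// ltW.
    by rewrite ler_wpM2r// ltW.
  have HsB : H `<=` star BB B.
    by apply: sub_starR => //; [rewrite setIC|have := ballm_gt0 bB; lra].
  have cs : cand (star BB B).
    by split; [exact: star_ball|exact: HsB|move=> h; apply: nBH; exact: subset_trans (sub_star_self bB) h].
  apply: le_trans (Pmin _ cs) _; rewrite -mulrA ler_wpM2l//.
  exact: (ballm_star bB).
have cP : cand P by split.
apply: le_trans (ltW (candC _ cP)).
have L1 : L * ballm mu H <= `|L| * ballm mu H by rewrite ler_wpM2r ?ler_norm// ltW.
apply: le_trans L1 _; apply: (@le_trans _ _ (`|L| * (C0 * ballm mu G))).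
  by rewrite ler_wpM2l.
by rewrite mulrCA mulrA ler_wpM2r ?(ltW G0)// lerDr exprn_ge0// ltW.
Qed.

(** Countably many balls cover almost everything. *)
Lemma null_of_balls (Y : set T) : measurable Y ->
  (forall B, balls BB B -> mu (Y `&` B) = 0%E) -> mu Y = 0%E.
Proof.
move=> mY YB; apply/eqP; rewrite eq_le measure_ge0 andbT.
apply/lee_addgt0Pr => e e0; rewrite add0e.
have [F [cF FB EF]] := ball_approx BB e0 measurableT.
have mF : measurable (\bigcup_(B in F) B).
  by apply: countable_bigcup_measurable => // A /FB; exact: ball_measurable.
have h0 : mu (Y `&` \bigcup_(B in F) B) = 0%E.
  rewrite setI_bigcupr.
  move/pfcard_geP : cF => [->|[g]]; first by rewrite bigcup_set0 measure0.
  have -> : \bigcup_(B in F) (Y `&` B) = \bigcup_n (Y `&` g n).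
    apply/seteqP; split=> x.
      by move=> [A FA [Yx Ax]]; have [n _ gA] := 'surj_g FA; exists n => //; rewrite gA.
    by move=> [n _ gx]; exists (g n) => //; exact: funS.
  apply/eqP; rewrite eq_le measure_ge0 andbT.
  apply: le_trans (le_mu_bigcup (I:=setT) _) _.
    by move=> n _; apply: measurableI => //; apply: (ball_measurable (b:=BB)); apply: FB; exact: funS.
  by rewrite eseries0// => n _ _; apply: YB; apply: FB; exact: funS.
have mC : measurable (setT `\` \bigcup_(B in F) B) by exact: measurableD.
apply: (@le_trans _ _ (mu (Y `&` \bigcup_(B in F) B) + mu (setT `\` \bigcup_(B in F) B))%E).
  apply: (@le_trans _ _ (mu ((Y `&` \bigcup_(B in F) B) `|` (setT `\` \bigcup_(B in F) B)))).
    apply: le_measure; rewrite ?inE//; first by apply: measurableU => //; exact: measurableI.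
    by move=> x Yx; have [h|h] := pselect ((\bigcup_(B in F) B) x); [left|right].
  by apply: measureU2 => //; exact: measurableI.
rewrite h0 add0e; apply: le_trans (ltW EF).
apply: le_measure; rewrite ?inE//; last by move=> x; left.
by apply: measurableU => //; exact: measurableD.
Qed.

End Gaps.

(** * Towers of isolated balls are A_1 weights *)

Section BadWeight.
Set Implicit Arguments.
Unset Strict Implicit.
Context {d : measure_display} {T : measurableType d} {R : realType}.
Context {mu : {measure set T -> \bar R}} (BB : ball_basis mu).
Variables (H P : nat -> set T) (v : nat -> R) (kap Kc c0 : R).
Hypothesis bH : forall j, balls BB (H j).
Hypothesis bP : forall j, balls BB (P j).
Hypothesis HP : forall j, H j `<=` P j.
Hypothesis v0 : forall j, 0 < v j.
Hypothesis kap0 : 0 <= kap.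
Hypothesis Kc0 : 0 <= Kc.
Hypothesis c00 : 0 < c0.
Local Open Scope ereal_scope.

(** The sets [H j] will be balls much smaller than the balls [P j] around them,
    and [v j] is chosen so that the tower is large on [H j] but not in mean over
    [P j]. *)
Definition tower (x : T) : \bar R := kap%:E + \sum_(j <oo) (v j * \1_(H j) x)%:E.

(** The part of the tower that is constant on [B]. *)
Definition tower_base (B : set T) : \bar R :=
  kap%:E + \sum_(j <oo) (if `[< B `<=` H j >] then (v j)%:E else 0).

Definition tower_rest (B : set T) : \bar R :=
  \sum_(j <oo) (if `[< B `<=` H j >] then 0 else (v j)%:E * mu (H j `&` B)).

Let term0 j x : 0 <= (v j * \1_(H j) x)%:E.
Proof. by rewrite lee_fin mulr_ge0// ltW. Qed.

Let base0 B j : 0 <= (if `[< B `<=` H j >] then (v j)%:E else 0).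
Proof. by case: ifP => // _; rewrite lee_fin ltW. Qed.

Let rest0 B j : 0 <= (if `[< B `<=` H j >] then 0 else (v j)%:E * mu (H j `&` B)).
Proof. by case: ifP => // _; rewrite mule_ge0// lee_fin ltW. Qed.

Lemma tower_ge0 x : 0 <= tower x.
Proof. by rewrite adde_ge0// ?lee_fin// nneseries_ge0. Qed.

Lemma tower_base_ge0 B : 0 <= tower_base B.
Proof. by rewrite adde_ge0// ?lee_fin// nneseries_ge0. Qed.

Lemma measurable_tower D : measurable_fun D tower.
Proof.
apply: measurable_funTS; apply: emeasurable_funD; first exact: measurable_cst.
apply: (@ge0_emeasurable_sum _ _ _ setT (fun j x => (v j * \1_(H j) x)%:E) xpredT) => // j _.
apply/measurable_EFinP; apply: measurable_funM => //.
by apply: measurable_indic; exact: ball_measurable (bH j).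
Qed.

Lemma tower_ge_base B x : B x -> tower_base B <= tower x.
Proof.
move=> Bx; apply: leeD => //; apply: lee_nneseries => // j _.
case: asboolP => [BH|_] //; by rewrite indicE mem_set ?mulr1//; exact: BH.
Qed.

Lemma nneseries_ge_term (u : nat -> \bar R) j : (forall i, 0 <= u i) ->
  u j <= \sum_(i <oo) u i.
Proof.
move=> u0; apply: le_trans (nneseries_lim_ge j.+1 _); last by move=> *; exact: u0.
by rewrite big_nat_recr//= leeDr// sume_ge0.
Qed.

Lemma tower_ge_term j x : H j x -> (v j)%:E <= tower x.
Proof.
move=> Hx; rewrite /tower -[leLHS]add0e; apply: leeD; first by rewrite lee_fin.
apply: le_trans (nneseries_ge_term j _) => //.
by rewrite indicE mem_set// mulr1.
Qed.

Lemma avg_ge_level (F : T -> \bar R) (c : R) j : (0 <= c)%R -> (forall x, 0 <= F x) ->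
  (forall x, H j x -> c%:E <= F x) ->
  (c * (ballm mu (H j) / ballm mu (P j)))%:E <= avg (mu:=mu) (P j) F.
Proof.
move=> c1 F0 cF; have P0 := ballm_gt0 (bP j).
have mP := ball_measurable (bP j); have mH := ball_measurable (bH j).
rewrite (avgE _ (bP j)) mulrA [(_ * _ / _)%R]mulrC EFinM; apply: lee_wpmul2l.
  by rewrite lee_fin invr_ge0 ltW.
have -> : (c * ballm mu (H j))%:E = \int[mu]_(x in P j) (c * \1_(H j) x)%:E.
  by rewrite integral_indicZ// setIidl// EFinM -(ballmE (bH j)).
apply: le_lower_integral => x _; first by rewrite lee_fin mulr_ge0.
rewrite indicE; case: (boolP (x \in H j)) => [|_]; last by rewrite mulr0.
by rewrite inE mulr1; exact: cF.
Qed.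

Lemma integral_tower_le B : balls BB B ->
  \int[mu]_(x in B) tower x <= tower_base B * mu B + tower_rest B.
Proof.
move=> bB; have mB := ball_measurable bB.
have mH j := ball_measurable (bH j).
rewrite ge0_integralD//; first last.
  apply: measurable_funTS.
  apply: (@ge0_emeasurable_sum _ _ _ setT (fun j x => (v j * \1_(H j) x)%:E) xpredT) => // j _.
  by apply/measurable_EFinP; apply: measurable_funM.
  by move=> x _; exact: nneseries_ge0.
rewrite integral_nneseries//; last first.
  by move=> j; apply/measurable_EFinP; apply: measurable_funM => //; exact: measurable_funTS.
rewrite (integral_cst mu mB kap%:E) /tower_base ge0_muleDl ?lee_fin ?nneseries_ge0// -addeA.
rewrite (ballmE bB); rewrite leeD2lE; last by rewrite -EFinM.
rewrite [X in _ <= X + _]muleC -nneseriesZl// -nneseriesD//; last first.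
  by move=> j _ _; rewrite mule_ge0// lee_fin ltW// (ballm_gt0 bB).
rewrite -(ballmE bB).
apply: lee_nneseries => [j _ _|j _]; first exact: integral_ge0.
rewrite integral_indicZ ?(ltW (v0 j))//.
case: asboolP => [BH|_]; last by rewrite mule0 add0e.
rewrite adde0 muleC; apply: lee_wpmul2r; first by rewrite lee_fin ltW.
by apply: le_measure; rewrite ?inE//; exact: measurableI.
Qed.

(* the balls [H j] that meet [B] without containing it have a small total mass *)
Hypothesis rest_le : forall B, balls BB B ->
  tower_rest B <= Kc%:E * (tower_base B * mu B).

Lemma avg_tower_le B : balls BB B -> avg (mu:=mu) B tower <= (1 + Kc)%:E * tower_base B.
Proof.
move=> bB; rewrite (avgE _ bB)// lee_pdivrMl ?(ballm_gt0 bB)//.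
apply: le_trans (integral_tower_le bB) _.
apply: le_trans (leeD (lexx _) (rest_le bB)) _.
have b0 : 0 <= tower_base B * mu B by rewrite mule_ge0// tower_base_ge0.
rewrite -{1}[tower_base B * mu B]mul1e -ge0_muleDl ?lee_fin// -EFinD.
by rewrite (ballmE bB) [leLHS]muleA [leLHS]muleC.
Qed.

Lemma maximal1_tower_le x : maximal1 BB tower x <= (1 + Kc)%:E * tower x.
Proof.
have K0 : 0 <= (1 + Kc)%:E by rewrite lee_fin addr_ge0.
apply: maximal1_le; [exact: tower_ge0|by rewrite mule_ge0// tower_ge0|].
move=> B bB Bx; apply: le_trans (avg_tower_le bB) _.
by apply: lee_wpmul2l => //; exact: tower_ge_base.
Qed.

Hypothesis tower_gt0 : forall x, 0 < tower x.
Hypothesis base_lty : forall B, balls BB B ->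
  exists B', [/\ balls BB B', B `<=` B' & tower_base B' < +oo].

Lemma weight_tower : weight (mu:=mu) tower.
Proof.
split; first exact: measurable_tower.
pose Y := [set x | tower x = +oo].
have mY : measurable Y.
  rewrite -[Y]setTI (_ : Y = tower @^-1` [set +oo])//.
  by apply: (measurable_tower (D:=setT)) => //; exact: emeasurable_set1.
have Y0 : mu Y = 0.
  apply: (null_of_balls (BB:=BB)) => // B bB.
  have [B' [bB' BB' base]] := base_lty bB; have mB' := ball_measurable bB'.
  have iB : mu.-integrable B' tower.
    apply/integrableP; split; first exact: measurable_tower.
    under eq_integral do rewrite gee0_abs ?tower_ge0//.
    have := avg_tower_le bB'; rewrite (avgE _ bB')// lee_pdivrMl ?(ballm_gt0 bB')// => /le_lt_trans; apply.
    have bfin : tower_base B' \is a fin_num by rewrite ge0_fin_numE// tower_base_ge0.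
    by rewrite -(fineK bfin) -!EFinM ltry.
  have [N [mN N0 sN]] := integrable_ae mB' iB.
  apply/eqP; rewrite eq_le measure_ge0 andbT -N0; apply: le_measure; rewrite ?inE//.
    by apply: measurableI => //; exact: ball_measurable bB.
  move=> x [Yx Bx]; apply: sN => /= /(_ (BB' _ Bx)); by rewrite Yx.
exists Y; split => // x /= h; rewrite /Y /=; apply: contrapT => nY; apply: h.
by rewrite tower_gt0/= ltey; apply/eqP.
Qed.

Lemma A1_tower : Ap_cst BB 1 tower <= (1 + Kc)%:E.
Proof.
rewrite /Ap_cst eqxx unlock /Lnorm.
have K0 : 0 <= (1 + Kc)%:E by rewrite lee_fin addr_ge0.
case: ifPn => _ //; apply/ess_supP; have [_ ae] := weight_tower.
apply: filterS ae => x /andP[wx0 wxoo] /=.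
have wfin : tower x \is a fin_num by rewrite ge0_fin_numE// ltW.
have w1 : (0 < fine (tower x))%R by rewrite fine_gt0// wx0 wxoo.
have := maximal1_tower_le x; rewrite -[X in _ <= _ * X](fineK wfin) => Mx.
rewrite -[X in _ * X^-1](fineK wfin) inver gt_eqF//.
rewrite gee0_abs ?mule_ge0 ?maximal1_ge0 ?lee_fin ?invr_ge0 ?(ltW w1)//.
by rewrite lee_pdivrMr.
Qed.

(* [P j] is contained in few of the balls [H i], so the mean of the tower over
   [P j] is much smaller than the contribution of [H j] to the mean of order s *)
Hypothesis tower_sparse : forall j, j.+1%:R%:E * tower_base (P j) <=
  (v j * (ballm mu (H j) / ballm mu (P j)) `^ (1 + c0 / (1 + Kc))^-1)%:E.

(** A tower is an A_1 weight with constant 1 + Kc, but it violates the reverse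
    Holder inequality on the balls P_j, where its mean is much smaller than
    its mean of order s. *)
Lemma tower_not_reverse_Holder :
  ~ (forall w, Ainfty BB w -> RH BB (1 + c0 / fine (Ainfty_cst BB w)) w).
Proof.
move=> sharp.
have K1 : (0 < 1 + Kc)%R by rewrite ltr_pwDl.
have A1 : Ap BB 1 tower by split; [exact: weight_tower|apply: le_lt_trans A1_tower _; rewrite ltry].
have Ai : Ainfty BB tower by exists 1%R.
have H0 j := ballm_gt0 (bH j); have P0 j := ballm_gt0 (bP j).
have ratio j : (0 < ballm mu (H j) / ballm mu (P j) <= 1)%R.
  by rewrite divr_gt0//= ler_pdivrMr// mul1r (le_ballm (bH j) (bP j)).
have basefin j : tower_base (P j) \is a fin_num.
  rewrite ge0_fin_numE ?tower_base_ge0//.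
  move: (tower_sparse j); case: (tower_base (P j)) => [r _|h|//]; first exact: ltry.
  by rewrite gt0_muley ?lte_fin ?ltr0n in h.
(* the mean of the tower over P_j *)
have avgP j : exists a : R, [/\ (0 < a)%R,
    \int[mu]_(x in P j) tower x = (a * ballm mu (P j))%:E,
    avg (mu:=mu) (P j) tower = a%:E & (a <= (1 + Kc) * fine (tower_base (P j)))%R].
  have mP := ball_measurable (bP j); have mHj := ball_measurable (bH j).
  have le1 := avg_tower_le (bP j).
  have afin : avg (mu:=mu) (P j) tower \is a fin_num.
    rewrite ge0_fin_numE; last by apply: avg_ge0 => x _; exact: tower_ge0.
    by apply: le_lt_trans le1 _; rewrite -(fineK (basefin j)) -EFinM ltry.
  exists (fine (avg (mu:=mu) (P j) tower)); split.
  - have : (0 < (v j * (ballm mu (H j) / ballm mu (P j)))%:E).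
      by rewrite lte_fin mulr_gt0//; case/andP: (ratio j).
    rewrite -lte_fin fineK// => /lt_le_trans; apply.
    by apply: avg_ge_level; [exact: ltW|exact: tower_ge0|exact: tower_ge_term].
  - rewrite EFinM fineK// (avgE _ (bP j))// muleAC -EFinM mulVf ?gt_eqF// mul1e.
    by [].
  - by rewrite fineK.
  - by rewrite -lee_fin EFinM !fineK.
have [a [a0 ia _ _]] := avgP 0%N.
pose A := Ainfty_cst BB tower.
have A_le : A <= (1 + Kc)%:E.
  apply: le_trans A1_tower; apply: ereal_inf_lbound; exists 1%R => //.
have A_ge : 1 <= A.
  apply: le_ereal_inf_tmp => _ [p [p1 Ap'] <-].
  exact: (Ap_cst_ge1 p1 tower_ge0 weight_tower (bP 0%N) a0 ia).
have Afin : A \is a fin_num.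
  rewrite ge0_fin_numE; last exact: le_trans A_ge.
  by apply: le_lt_trans A_le _; rewrite ltry.
have A1' : (1 <= fine A)%R by rewrite -lee_fin fineK.
have AK : (fine A <= 1 + Kc)%R by rewrite -lee_fin fineK.
pose s := (1 + c0 / fine A)%R; pose s0 := (1 + c0 / (1 + Kc))%R.
have s00 : (0 < s0)%R by rewrite addr_gt0// divr_gt0.
have ss : (s0 <= s)%R.
  rewrite lerD2l ler_wpM2l ?(ltW c00)// lef_pV2 ?posrE//.
  exact: lt_le_trans A1'.
have sgt0 : (0 < s)%R by exact: lt_le_trans ss.
have Q := sharp tower Ai; rewrite /RH -/A -/s in Q.
have Q0 : 0 <= RH_cst BB s tower.
  apply: le_trans (ereal_sup_ubound _); last by exists (P 0%N).
  have [a' [a'0 _ -> _]] := avgP 0%N.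
  by rewrite mule_ge0 ?poweR_ge0// inver gt_eqF// lee_fin invr_ge0 ltW.
have Qfin : RH_cst BB s tower \is a fin_num by rewrite ge0_fin_numE.
pose q := fine (RH_cst BB s tower); have q0 : (0 <= q)%R by exact: fine_ge0.
suff key j : (j.+1%:R <= q * (1 + Kc))%R.
  have := key (Num.trunc (q * (1 + Kc))); rewrite leNgt => /negP; apply.
  exact: truncnS_gt.
have [a' [a'0 _ avga' a'le]] := avgP j.
have /andP[r0 r1] := ratio j.
set rho := (ballm mu (H j) / ballm mu (P j))%R in r0 r1 *.
have mP := ball_measurable (bP j); have mHj := ball_measurable (bH j).
have lower : (v j * rho `^ s^-1)%:E <= avgr (mu:=mu) s (P j) tower.
  have -> : (v j * rho `^ s^-1)%:E = ((v j `^ s * rho)%:E) `^ s^-1.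
    by rewrite poweR_EFin powRM ?powR_ge0 ?(ltW r0)// -powRrM mulfV ?gt_eqF// powRr1 ?ltW.
  apply: gt0_ler_poweR.
  - by rewrite invr_ge0 ltW.
  - by rewrite in_itv/= leey andbT lee_fin mulr_ge0 ?powR_ge0 ?ltW.
  - by rewrite in_itv/= leey andbT; apply: avg_ge0 => x _; exact: poweR_ge0.
  apply: avg_ge_level => [|x|x /tower_ge_term h]; [exact: powR_ge0|exact: poweR_ge0|].
  rewrite -poweR_EFin; apply: gt0_ler_poweR => //.
  - exact: ltW.
  - by rewrite in_itv/= leey andbT lee_fin ltW.
  - by rewrite in_itv/= leey andbT abse_ge0.
  - by rewrite gee0_abs ?tower_ge0.
have upper : avgr (mu:=mu) s (P j) tower <= (q * a')%:E.
  have : avgr (mu:=mu) s (P j) tower * (avg (mu:=mu) (P j) tower)^-1 <= RH_cst BB s tower.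
    by apply: ereal_sup_ubound; exists (P j).
  by rewrite avga' inver gt_eqF// lee_pdivrMr// -[RH_cst _ _ _]fineK// -EFinM.
have h1 := le_trans lower upper; rewrite lee_fin in h1.
have h2 := tower_sparse j; rewrite -[tower_base _]fineK// -EFinM lee_fin -/rho -/s0 in h2.
have h3 : (rho `^ s0^-1 <= rho `^ s^-1)%R.
  by apply: ger_powR; [rewrite r0 r1|rewrite lef_pV2 ?posrE].
have base_gt0 : (0 < fine (tower_base (P j)))%R.
  by rewrite -(pmulr_rgt0 _ K1); exact: lt_le_trans a'le.
have h4 : (j.+1%:R * fine (tower_base (P j)) <= q * ((1 + Kc) * fine (tower_base (P j))))%R.
  apply: le_trans h2 _; apply: (@le_trans _ _ (v j * rho `^ s^-1)%R).
    by rewrite ler_wpM2l// ltW.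
  by apply: le_trans h1 _; rewrite ler_wpM2l.
by move: h4; rewrite mulrA ler_pM2r.
Qed.

End BadWeight.

Section NoGaps.
Set Implicit Arguments.
Unset Strict Implicit.
Context {d : measure_display} {T : measurableType d} {R : realType}.
Context {mu : {measure set T -> \bar R}} (BB : ball_basis mu).
Local Notation C0 := (star_cst BB).
Let C00 : 0 < C0. Proof. exact: star_cst_gt0. Qed.

Lemma nneseries_le_telescope (u : nat -> \bar R) (Y : nat -> R) (c : R) :
  (forall i, 0 <= u i)%E -> 0 <= Y 0%N ->
  (forall n, (u n + (Y n)%:E <= (Y n.+1)%:E)%E) -> (forall n, Y n <= c) ->
  (\sum_(i <oo) u i <= c%:E)%E.
Proof.
move=> u0 Y0 step Yc.
have part n : (\sum_(0 <= i < n) u i <= (Y n)%:E)%E.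
  elim: n => [|n IH]; first by rewrite big_nil lee_fin.
  rewrite big_nat_recr//= addeC; apply: le_trans (step n).
  by apply: leeD.
apply: lime_le; first by apply: is_cvg_nneseries => *; exact: u0.
apply: nearW => n; apply: le_trans (part n) _.
by rewrite lee_fin.
Qed.

(** A small ratio [rho] is beaten by its power of order [s^-1 < 1]. *)
Lemma ratio_powR_ge (s rho G : R) : 1 < s -> 0 < rho -> 0 <= G ->
  G `^ (1 - s^-1)^-1 <= rho^-1 -> G * rho <= rho `^ s^-1.
Proof.
move=> s1 r0 G0 h.
have th0 : 0 < 1 - s^-1 by rewrite subr_gt0 invf_lt1// (lt_trans ltr01).
have -> : rho `^ s^-1 = rho^-1 `^ (1 - s^-1) * rho.
  rewrite -[rho^-1]powR_inv1 ?(ltW r0)// -powRrM mulN1r opprB.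
  rewrite -[X in _ = _ * X]powRr1 ?(ltW r0)// -powRD ?subrK//.
  by rewrite (gt_eqF r0) implybT.
rewrite ler_wpM2r ?(ltW r0)//.
have := ge0_ler_powR (ltW th0) _ _ h; rewrite !nnegrE powR_ge0 invr_ge0 (ltW r0).
move=> /(_ isT isT).
by rewrite -powRrM mulVf ?gt_eqF// powRr1.
Qed.

Lemma isolated_absorb H P B : isolated BB H P -> balls BB B -> ~ B `<=` H ->
  (mu (H `&` B) = 0 \/ [/\ mu (H `&` B) <= (ballm mu H)%:E & (ballm mu P <= 2 * C0 * ballm mu B)%R])%E.
Proof.
move=> [bH bP HP nPH iso] bB nBH.
have [BH|BH] := pselect (B `&` H !=set0); last first.
  left; rewrite (_ : H `&` B = set0) ?measure0//.
  by apply/seteqP; split => // x [Hx Bx]; apply: BH; exists x.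
right; split; last by case: (iso B bB BH).
have mH := ball_measurable bH; have mB := ball_measurable bB.
by rewrite -(ballmE bH); apply: le_measure; rewrite ?inE//; exact: measurableI.
Qed.

(** First case: a fixed ball [Q0] lies in none of the balls [H] of a sequence of
    isolated pairs with unbounded ratios.  The tower has base 1, and [H j] gets
    the weight 2^-(j+1) times the ratio of the pair, that is the mass
    2^-(j+1) mu (P j).  A later [H j] cannot contain an earlier [P i]: the hull of
    [P i] and [Q0] would then be comparable to [P j], which is chosen much larger
    than this hull. *)
Section Avoiding.
Variables (c0 : R) (Q0 : set T).
Hypothesis c00 : 0 < c0.
Hypothesis bQ0 : balls BB Q0.
Hypothesis avoid : forall L : R, exists H P,
  [/\ isolated BB H P, L * ballm mu H <= ballm mu P & ~ Q0 `<=` H].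

Let s0 := 1 + c0 / (1 + 2 * C0).

(* the ratio needed when the weights chosen so far add up to at most [X] *)
Let G (j : nat) (X : R) : R := 2 ^+ j.+1 * (j.+1%:R * (1 + X)).

Let L (j : nat) (X : R) : R := G j X `^ (1 - s0^-1)^-1 + X + 1.

Let pick_spec (j : nat) (X : R) (t : set T * set T * set T) :=
  [/\ isolated BB t.1.1 t.1.2, L j X * ballm mu t.1.1 <= ballm mu t.1.2,
      ~ Q0 `<=` t.1.1, balls BB t.2 & t.1.2 `|` Q0 `<=` t.2].

Let pick_ex : exists F : nat -> R -> set T * set T * set T,
  forall j X, pick_spec j X (F j X).
Proof.
have ex (z : nat * R) : exists t, pick_spec z.1 z.2 t.
  case: z => j X /=.
  have [H [P [iso LHP nQ]]] := avoid (L j X).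
  have bP : balls BB P by case: iso.
  have [Q' [bQ' PQ' QQ']] := ball_join_hull bP bQ0.
  exists (H, P, Q'); split => //= x [|]; [exact: PQ'|exact: QQ'].
have [F FE] := choice ex.
by exists (fun j X => F (j, X)) => j X; exact: (FE (j, X)).
Qed.

Lemma avoiding_not_sharp :
  ~ (forall w, Ainfty BB w -> RH BB (1 + c0 / fine (Ainfty_cst BB w)) w).
Proof.
have [F FP] := pick_ex.
pose lam (t : set T * set T * set T) := ballm mu t.1.2 / ballm mu t.1.1.
pose X := fix X (j : nat) : R := if j is i.+1 then
    X i + 2^-1 ^+ i.+1 * lam (F i (X i)) + 2 * C0 * ballm mu (F i (X i)).2 / ballm mu (F i (X i)).1.2
  else 0.
pose H j := (F j (X j)).1.1; pose P j := (F j (X j)).1.2; pose Q j := (F j (X j)).2.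
pose v j : R := 2^-1 ^+ j.+1 * (ballm mu (P j) / ballm mu (H j)).
have iso j : isolated BB (H j) (P j) by case: (FP j (X j)).
have big j : L j (X j) * ballm mu (H j) <= ballm mu (P j) by case: (FP j (X j)).
have nQ j : ~ Q0 `<=` H j by case: (FP j (X j)).
have bQ j : balls BB (Q j) by case: (FP j (X j)).
have PQ j : P j `|` Q0 `<=` Q j by case: (FP j (X j)).
have bH j : balls BB (H j) by case: (iso j).
have bP j : balls BB (P j) by case: (iso j).
have HP j : H j `<=` P j by case: (iso j).
have XS j : X j.+1 = X j + v j + 2 * C0 * ballm mu (Q j) / ballm mu (P j) by [].
have H0 j := ballm_gt0 (bH j); have P0 j := ballm_gt0 (bP j); have Q0' j := ballm_gt0 (bQ j).
have v0 j : 0 < v j by rewrite mulr_gt0 ?exprn_gt0 ?divr_gt0.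
have q0 j : 0 < 2 * C0 * ballm mu (Q j) / ballm mu (P j).
  by rewrite divr_gt0// mulr_gt0// mulr_gt0.
have XSge j : X j + v j <= X j.+1 by rewrite XS lerDl ltW.
have Xmono i j : (i <= j)%N -> X i <= X j.
  move=> /subnK <-; elim: (j - i)%N => [|k IH]; first by rewrite add0n.
  rewrite addSn; apply: le_trans IH _; apply: le_trans (XSge _).
  by rewrite lerDl ltW.
have X0 j : 0 <= X j by exact: (Xmono 0%N j).
have L0 j : X j < L j (X j).
  have := powR_ge0 (G j (X j)) (1 - s0^-1)^-1; rewrite /L; lra.
(* a ball P_i inside a later H_j would make Q_i, which contains Q0, too large *)
have notin i j : (i <= j)%N -> ~ P i `<=` H j.
  rewrite leq_eqVlt => /predU1P[->|ij]; first by case: (iso j).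
  move=> PH; have [_ _ _ _ alt] := iso j.
  have [|QH|le] := alt (Q i) (bQ i).
  - have [x Px] := ball_nonempty (bP i); exists x; split; last exact: PH.
    by apply: PQ; left.
  - by apply: (nQ j) => x Qx; apply: QH; apply: PQ; right.
  have : X j * ballm mu (P i) < X i.+1 * ballm mu (P i).
    apply: (@lt_le_trans _ _ (2 * C0 * ballm mu (Q i))).
      apply: lt_le_trans le; apply: lt_le_trans (big j).
      apply: (@le_lt_trans _ _ (X j * ballm mu (H j))).
        by rewrite ler_wpM2l// (le_ballm (bP i) (bH j)).
      by rewrite ltr_pM2r.
    rewrite -ler_pdivrMr// XS lerDr.
    by rewrite addr_ge0// ltW.
  by rewrite ltr_pM2r// ltNge Xmono.
have base_self j : (tower_base H v 1 (P j) <= (1 + X j)%:E)%E.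
  rewrite /tower_base EFinD leeD2lE//.
  apply: (@nneseries_le_telescope _ (fun n => X (minn n j))).
  - by move=> i; case: ifP => // _; rewrite lee_fin ltW.
  - by rewrite min0n.
  - move=> n; cbv beta; have [nj|jn] := ltnP n j.
      rewrite (minn_idPl nj).
      case: asboolP => _; rewrite -?EFinD lee_fin; first by rewrite addrC.
      by rewrite add0r Xmono.
    case: asboolP => [/(notin _ _ jn)//|_].
    by rewrite add0e (minn_idPr (leqW jn)).
  - by move=> n; apply: Xmono; rewrite geq_minr.
have base_ge B : (1 <= tower_base H v 1 B)%E.
  rewrite /tower_base leeDl// nneseries_ge0// => n _ _.
  by case: ifP => // _; rewrite lee_fin ltW.
have C02 : 0 <= 2 * C0 by rewrite mulr_ge0// ltW.
apply: (@tower_not_reverse_Holder _ _ _ _ BB H P v 1 (2 * C0) c0) => //.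
- move=> B bB; have mB0 := ballm_gt0 bB.
  apply: (@le_trans _ _ (2 * C0 * ballm mu B)%:E); last first.
    rewrite EFinM; apply: lee_wpmul2l; first by rewrite lee_fin.
    rewrite (ballmE bB) -[leLHS]mul1e; apply: lee_wpmul2r => //.
    by rewrite lee_fin ltW.
  set c := 2 * C0 * ballm mu B.
  have c0' : 0 <= c by rewrite mulr_ge0// ltW.
  apply: (@nneseries_le_telescope _ (fun n => (1 - 2^-1 ^+ n) * c)).
  + by move=> i; case: ifP => // _; rewrite mule_ge0// lee_fin ltW.
  + by rewrite expr0 subrr mul0r.
  + move=> n; have step : 2^-1 ^+ n.+1 * c + (1 - 2^-1 ^+ n) * c = (1 - 2^-1 ^+ n.+1) * c.
      by rewrite -mulrDl exprS; congr (_ * _); lra.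
    rewrite -step EFinD leeD2rE//.
    have pw0 : 0 <= 2^-1 ^+ n.+1 * c by rewrite mulr_ge0// exprn_ge0.
    case: asboolP => [_|nBH]; first by rewrite lee_fin.
    have [->|[le1 le2]] := isolated_absorb (iso n) bB nBH; first by rewrite mule0 lee_fin.
    apply: (@le_trans _ _ ((v n)%:E * (ballm mu (H n))%:E)%E).
      by apply: lee_wpmul2l => //; rewrite lee_fin ltW.
    rewrite -EFinM lee_fin /v -mulrA ler_wpM2l ?exprn_ge0//.
    by rewrite divfK ?gt_eqF.
  + by move=> n; rewrite ler_piMl// gerBl exprn_ge0.
- move=> x; rewrite /tower; apply: lt_le_trans (@lte01 R) _.
  rewrite leeDl// nneseries_ge0// => n _ _.
  by rewrite lee_fin mulr_ge0// ltW.
- move=> B bB; have [B' [bB' BB' QB']] := ball_join_hull bB bQ0.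
  exists B'; split => //; rewrite /tower_base eseries0 ?adde0 ?ltry// => n _ _.
  by case: asboolP => // B'H; exfalso; apply: (nQ n); exact: subset_trans QB' B'H.
- move=> j; rewrite -/s0.
  have Gn0 : 0 <= G j (X j) by rewrite /G !mulr_ge0// ?exprn_ge0// addr_ge0.
  have s1 : 1 < s0 by rewrite ltrDl divr_gt0// ltr_pwDl.
  apply: (@le_trans _ _ (j.+1%:R * (1 + X j))%:E).
    by rewrite EFinM; apply: lee_wpmul2l.
  rewrite lee_fin; set rho := ballm mu (H j) / ballm mu (P j).
  have r0 : 0 < rho by rewrite divr_gt0.
  have := @ratio_powR_ge s0 rho (G j (X j)) s1 r0 Gn0.
  have -> : v j = 2^-1 ^+ j.+1 * rho^-1 by rewrite /v /rho invf_div.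
  have hL : G j (X j) `^ (1 - s0^-1)^-1 <= rho^-1.
    rewrite /rho invf_div ler_pdivlMr//; apply: le_trans (big j).
    by rewrite ler_wpM2r ?(ltW (H0 j))// /L -addrA lerDl addr_ge0.
  move=> /(_ hL) {hL}.
  move: (rho `^ _) => y hy.
  have : 2^-1 ^+ j.+1 * rho^-1 * (G j (X j) * rho) <= 2^-1 ^+ j.+1 * rho^-1 * y.
    by rewrite ler_wpM2l// mulr_ge0 ?exprn_ge0 ?invr_ge0 ?(ltW r0).
  apply: le_trans; rewrite /G; move: (j.+1%:R * _) => z.
  by rewrite mulrACA mulVf ?gt_eqF// mulr1 mulrA exprVn mulVf ?mul1r.
Qed.

End Avoiding.

(** Second case: every ball lies in [H] for all the isolated pairs of large
    ratio.  The pairs can then be nested, and the tower has base 0.  The weights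
    decrease geometrically, and the masses increase geometrically, so every sum
    is controlled by one of its extreme terms. *)
Section Absorbing.
Variable c0 : R.
Hypothesis c00 : 0 < c0.
Hypothesis gaps : forall L : R, exists H P, isolated BB H P /\ L * ballm mu H <= ballm mu P.
Hypothesis absorb : forall Q, balls BB Q -> exists L : R, forall H P,
  isolated BB H P -> L * ballm mu H <= ballm mu P -> Q `<=` H.

Let s0 := 1 + c0 / (1 + 2 * C0).

Let g (j : nat) : R := (4 * j.+1%:R) `^ (1 - s0^-1)^-1 + 4 + j%:R.

Let next_spec (j : nat) (Q : set T) (t : set T * set T) := balls BB Q ->
  [/\ isolated BB t.1 t.2, g j * ballm mu t.1 <= ballm mu t.2 & Q `<=` t.1].

Let next_ex : exists F : nat -> set T -> set T * set T,
  forall j Q, next_spec j Q (F j Q).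
Proof.
have ex (z : nat * set T) : exists t, next_spec z.1 z.2 t.
  case: z => j Q /=; have [bQ|nQ] := pselect (balls BB Q); last by exists (Q, Q) => /nQ.
  have [L QL] := absorb bQ.
  have [H [P [iso le]]] := gaps (Num.max L (g j)).
  have bH : balls BB H by case: iso.
  have H0 := ltW (ballm_gt0 bH).
  exists (H, P) => _; split => //=.
    by apply: le_trans le; rewrite ler_wpM2r// le_max lexx orbT.
  by apply: (QL _ P) => //; apply: le_trans le; rewrite ler_wpM2r// le_max lexx.
have [F FE] := choice ex.
by exists (fun j Q => F (j, Q)) => j Q; exact: (FE (j, Q)).
Qed.

Lemma absorbing_not_sharp :
  ~ (forall w, Ainfty BB w -> RH BB (1 + c0 / fine (Ainfty_cst BB w)) w).
Proof.
have [F FP] := next_ex.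
have [Q [_ [[bQ _ _ _ _] _]]] := gaps 0.
pose HP := fix HP (j : nat) : set T * set T :=
  if j is i.+1 then F i.+1 (HP i).2 else F 0%N Q.
pose H j := (HP j).1; pose P j := (HP j).2.
have spec j : [/\ isolated BB (H j) (P j), g j * ballm mu (H j) <= ballm mu (P j) &
    (if j is i.+1 then P i else Q) `<=` H j].
  elim: j => [|j [iso _ _]]; first exact: FP.
  by apply: FP; case: iso.
have iso j : isolated BB (H j) (P j) by case: (spec j).
have big j : g j * ballm mu (H j) <= ballm mu (P j) by case: (spec j).
have PH j : P j `<=` H j.+1 by case: (spec j.+1).
have bH j : balls BB (H j) by case: (iso j).
have bP j : balls BB (P j) by case: (iso j).
have HsubP j : H j `<=` P j by case: (iso j).
have H0 j := ballm_gt0 (bH j); have P0 j := ballm_gt0 (bP j).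
have Hmono i j : (i <= j)%N -> H i `<=` H j.
  move=> /subnK <-; elim: (j - i)%N => [|k IH]; first by rewrite add0n.
  by rewrite addSn; apply: subset_trans IH _; exact: subset_trans (HsubP _) (PH _).
pose v := fix v (j : nat) : R :=
  if j is i.+1 then 2 * v i * (ballm mu (H i) / ballm mu (P i)) else 1.
have vS j : v j.+1 = 2 * v j * (ballm mu (H j) / ballm mu (P j)) by [].
have v0 j : 0 < v j.
  by elim: j => // j IH; rewrite vS mulr_gt0 ?divr_gt0// mulr_gt0.
have g4 j : 4 + j%:R <= g j.
  by have := powR_ge0 (4 * j.+1%:R) (1 - s0^-1)^-1; rewrite /g; lra.
have ratio j : ballm mu (H j) / ballm mu (P j) <= 4^-1.
  rewrite ler_pdivrMr// -ler_pdivrMl// invrK; apply: le_trans (big j).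
  rewrite ler_wpM2r ?(ltW (H0 j))//; apply: le_trans (g4 j).
  by rewrite lerDl.
have v2 j : 2 * v j.+1 <= v j.
  rewrite vS; have := ler_wpM2l (ltW (v0 j)) (ratio j).
  by move: (v j) (ballm mu (H j) / _) => a rho; lra.
have vP j : v j.+1 * ballm mu (P j) = 2 * (v j * ballm mu (H j)).
  by rewrite vS -mulrA divfK ?gt_eqF// mulrA.
have v2H j : 2 * (v j * ballm mu (H j)) <= v j.+1 * ballm mu (H j.+1).
  by rewrite -vP ler_wpM2l ?(ltW (v0 _))// (le_ballm (bP j) (bH j.+1)).
have eventually B : balls BB B -> exists J, forall j, (J <= j)%N -> B `<=` H j.
  move=> bB; have [L BL] := absorb bB.
  exists (Num.truncn L).+1 => j Jj; apply: (BL _ _ (iso j)).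
  apply: le_trans (big j); rewrite ler_wpM2r ?(ltW (H0 j))//.
  apply: le_trans (g4 j); apply: le_trans (ltW (truncnS_gt L)) _.
  by rewrite -[leLHS]add0r lerD// ler_nat.
have base_term0 B n : (0 <= (if `[< B `<=` H n >] then (v n)%:E else 0))%E.
  by case: ifP => // _; rewrite lee_fin ltW.
have notin i j : (i <= j)%N -> ~ P j `<=` H i.
  move=> ij PHi; case: (iso j) => _ _ _ + _; apply.
  exact: subset_trans PHi (Hmono _ _ ij).
have base_self j : (tower_base H v 0 (P j) <= (2 * v j.+1)%:E)%E.
  rewrite /tower_base add0e.
  apply: (@nneseries_le_telescope _ (fun n => 2 * v j.+1 - 2 * v (maxn n j.+1))).
  - exact: base_term0.
  - by rewrite max0n subrr.
  - move=> n; cbv beta; have [nj|jn] := leqP n j.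
      case: asboolP => [/(notin _ _ nj)//|_].
      by rewrite add0e (maxn_idPr (leqW nj)) (maxn_idPr (nj : (n.+1 <= j.+1)%N)).
    rewrite (maxn_idPl jn) (maxn_idPl (leqW jn)).
    have := v2 n; have := v0 n; move: (v n) (v n.+1) (v j.+1) => a b c a0 ab.
    by case: asboolP => _; rewrite -?EFinD lee_fin; lra.
  - by move=> n; rewrite gerBl mulr_ge0// ltW.
apply: (@tower_not_reverse_Holder _ _ _ _ BB H P v 0 (2 * C0) c0) => //.
- by rewrite mulr_ge0// ltW.
- move=> B bB; have mB0 := ballm_gt0 bB; have mB := ball_measurable bB.
  have [J0 J0B] := eventually B bB.
  have exJ : exists n, `[< B `<=` H n >] by exists J0; apply/asboolP; exact: J0B.
  case: (ex_minnP exJ) => J /asboolP BJ Jmin.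
  have BH j : (J <= j)%N -> B `<=` H j by move=> /Hmono; exact: subset_trans.
  have nBH j : (j < J)%N -> ~ B `<=` H j.
    by move=> jJ /asboolP /Jmin; rewrite leqNgt jJ.
  apply: (@le_trans _ _ (2 * C0 * (v J * ballm mu B))%:E); last first.
    rewrite EFinM; apply: lee_wpmul2l; first by rewrite lee_fin mulr_ge0// ltW.
    rewrite (ballmE bB) EFinM; apply: lee_wpmul2r; first by rewrite lee_fin ltW.
    rewrite /tower_base add0e.
    apply: le_trans (nneseries_ge_term J (base_term0 B)).
    by case: asboolP.
  have rest0 i : (0 <= (if `[< B `<=` H i >] then 0 else (v i)%:E * mu (H i `&` B)))%E.
    by case: ifP => // _; rewrite mule_ge0// lee_fin ltW.
  have rhs0 : 0 <= 2 * C0 * (v J * ballm mu B) by rewrite !mulr_ge0// ltW.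
  case: J => [|J] in BJ Jmin BH nBH rhs0 *.
    rewrite /tower_rest eseries0 ?lee_fin// => i _ _.
    by case: asboolP => // h; exfalso; apply: h; exact: BH.
  have [BHJ|BHJ] := pselect (B `&` H J !=set0); last first.
    rewrite /tower_rest eseries0 ?lee_fin// => i _ _.
    case: asboolP => // h; have iJ : (i <= J)%N.
      by rewrite leqNgt; apply/negP => /BH.
    rewrite (_ : H i `&` B = set0) ?measure0 ?mule0//.
    apply/seteqP; split => // x [Hx Bx]; apply: BHJ; exists x; split => //.
    exact: Hmono Hx.
  have PJ : ballm mu (P J) <= 2 * C0 * ballm mu B.
    case: (iso J) => _ _ _ _ /(_ _ bB BHJ)[/nBH|//].
    by move=> /(_ (ltnSn _)).
  apply: (@le_trans _ _ (2 * (v J * ballm mu (H J)))%:E); last first.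
    by rewrite lee_fin -vP mulrCA ler_wpM2l// ltW.
  pose a n := v n * ballm mu (H n).
  have a0 n : 0 < a n by rewrite mulr_gt0.
  have restle n : ((v n)%:E * mu (H n `&` B) <= (a n)%:E)%E.
    rewrite EFinM; apply: lee_wpmul2l; first by rewrite lee_fin ltW.
    have mHn := ball_measurable (bH n).
    rewrite -(ballmE (bH n)); apply: le_measure; rewrite ?inE//; exact: measurableI.
  apply: (@nneseries_le_telescope _ (fun n => if (n <= J)%N then a n else 2 * a J)) => //.
  + by rewrite leq0n ltW.
  + move=> n; cbv beta; have [nJ|Jn] := leqP n J; last first.
      rewrite leqNgt ltnS ltnW//=.
      by case: asboolP => [_|h]; [rewrite add0e|exfalso; apply: h; exact: BH].
    apply: (@le_trans _ _ (a n + a n)%:E).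
      rewrite EFinD leeD2rE//; case: asboolP => _; last exact: restle.
      by rewrite lee_fin ltW.
    rewrite lee_fin; have [nJ'|Jn] := ltnP n J.
      by apply: le_trans (v2H n); rewrite -/(a n) mulr_natl mulr2n.
    have -> : n = J by apply/eqP; rewrite eqn_leq nJ Jn.
    by rewrite mulr_natl mulr2n.
  + move=> n; case: leqP => // nJ.
    have mono k : a k <= a k.+1 by have := v2H k; rewrite -/(a k) -/(a k.+1); have := a0 k; move: (a k) (a k.+1) => x y; lra.
    have : a n <= a J.
      move: nJ => /subnK <-; elim: (J - n)%N => [|k IH]; first by rewrite add0n.
      by rewrite addSn; exact: le_trans IH (mono _).
    rewrite -/(a J); have := a0 J; move: (a J) (a n) => x y; lra.
- move=> x; have [B [bB Bx _]] := ball_join BB x x.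
  have [J /(_ J (leqnn _)) BJ] := eventually B bB.
  have := tower_ge_term (kap:=0) v0 (lexx 0) (BJ _ Bx).
  by apply: lt_le_trans; rewrite lte_fin.
- move=> B bB; exists B; split => //; apply: (@le_lt_trans _ _ 2%:E); last exact: ltry.
  rewrite /tower_base add0e.
  apply: (@nneseries_le_telescope _ (fun n => 2 - 2 * v n)).
  + exact: base_term0.
  + by rewrite /= mulr1 subrr.
  + move=> n; have := v2 n; have := v0 n; move: (v n) (v n.+1) => a b a0 ab.
    by case: asboolP => _; rewrite -?EFinD lee_fin; lra.
  + by move=> n; rewrite gerBl mulr_ge0// ltW.
- move=> j; rewrite -/s0.
  have s1 : 1 < s0 by rewrite ltrDl divr_gt0// ltr_pwDl// mulr_ge0// ltW.
  apply: (@le_trans _ _ (j.+1%:R * (2 * v j.+1))%:E).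
    by rewrite EFinM; apply: lee_wpmul2l.
  rewrite lee_fin vS; set rho := ballm mu (H j) / ballm mu (P j).
  have r0 : 0 < rho by rewrite divr_gt0.
  have hL : (4 * j.+1%:R) `^ (1 - s0^-1)^-1 <= rho^-1.
    rewrite /rho invf_div ler_pdivlMr//; apply: le_trans (big j).
    by rewrite ler_wpM2r ?(ltW (H0 j))// /g -addrA lerDl addr_ge0.
  have Gn0 : 0 <= 4 * j.+1%:R :> R by rewrite mulr_ge0.
  have := @ratio_powR_ge s0 rho (4 * j.+1%:R) s1 r0 Gn0 hL.
  move: (rho `^ _) (v0 j) => y vj0 hy.
  have : v j * (4 * j.+1%:R * rho) <= v j * y by rewrite ler_wpM2l// ltW.
  apply: le_trans; rewrite le_eqVlt; apply/orP; left; apply/eqP.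
  by move: (j.+1%:R) => z; ring.
Qed.

End Absorbing.

(** The constants of a tower do not depend on the ratios of its pairs, so the
    exponent in the sharp reverse Holder property stays away from 1 and the
    inequality fails for large ratios. *)
Lemma gap_bound_of_sharp : sharp_reverse_Holder BB -> exists C, gap_bound BB C.
Proof.
move=> [c0 c00 sharp]; apply: contrapT => nogap.
have [[Q0 [bQ0 avoid]]|nav] := pselect (exists Q0, balls BB Q0 /\ forall L : R,
  exists H P, [/\ isolated BB H P, L * ballm mu H <= ballm mu P & ~ Q0 `<=` H]).
  exact: (avoiding_not_sharp c00 bQ0 avoid sharp).
apply: (absorbing_not_sharp c00 _ _ sharp).
  by move=> L; have [H [P [iso le]]] := isolated_of_gap L nogap; exists H, P.
move=> Q bQ; apply: contrapT => nL; apply: nav; exists Q; split => // L.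
apply: contrapT => nHP; apply: nL; exists L => H P iso le; apply: contrapT => nQH.
by apply: nHP; exists H, P.
Qed.

End NoGaps.

(** * Reverse weak type estimates *)

Section LlogL.
Set Implicit Arguments.
Unset Strict Implicit.
Context {d : measure_display} {T : measurableType d} {R : realType}.
Context {mu : {measure set T -> \bar R}} (BB : ball_basis mu).
Local Notation C0 := (star_cst BB).
Let C00 : 0 < C0. Proof. exact: star_cst_gt0. Qed.
Local Open Scope ereal_scope.

Lemma integral_bigcup_le (I : set nat) (F : nat -> set T) (g : T -> R) :
  measurable_fun setT g -> (forall x, (0 <= g x)%R) ->
  (forall n, I n -> measurable (F n)) ->
  \int[mu]_(x in \bigcup_(n in I) F n) (g x)%:E <=
  \sum_(n <oo | n \in I) \int[mu]_(x in F n) (g x)%:E.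
Proof.
move=> mg g0 mF; set V := \bigcup_(n in I) F n.
have mV : measurable V by exact: bigcup_measurable.
pose u n x := if n \in I then (g x)%:E * (\1_(F n) x)%:E else 0.
have u0 n x : 0 <= u n x.
  by rewrite /u; case: ifP => // _; rewrite -EFinM lee_fin mulr_ge0.
have mu' n : measurable_fun V (u n).
  rewrite /u; case: (boolP (n \in I)) => [nI|_]; last exact: measurable_cst.
  apply: measurable_funTS; apply: emeasurable_funM; first exact/measurable_EFinP.
  by apply/measurable_EFinP; apply: measurable_indic; apply: mF; rewrite inE in nI.
apply: (@le_trans _ _ (\int[mu]_(x in V) \sum_(n <oo) u n x)).
  apply: le_lower_integral => [x _|x [n In Fx]]; first by rewrite lee_fin.
  apply: le_trans (nneseries_ge_term n (fun i => u0 i x)).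
  by rewrite /u mem_set// indicE mem_set// mule1.
rewrite integral_nneseries// [leRHS]eseries_mkcond.
apply: lee_nneseries => [n _ _|n _]; first exact: integral_ge0.
rewrite /u; case: (boolP (n \in I)) => nI; last by rewrite integral0.
have mFn : measurable (F n) by apply: mF; rewrite inE in nI.
rewrite [leLHS](eq_integral (((EFin \o g) \_ (F n)))); last first.
  by move=> x _; rewrite epatch_indic.
rewrite -integral_mkcondr; apply: ge0_subset_integral => //.
- exact: measurableI.
- by apply: measurable_funTS; exact/measurable_EFinP.
- by move=> x _; rewrite lee_fin.
Qed.

(** Without gaps, a Calderon-Zygmund ball F_n is contained, together with its
    star, in a ball of comparable measure over which the mean of [g] is below
    the level; so the integral of the large values of [g] is controlled by the
    measure of a level set of the maximal function. *)
Lemma reverse_weak_type (C1 : R) (Q : set T) (g : T -> R) (l : R) :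
  gap_bound BB C1 -> (0 <= C1)%R -> balls BB Q ->
  measurable_fun setT g -> (forall x, 0 <= g x)%R -> (forall x, g x != 0%R -> Q x) ->
  (0 < l)%R -> C0%:E * \int[mu]_(x in Q) (g x)%:E < (l * ballm mu Q)%:E ->
  exists U, [/\ measurable U, U `<=` star BB Q,
    forall x, U x -> l%:E <= maximal1 BB (EFin \o g) x &
    \int[mu]_(x in [set x | (2 * l < g x)%R]) (g x)%:E <= (C1 * l)%:E * mu U].
Proof.
move=> gapC C10 bQ mg g0 gQ l0 lQ; have mQ := ball_measurable bQ.
have Q0 := ballm_gt0 bQ.
have gE0 x : 0 <= (g x)%:E by rewrite lee_fin.
have mgE D : measurable_fun D (EFin \o g) by apply: measurable_funTS; exact/measurable_EFinP.
have iQ : \int[mu]_x (g x)%:E = \int[mu]_(x in Q) (g x)%:E.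
  rewrite [RHS]integral_mkcond; apply: eq_integral => x _; rewrite patchE.
  case: ifPn => // /negP xQ; have [->//|gx] := eqVneq (g x) 0%R.
  by exfalso; apply: xQ; rewrite inE; exact: gQ.
pose h x := (l^-1 * g x)%:E.
have h0 x : 0 <= h x by rewrite lee_fin mulr_ge0// invr_ge0 ltW.
have mh : measurable_fun setT h by apply/measurable_EFinP; exact: measurable_funM.
have ih D : measurable D -> \int[mu]_(x in D) h x = l^-1%:E * \int[mu]_(x in D) (g x)%:E.
  by move=> mD; rewrite -ge0_integralZl_EFin// ?invr_ge0 ltW.
have hQ : C0%:E * \int[mu]_x h x < mu Q.
  rewrite ih// iQ muleCA (ballmE bQ) -lte_pdivlMl ?invr_gt0// invrK.
  by rewrite -EFinM.
have hoo : \int[mu]_x h x < +oo.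
  rewrite ltNge leye_eq; apply/negP => /eqP e; move: hQ.
  by rewrite e gt0_muley ?lte_fin// ltNge leey.
have [F [I [FI tF Fcov Fstop _]]] := calderon_zygmund_balls BB mh h0 hoo.
have bF n : I n -> balls BB (F n) by case/FI.
have mF n : I n -> measurable (F n) by move=> /bF; exact: ball_measurable.
have starF n : I n -> mu (star BB (F n)) < mu Q.
  move=> In; apply: le_lt_trans hQ; apply: le_trans (le_mu_star (bF n In)) _.
  apply: lee_wpmul2l; first by rewrite lee_fin ltW.
  case: (FI n In) => _ /le_trans; apply.
  by apply: ge0_subset_integral => //; exact: mF.
have FQ n : I n -> F n `<=` star BB Q.
  move=> In; apply: sub_star => //; first exact: bF.
    apply: contrapT => FQ0; have := ball_gt0 (bF n In); rewrite ltNge => /negP; apply.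
    case: (FI n In) => _ /le_trans; apply; rewrite ih; last exact: mF.
    rewrite (_ : \int[mu]_(x in F n) (g x)%:E = 0) ?mule0// integral0_eq// => x Fx.
    have [->//|gx] := eqVneq (g x) 0%R.
    by exfalso; apply: FQ0; exists x; split => //; exact: gQ.
  apply: (@le_trans _ _ (mu Q)).
    apply: le_trans (ltW (starF n In)).
    have bn := bF n In; apply: le_measure; rewrite ?inE//; [exact: mF| |exact: sub_star_self].
    exact: ball_measurable (star_ball bn).
  by rewrite -[leLHS]mul1e; apply: lee_wpmul2r => //; rewrite lee_fin ler1n.
have intstar n : I n -> \int[mu]_(x in star BB (F n)) (g x)%:E <= (C1 * l)%:E * mu (F n).
  move=> In; have bn := bF n In; have bs := star_ball bn.
  have sT : star BB (F n) <> setT.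
    move=> e; have := starF n In; rewrite e ltNge => /negP; apply.
    by apply: le_measure; rewrite ?inE.
  have [P [bP FP nPF Ple]] := gapC _ bn sT.
  have mP := ball_measurable bP.
  have /ltW := Fstop n P In bP (subset_trans (sub_star_self bn) FP) nPF.
  rewrite ih// -lee_pdivlMl ?invr_gt0// invrK => leP.
  apply: (@le_trans _ _ (\int[mu]_(x in P) (g x)%:E)).
    by apply: ge0_subset_integral => //; exact: ball_measurable bs.
  apply: le_trans leP _; rewrite mulrC EFinM -muleA; apply: lee_wpmul2l.
    by rewrite lee_fin ltW.
  by rewrite (ballmE bP) (ballmE bn) -EFinM lee_fin.
exists (\bigcup_(n in I) F n); split.
- exact: bigcup_measurable.
- by move=> x [n In Fx]; exact: FQ Fx.
- move=> x [n In Fx]; have bn := bF n In.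
  apply: le_trans (maximal1_ge _ bn Fx) => //.
  rewrite (avgE _ bn) lee_pdivlMl ?(ballm_gt0 bn)//.
  have [_] := FI n In; rewrite ih; last exact: mF.
  by rewrite -lee_pdivrMl ?invr_gt0// invrK (ballmE bn) muleC.
set X := [set x | (2 * l < g x)%R]; set V := \bigcup_(n in I) star BB (F n).
have mX : measurable X by exact: measurable_superlevel.
have ms n : I n -> measurable (star BB (F n)).
  by move=> /bF /star_ball; exact: ball_measurable.
have mV : measurable V by exact: bigcup_measurable.
have XV0 : mu (X `\` V) = 0.
  apply/eqP; rewrite eq_le measure_ge0 andbT -Fcov; apply: le_measure; rewrite ?inE.
  - exact: measurableD.
  - apply: measurableD => //; rewrite -[X in measurable X]setTI.
    exact: emeasurable_fun_c_infty.
  - move=> x [Xx Vx]; split; last exact: Vx.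
    by rewrite /= /h lee_fin ler_pdivlMl// mulrC; exact: (ltW (Xx : (2 * l < g x)%R)).
apply: (@le_trans _ _ (\int[mu]_(x in V) (g x)%:E)).
  rewrite -[X in \int[mu]_(x in X) _](setUIDK X V) ge0_integral_setU//; last 3 first.
  - exact: measurableI.
  - exact: measurableD.
  - by apply/disj_set2P/seteqP; split => // x [[_ Vx] [_ nVx]].
  rewrite [Y in _ + Y](_ : _ = 0) ?adde0.
    by apply: ge0_subset_integral => //; exact: measurableI.
  by apply: null_set_integral => //; exact: measurableD.
apply: le_trans (integral_bigcup_le mg g0 ms) _.
rewrite measure_bigcup// -nneseriesZl//.
apply: lee_nneseries => [n _ _|n]; first exact: integral_ge0.
by rewrite inE; exact: intstar.
Qed.

Section Layers.
Local Open Scope ring_scope.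

(** The number of dyadic levels [2 a < ... < 2^J a] below [y]; up to a constant
    this is the logarithm of [y / a]. *)
Definition levels (a : R) (J : nat) (y : R) : R :=
  \sum_(q < J) (if 2 ^+ q.+1 * a < y then 1 else 0).

(** The maximum of [2^q a] over the [q < J] such that [U q] contains [x]: later
    sets carry larger values, so the last one decides. *)
Fixpoint steps (a : R) (U : nat -> set T) (J : nat) (x : T) : R :=
  if J is q.+1 then if x \in U q then 2 ^+ q * a else steps a U q x else 0.

Lemma levels_ge0 a J y : 0 <= levels a J y.
Proof. by apply: sumr_ge0 => q _; case: ifP. Qed.

Lemma levels_full a J y : 0 <= a -> 2 ^+ J * a < y -> levels a J y = J%:R.
Proof.
move=> a0 h; rewrite /levels (eq_bigr (fun=> 1)) ?sumr_const ?card_ord// => q _.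
rewrite ifT//; apply: le_lt_trans h; rewrite ler_wpM2r//.
by rewrite ler_weXn2l ?ler1n.
Qed.

Lemma levels_lt a J y : 0 <= a -> y <= 2 ^+ J.+1 * a ->
  exists2 L : nat, levels a J y = L%:R & y <= 2 ^+ L.+1 * a.
Proof.
move=> a0; elim: J => [|J IH] yJ.
  by exists 0%N => //; rewrite /levels big_ord0.
have [yJ'|yJ'] := leP y (2 ^+ J.+1 * a).
  have [L LE Ly] := IH yJ'; exists L => //.
  by rewrite /levels big_ord_recr/= -/(levels a J y) LE ltNge yJ' addr0.
by exists J.+1 => //; exact: levels_full.
Qed.

Lemma measurable_levels a J (g : T -> R) : measurable_fun setT g ->
  measurable_fun setT (fun x => levels a J (g x)).
Proof.
move=> mg; rewrite /levels.
apply: (@measurable_sum _ _ _ _ _ _ (fun q : 'I_J => fun x => if 2 ^+ q.+1 * a < g x then 1 else 0)).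
move=> q; apply: measurable_fun_ifT => //.
exact: measurable_fun_ltr.
Qed.

Lemma steps_ge0 a U J x : 0 <= a -> 0 <= steps a U J x.
Proof.
by move=> a0; elim: J => //= J IH; case: ifP => // _; rewrite mulr_ge0// exprn_ge0.
Qed.

Lemma measurable_steps a U J : (forall q, measurable (U q)) ->
  measurable_fun setT (steps a U J).
Proof.
move=> mU; elim: J => [|J IH]; first exact: measurable_cst.
rewrite /=; apply: measurable_fun_ifT => //.
apply: (measurable_fun_bool true).
rewrite setTI (_ : _ @^-1` _ = U J)//.
by apply/seteqP; split=> x /=; [exact: set_mem|exact: mem_set].
Qed.

Lemma steps_supp a U J x : steps a U J x != 0 -> exists q, U q x.
Proof.
elim: J => [|J IH] /=; first by rewrite eqxx.
by case: ifPn => // /set_mem Ux _; exists J.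
Qed.

Lemma steps_le a U J x (M : \bar R) : (0 <= M)%E ->
  (forall q, U q x -> ((2 ^+ q * a)%:E <= M)%E) -> ((steps a U J x)%:E <= M)%E.
Proof.
move=> M0 UM; elim: J => //= J IH.
by case: ifPn => // /set_mem; exact: UM.
Qed.

Lemma natX_step (n j : nat) :
  n.+1%:R ^+ j.+1 <= n%:R ^+ j.+1 + j.+1%:R * n.+1%:R ^+ j :> R.
Proof.
elim: j => [|j IH]; first by rewrite !expr1 expr0 mulr1 -natrD addn1.
have : n.+1%:R * n.+1%:R ^+ j.+1 <=
    n.+1%:R * (n%:R ^+ j.+1 + j.+1%:R * n.+1%:R ^+ j) :> R by rewrite ler_wpM2l.
have : n%:R ^+ j.+1 <= n.+1%:R ^+ j.+1 :> R by rewrite lerXn2r ?nnegrE ?ler_nat.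
have -> : n.+1%:R * (n%:R ^+ j.+1 + j.+1%:R * n.+1%:R ^+ j) =
    n%:R * n%:R ^+ j.+1 + n%:R ^+ j.+1 + j.+1%:R * n.+1%:R ^+ j.+1 :> R.
  by rewrite [n.+1%:R ^+ j.+1]exprS -(natr1 n); move: (n%:R ^+ j.+1) ((_ + 1) ^+ j) => p q; ring.
rewrite -!exprS -(natr1 j.+1) => h1 h2; apply: le_trans h2 _.
by move: h1; move: (_ ^+ j.+1) (_ ^+ j.+1) (_ ^+ j.+2) (j.+1%:R) => p q s w h1; lra.
Qed.

(** Summation by parts: a power j+1 of the number of levels is a sum of powers
    j over the levels. *)
Lemma levels_expr_le a J y j : 0 <= a ->
  levels a J y ^+ j.+1 <=
  \sum_(q < J) (if 2 ^+ q.+1 * a < y then j.+1%:R * q.+1%:R ^+ j else 0).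
Proof.
move=> a0; elim: J => [|J IH]; first by rewrite /levels !big_ord0 expr0n.
rewrite big_ord_recr/=; case: ifPn => h; last first.
  by rewrite /levels big_ord_recr/= (negbTE h) !addr0.
rewrite (levels_full a0 h); apply: le_trans (natX_step J j) _.
rewrite lerD2r; apply: le_trans IH; rewrite levels_full//.
by apply: le_lt_trans h; rewrite ler_wpM2r// ler_weXn2l ?ler1n.
Qed.

(** The levels are geometric, so a sum over them is controlled by its last
    term. *)
Lemma steps_levels a (U : nat -> set T) J x j : 0 < a ->
  \sum_(q < J) (q.+1%:R ^+ j * (2 ^+ q * a) * \1_(U q) x) <=
  2 * steps a U J x * levels (a / 4) J (steps a U J x) ^+ j.
Proof.
move=> a0; elim: J => [|J IH]; first by rewrite big_ord0 /= mulr0 mul0r.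
rewrite big_ord_recr/= indicE; case: ifPn => _ /=; last first.
  rewrite mulr0 addr0; apply: le_trans IH _.
  apply: ler_wpM2l; first by rewrite mulr_ge0// steps_ge0// ltW.
  rewrite lerXn2r ?nnegrE ?levels_ge0// /levels big_ord_recr/= lerDl.
  by case: ifP.
rewrite levels_full ?mulr1; last 2 first.
- by rewrite divr_ge0// ltW.
- by rewrite exprS; have : 0 < 2 ^+ J * a by [rewrite mulr_gt0// exprn_gt0]; move: (2 ^+ J) => z; lra.
have part K : (K <= J)%N ->
    \sum_(q < K) q.+1%:R ^+ j * (2 ^+ q * a) * \1_(U q) x <= J.+1%:R ^+ j * (2 ^+ K * a).
  elim: K => [|K IHK] KJ; first by rewrite big_ord0 mulr_ge0 ?exprn_ge0// mulr_ge0 ?exprn_ge0// ltW.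
  rewrite big_ord_recr/=.
  have -> : J.+1%:R ^+ j * (2 ^+ K.+1 * a) = J.+1%:R ^+ j * (2 ^+ K * a) + J.+1%:R ^+ j * (2 ^+ K * a).
    by rewrite exprS; move: (2 ^+ K) (_ ^+ j) => z w; ring.
  apply: lerD; first exact: IHK (ltnW KJ).
  have K0 : 0 <= 2 ^+ K * a by rewrite mulr_ge0 ?exprn_ge0// ltW.
  apply: (@le_trans _ _ (K.+1%:R ^+ j * (2 ^+ K * a))).
    by apply: ler_piMr; [rewrite mulr_ge0// exprn_ge0|rewrite indicE; case: (_ \in _)].
  by rewrite ler_wpM2r// lerXn2r ?nnegrE ?ler_nat// ltnW.
apply: le_trans (lerD (part J (leqnn _)) (lexx _)) _.
rewrite le_eqVlt; apply/orP; left; apply/eqP.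
by move: (2 ^+ J) (_ ^+ j) => z w; ring.
Qed.

End Layers.

(** One iteration: the levels of [g] over [a] are those of a step function
    below its maximal function, up to one logarithmic factor. *)
Lemma layer_step (C1 : R) (Q : set T) (g : T -> R) (a : R) (J j : nat) :
  gap_bound BB C1 -> (0 <= C1)%R -> balls BB Q ->
  measurable_fun setT g -> (forall x, 0 <= g x)%R -> (forall x, g x != 0%R -> Q x) ->
  (0 < a)%R -> C0%:E * \int[mu]_(x in Q) (g x)%:E < (a * ballm mu Q)%:E ->
  exists g' : T -> R, [/\ measurable_fun setT g', forall x, (0 <= g' x)%R,
    forall x, g' x != 0%R -> star BB Q x,
    forall x, (g' x)%:E <= maximal1 BB (EFin \o g) x &
    \int[mu]_(x in Q) (g x * levels a J (g x) ^+ j.+1)%:E <=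
    (C1 * j.+1%:R * 2)%:E *
      \int[mu]_(x in star BB Q) (g' x * levels (a / 4) J (g' x) ^+ j)%:E].
Proof.
move=> gapC C10 bQ mg g0 gQ a0 aQ; have mQ := ball_measurable bQ.
have mS := ball_measurable (star_ball bQ).
have exU q : exists U, [/\ measurable U, U `<=` star BB Q,
    forall x, U x -> (2 ^+ q * a)%:E <= maximal1 BB (EFin \o g) x &
    \int[mu]_(x in [set x | (2 ^+ q.+1 * a < g x)%R]) (g x)%:E <= (C1 * (2 ^+ q * a))%:E * mu U].
  have l0 : (0 < 2 ^+ q * a)%R by rewrite mulr_gt0// exprn_gt0.
  rewrite exprS -mulrA; apply: (reverse_weak_type gapC C10 bQ mg g0 gQ l0).
  apply: lt_le_trans aQ _; rewrite lee_fin ler_wpM2r ?(ltW (ballm_gt0 bQ))//.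
  by rewrite ler_peMl ?(ltW a0)// exprn_ege1// ler1n.
have [U UP] := choice exU.
have mU q : measurable (U q) by case: (UP q).
exists (steps a U J); split.
- exact: measurable_steps.
- by move=> x; rewrite steps_ge0// ltW.
- by move=> x /steps_supp[q]; case: (UP q) => _ + _ _; apply.
- move=> x; apply: steps_le; first exact: maximal1_ge0.
  by move=> q; case: (UP q) => _ _ + _; apply.
pose c q : R := (j.+1%:R * q.+1%:R ^+ j)%R.
have c0 q : (0 <= c q)%R by rewrite mulr_ge0// exprn_ge0.
pose X q := [set x | (2 ^+ q.+1 * a < g x)%R].
have mX q : measurable (X q) by exact: measurable_superlevel.
apply: (@le_trans _ _ (\int[mu]_(x in Q) \sum_(q < J) (c q * (g x * \1_(X q) x))%:E)).
  apply: le_lower_integral => x _; first by rewrite lee_fin mulr_ge0// exprn_ge0// levels_ge0.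
  rewrite sumEFin lee_fin; apply: le_trans (ler_wpM2l (g0 x) (levels_expr_le J (g x) j (ltW a0))) _.
  rewrite mulr_sumr; apply: ler_sum => q _; rewrite indicE.
  have -> : (x \in X q) = (2 ^+ q.+1 * a < g x)%R by apply/idP/idP; rewrite inE.
  by case: ifP => _; rewrite ?mulr0// mulr1 mulrC.
rewrite ge0_integral_sum//; last 2 first.
- move=> q; apply: measurable_funTS; apply/measurable_EFinP; apply: measurable_funM => //.
  by apply: measurable_funM => //; exact: measurable_indic.
- by move=> q x _; rewrite lee_fin !mulr_ge0.
apply: (@le_trans _ _ (\sum_(q < J) \int[mu]_(x in star BB Q)
    (C1 * j.+1%:R * (q.+1%:R ^+ j * (2 ^+ q * a) * \1_(U q) x))%:E)).
  apply: lee_sum => q _; have [_ US _ Uint] := UP q.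
  under eq_integral do rewrite EFinM.
  rewrite ge0_integralZl_EFin//; last 2 first.
  - by move=> x _; rewrite lee_fin mulr_ge0.
  - by apply: measurable_funTS; apply/measurable_EFinP; apply: measurable_funM.
  have -> : \int[mu]_(x in Q) (g x * \1_(X q) x)%:E = \int[mu]_(x in Q `&` X q) (g x)%:E.
    rewrite integral_mkcondr; apply: eq_integral => x _.
    by rewrite epatch_indic EFinM.
  apply: (@le_trans _ _ ((c q)%:E * ((C1 * (2 ^+ q * a))%:E * mu (U q)))).
    apply: lee_wpmul2l; first by rewrite lee_fin.
    apply: le_trans Uint; apply: ge0_subset_integral => //.
    - exact: measurableI.
    - exact: mX.
    - by apply: measurable_funTS; exact/measurable_EFinP.
    - by move=> x _; rewrite lee_fin.
  under eq_integral do rewrite !mulrA.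
  rewrite integral_indicZ//; last first.
    by rewrite !mulr_ge0 ?exprn_ge0// ltW.
  rewrite setIidl// muleA -EFinM /c.
  rewrite le_eqVlt; apply/orP; left; apply/eqP; congr ((_)%:E * _).
  by move: (_ ^+ j)%R (2 ^+ q)%R => z w; ring.
rewrite -ge0_integral_sum//; last 2 first.
- move=> q; apply: measurable_funTS; apply/measurable_EFinP; apply: measurable_funM => //.
  by apply: measurable_funM => //; exact: measurable_indic.
- by move=> q x _; rewrite lee_fin !mulr_ge0 ?exprn_ge0// ltW.
have ms := measurable_steps a J mU.
rewrite -ge0_integralZl_EFin//; last 3 first.
- by move=> x _; rewrite lee_fin mulr_ge0 ?exprn_ge0 ?levels_ge0// steps_ge0// ltW.
- apply: measurable_funTS; apply/measurable_EFinP; apply: measurable_funM => //.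
  by apply: measurable_funX; exact: measurable_levels.
- by rewrite !mulr_ge0.
apply: le_lower_integral => x _.
  by rewrite sumEFin lee_fin; apply: sumr_ge0 => q _; rewrite !mulr_ge0 ?exprn_ge0// ltW.
rewrite sumEFin -EFinM lee_fin -mulr_sumr -[leRHS]mulrA ler_wpM2l ?mulr_ge0//.
by rewrite mulrA; exact: steps_levels.
Qed.

End LlogL.

(** * The L log L estimate *)

Section Iteration.
Set Implicit Arguments.
Unset Strict Implicit.
Context {d : measure_display} {T : measurableType d} {R : realType}.
Context {mu : {measure set T -> \bar R}} (BB : ball_basis mu).
Local Notation C0 := (star_cst BB).
Local Notation stars k Q := (iter k (star BB) Q).
Local Notation Max k f := (iter k (maximal1 BB) f).
Let C00 : 0 < C0. Proof. exact: star_cst_gt0. Qed.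
Let C01 : 1 <= C0. Proof. exact: star_cst_ge1. Qed.

Lemma iter_star_ball k Q : balls BB Q -> balls BB (stars k Q).
Proof. by move=> bQ; elim: k => //= k IH; exact: star_ball. Qed.

Lemma sub_iter_star k Q : balls BB Q -> Q `<=` stars k Q.
Proof.
move=> bQ; elim: k => //= k IH; apply: subset_trans IH _.
by apply: sub_star_self; exact: iter_star_ball.
Qed.

Lemma ballm_iter_star k Q : balls BB Q -> ballm mu (stars k Q) <= C0 ^+ k * ballm mu Q.
Proof.
move=> bQ; elim: k => [|k IH]; first by rewrite mul1r.
apply: le_trans (ballm_star (iter_star_ball k bQ)) _.
by rewrite exprS -mulrA ler_wpM2l// ltW.
Qed.

Local Open Scope ereal_scope.

Lemma le_maximal1 (f g : T -> \bar R) x : (forall y, 0 <= f y) ->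
  (forall y, f y <= g y) -> maximal1 BB f x <= maximal1 BB g x.
Proof.
move=> f0 fg; apply: maximal1_le => //; first exact: maximal1_ge0.
move=> B bB Bx; apply: (@le_trans _ _ (avg (mu:=mu) B g)); first exact: (le_avg bB).
by apply: maximal1_ge => // y; exact: le_trans (fg y).
Qed.

Lemma iter_maximal_ge0 k (f : T -> \bar R) x : (forall y, 0 <= f y) -> 0 <= Max k f x.
Proof. by move=> f0; case: k => //= k; exact: maximal1_ge0. Qed.

Lemma le_iter_maximal k (f g : T -> \bar R) x : (forall y, 0 <= f y) ->
  (forall y, f y <= g y) -> Max k f x <= Max k g x.
Proof.
move=> f0 fg; elim: k x => [|k IH] x; first exact: fg.
rewrite 2!iterS; apply: le_maximal1; last exact: IH.
by move=> y; exact: iter_maximal_ge0.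
Qed.

Lemma avg_cst (B : set T) (c : \bar R) : balls BB B -> avg (mu:=mu) B (fun=> c) = c.
Proof.
move=> bB; have B0 := ballm_gt0 bB; rewrite (avgE _ bB).
rewrite (integral_cst mu (ball_measurable bB) c) (ballmE bB) muleCA -EFinM.
by rewrite mulVf ?mule1// gt_eqF.
Qed.

Lemma avg_star_le (B : set T) (f : T -> \bar R) : balls BB B -> (forall x, 0 <= f x) ->
  avg (mu:=mu) B f <= C0%:E * avg (mu:=mu) (star BB B) (maximal1 BB f).
Proof.
move=> bB f0; have bs := star_ball bB; have B0 := ballm_gt0 bB; have s0 := ballm_gt0 bs.
apply: (@le_trans _ _ (C0%:E * avg (mu:=mu) (star BB B) f)); last first.
  apply: lee_wpmul2l; first by rewrite lee_fin ltW.
  rewrite -[leLHS](avg_cst _ bs); apply: (le_avg bs) => x sx.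
    by apply: avg_ge0.
  exact: maximal1_ge.
have sub : \int[mu]_(x in B) f x <= \int[mu]_(x in star BB B) f x.
  rewrite integral_mkcond [leRHS]integral_mkcond; apply: le_lower_integral => x _.
    by rewrite patchE; case: ifP.
  rewrite !patchE; case: ifPn => [|_]; last by case: ifP.
  by rewrite inE => /(sub_star_self bB) sx; rewrite mem_set.
rewrite (avgE _ bB) (avgE _ bs) muleA -EFinM; apply: lee_pmul => //.
- by rewrite lee_fin invr_ge0 ltW.
- exact: integral_ge0.
- rewrite lee_fin ler_pdivlMr// mulrC ler_pdivrMr//.
  exact: (ballm_star bB).
Qed.

Lemma avg_iter_le k (B : set T) (f : T -> \bar R) : balls BB B -> (forall x, 0 <= f x) ->
  avg (mu:=mu) B f <= (C0 ^+ k)%:E * avg (mu:=mu) (stars k B) (Max k f).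
Proof.
move=> bB f0; elim: k => [|k IH]; first by rewrite mul1e.
apply: le_trans IH _; rewrite exprSr EFinM -muleA; apply: lee_wpmul2l.
  by rewrite lee_fin exprn_ge0// ltW.
apply: avg_star_le; first exact: iter_star_ball.
by move=> x; exact: iter_maximal_ge0.
Qed.

(** A power [j] of the logarithm of [g] costs [j] maximal functions. *)
Lemma LlogL_maximal (C1 : R) (j : nat) : gap_bound BB C1 -> (0 <= C1)%R ->
  exists2 K : R, (0 <= K)%R & forall (Q : set T) (g : T -> R) (a e : R) (J : nat),
    balls BB Q -> measurable_fun setT g -> (forall x, 0 <= g x)%R ->
    (forall x, g x != 0%R -> Q x) -> (0 < a)%R -> (0 <= e)%R ->
    avg (mu:=mu) (stars j Q) (Max j (EFin \o g)) <= e%:E ->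
    (4 ^+ j * C0 ^+ j.+1 * e < a)%R ->
    \int[mu]_(x in Q) (g x * levels a J (g x) ^+ j)%:E <=
      K%:E * \int[mu]_(x in stars j Q) Max j (EFin \o g) x.
Proof.
move=> gapC C10; elim: j => [|j [K K0 IH]].
  exists 1%R => // Q g a e J bQ mg g0 gQ a0 e0 eE ea.
  rewrite mul1e; apply: le_lower_integral => x _ /=; by rewrite lee_fin expr0 mulr1.
(* the levels of the step function are counted from [a / 4], whence the powers
   of 4 in the condition on [a] *)
exists (C1 * j.+1%:R * 2 * K)%R => [|Q g a e J bQ mg g0 gQ a0 e0 eE ea]; first by rewrite !mulr_ge0.
have gE0 x : 0 <= (EFin \o g) x by rewrite /= lee_fin.
have aQ : C0%:E * \int[mu]_(x in Q) (g x)%:E < (a * ballm mu Q)%:E.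
  have Q0 := ballm_gt0 bQ.
  have := avg_iter_le j.+1 bQ gE0; rewrite (avgE _ bQ) lee_pdivrMl// => h.
  apply: (@le_lt_trans _ _ (C0%:E * ((ballm mu Q)%:E * ((C0 ^+ j.+1)%:E * e%:E)))).
    apply: lee_wpmul2l; first by rewrite lee_fin ltW.
    apply: le_trans h _; apply: lee_wpmul2l; first by rewrite lee_fin ltW.
    by apply: lee_wpmul2l => //; rewrite lee_fin exprn_ge0// ltW.
  rewrite -!EFinM lte_fin mulrCA mulrC ltr_pM2r//; apply: le_lt_trans ea.
  rewrite mulrA -exprS ler_wpM2r// -[leLHS]mul1r ler_wpM2r ?exprn_ge0 ?(ltW C00)//.
  by rewrite exprn_ege1// ler1n.
have [g' [mg' g'0 g'Q g'M leg']] := layer_step J j gapC C10 bQ mg g0 gQ a0 aQ.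
apply: le_trans leg' _; rewrite [(_ * K)%:E]EFinM -muleA; apply: lee_wpmul2l.
  by rewrite lee_fin !mulr_ge0.
have a40 : (0 < a / 4)%R by rewrite divr_gt0.
have leM x : Max j (EFin \o g') x <= Max j.+1 (EFin \o g) x.
  by rewrite iterSr; apply: le_iter_maximal => // y; rewrite /= lee_fin.
have e1 : avg (mu:=mu) (stars j (star BB Q)) (Max j (EFin \o g')) <= e%:E.
  apply: le_trans eE; rewrite -iterSr; apply: (le_avg (iter_star_ball j.+1 bQ)) => x _ //.
  by apply: iter_maximal_ge0 => y; rewrite /= lee_fin.
have ea' : (4 ^+ j * C0 ^+ j.+1 * e < a / 4)%R.
  rewrite ltr_pdivlMr//; apply: le_lt_trans ea.
  rewrite mulrAC ler_wpM2r// mulrAC -exprSr ler_wpM2l ?exprn_ge0//.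
  by rewrite ler_weXn2l.
apply: le_trans (IH _ _ _ _ J (star_ball bQ) mg' g'0 g'Q a40 e0 e1 ea') _.
apply: lee_wpmul2l; first by rewrite lee_fin.
rewrite -iterSr; apply: le_lower_integral => x _ //.
by apply: iter_maximal_ge0 => y; rewrite /= lee_fin.
Qed.

Local Open Scope ring_scope.

(** Young's inequality between the exponential and [L log L]: either [b] is
    smaller than twice the logarithm of [s / a], or the exponential of [b / 2]
    dominates [s / a]. *)
Lemma powR_levels_le (r b s a : R) (J k : nat) : 1 <= r -> r <= k%:R -> 0 <= b -> 0 < a ->
  0 <= s -> s <= 2 ^+ J.+1 * a ->
  b `^ r * s <= (2 `^ r * 2 + 4 `^ r + (2 * r) `^ r) * (a * expR b + s * levels a J s ^+ k).
Proof.
move=> r1 rk b0 a0 s0 sJ; have r0 : 0 < r by exact: lt_le_trans r1.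
have [L LE sL] := levels_lt (ltW a0) sJ; rewrite LE.
have k0 : (0 < k)%N by rewrite -(ltr_nat R); exact: lt_le_trans rk.
have aE : 0 <= a * expR b by rewrite mulr_ge0 ?expR_ge0// ltW.
have sL0 : 0 <= s * L%:R ^+ k by rewrite mulr_ge0// exprn_ge0.
set A := 2 `^ r * 2; set B := 4 `^ r; set C := (2 * r) `^ r.
have A0 : 0 <= A by rewrite mulr_ge0// powR_ge0.
have B0 : 0 <= B by exact: powR_ge0.
have C0' : 0 <= C by exact: powR_ge0.
set z := a * expR b in aE *; set w := s * _ in sL0 *.
suff : b `^ r * s <= A * z \/ b `^ r * s <= B * w \/ b `^ r * s <= C * z.
  have h1 : 0 <= A * z by exact: mulr_ge0. have h2 : 0 <= A * w by exact: mulr_ge0.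
  have h3 : 0 <= B * z by exact: mulr_ge0. have h4 : 0 <= B * w by exact: mulr_ge0.
  have h5 : 0 <= C * z by exact: mulr_ge0. have h6 : 0 <= C * w by exact: mulr_ge0.
  have -> : (A + B + C) * (z + w) = A * z + A * w + B * z + B * w + C * z + C * w by ring.
  by move: (b `^ r * s) (A * z) (A * w) (B * z) (B * w) (C * z) (C * w) h1 h2 h3 h4 h5 h6 =>
    u v1 v2 v3 v4 v5 v6 h1 h2 h3 h4 h5 h6 [|[]]; lra.
have [bL|Lb] := leP b (2 * L.+1%:R).
  have [L0|L0] := posnP L.
    left; rewrite /A /z -mulrA; rewrite L0 in sL bL.
    apply: ler_pM => //; first exact: powR_ge0.
      by apply: ge0_ler_powR; rewrite ?nnegrE ?(ltW r0)//; rewrite mulr1 in bL.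
    apply: le_trans sL _; rewrite expr1 ler_wpM2l// -[leLHS]mulr1 ler_wpM2l ?(ltW a0)//.
    by rewrite -expR0 ler_expR.
  right; left; rewrite /B /w [leRHS]mulrCA [leLHS]mulrC ler_wpM2l//.
  apply: (@le_trans _ _ ((4 * L%:R) `^ r)).
    apply: ge0_ler_powR; rewrite ?nnegrE ?(ltW r0) ?mulr_ge0//.
    apply: le_trans bL _; rewrite -(natr1 L).
    have : (1 : R) <= L%:R by rewrite ler1n.
    by move: (L%:R) => y; lra.
  rewrite powRM// ler_wpM2l ?powR_ge0// -powR_mulrn//.
  by apply: ler_powR; rewrite ?ler1n.
right; right; rewrite /C /z.
have e2 : 2 ^+ L.+1 <= expR (b / 2).
  apply: (@le_trans _ _ (expR L.+1%:R)).
    rewrite -[L.+1%:R]mulr1 expRM_natl lerXn2r ?nnegrE ?expR_ge0//.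
    by have := expR_ge1Dx (1 : R); lra.
  by rewrite ler_expR; lra.
have e1 : b `^ r <= (2 * r) `^ r * expR (b / 2).
  have -> : expR (b / 2) = expR (b / (2 * r)) `^ r.
    by rewrite -expRM; congr expR; field; rewrite gt_eqF.
  rewrite -powRM ?expR_ge0 ?mulr_ge0 ?(ltW r0)//; apply: ge0_ler_powR; rewrite ?nnegrE ?(ltW r0)//.
    by rewrite mulr_ge0 ?expR_ge0// mulr_ge0// ltW.
  rewrite mulrC -ler_pdivrMr ?mulr_gt0//.
  by have := expR_ge1Dx (b / (2 * r)); lra.
apply: (@le_trans _ _ ((2 * r) `^ r * expR (b / 2) * (expR (b / 2) * a))).
  apply: ler_pM => //; first exact: powR_ge0.
  by apply: le_trans sL _; rewrite ler_wpM2r// ltW.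
have -> : expR b = expR (b / 2) * expR (b / 2).
  by rewrite -expRD; congr expR; field.
by rewrite le_eqVlt; apply/orP; left; apply/eqP; ring.
Qed.

End Iteration.

(** * Amplitudes are bounded by iterated maximal functions *)

Section MaximalBound.
Set Implicit Arguments.
Unset Strict Implicit.
Context {d : measure_display} {T : measurableType d} {R : realType}.
Context {mu : {measure set T -> \bar R}} (BB : ball_basis mu).
Local Notation C0 := (star_cst BB).
Local Notation stars k Q := (iter k (star BB) Q).
Local Notation Max k f := (iter k (maximal1 BB) f).
Variables (r : R).
Hypothesis hr : 1 <= r.
Let r0 : 0 < r. Proof. exact: lt_le_trans hr. Qed.
Let C00 : 0 < C0. Proof. exact: star_cst_gt0. Qed.
Let C01 : 1 <= C0. Proof. exact: star_cst_ge1. Qed.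

(** The inequality of [powR_levels_le] is integrated with the scale [a] just
    above the mean of the k-th iterate of the maximal function. *)
Lemma osc_powR_maximal (k : nat) (C1 : R) : r <= k%:R -> gap_bound BB C1 -> 0 <= C1 ->
  exists2 C2 : R, 0 < C2 & forall (f b : T -> R) (M n e : R) (Q : set T),
    osc_le BB b n -> balls BB Q -> measurable_fun setT f -> (forall x, `|f x| <= M) ->
    0 <= e ->
    (avg (mu:=mu) (stars k Q) (Max k (fun y => (`|f y| `^ r)%:E)) <= e%:E)%E ->
    (\int[mu]_(x in Q) ((`|b x - mean mu Q b| / n) `^ r * `|f x| `^ r)%:E
      <= (C2 * e * ballm mu Q)%:E)%E.
Proof.
move=> rk gapC C10.
have [Kk Kk0 HK] := LlogL_maximal k gapC C10.
pose K : R := 2 `^ r * 2 + 4 `^ r + (2 * r) `^ r.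
have K0 : 0 < K by rewrite /K ltr_pwDr ?powR_gt0 ?mulr_gt0// addr_ge0 ?mulr_ge0 ?powR_ge0.
pose c : R := 4 ^+ k * C0 ^+ k.+1.
have c0 : 0 < c by rewrite mulr_gt0 ?exprn_gt0.
exists (K * (2 * c + Kk * C0 ^+ k)).
  apply: mulr_gt0 => //; apply: ltr_pwDl; first exact: mulr_gt0.
  by rewrite mulr_ge0// exprn_ge0// ltW.
move=> f b M n e Q bn bQ mf fM e0 avge.
have [n0 mb _ _] := bn.
have Q0 := ballm_gt0 bQ; have mQ := ball_measurable bQ.
pose beta x := `|b x - mean mu Q b| / n.
have beta0 x : 0 <= beta x by rewrite divr_ge0// ltW.
pose s x := `|f x| `^ r * \1_Q x.
have s0 x : 0 <= s x by rewrite mulr_ge0// powR_ge0.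
have ms : measurable_fun setT s.
  apply: measurable_funM; last exact: measurable_indic.
  by apply/measurable_EFinP; exact: measurable_normr_powR.
have sQ x : s x != 0 -> Q x.
  rewrite /s indicE; case: (boolP (x \in Q)) => [/set_mem//|_].
  by rewrite mulr0 eqxx.
have sf x : s x <= `|f x| `^ r.
  by rewrite /s ler_piMr ?powR_ge0// indicE; case: (_ \in _).
apply/lee_addgt0Pr => e' e'0.
pose eps := e' / (2 * K * ballm mu Q).
have eps0 : 0 < eps by rewrite divr_gt0// !mulr_gt0.
pose a := c * e + eps.
have a0 : 0 < a by apply: ltr_wpDl => //; rewrite mulr_ge0// ltW.
have M0 : 0 <= `|M| by [].
have sM x : s x <= `|M| `^ r.
  apply: le_trans (sf x) _; apply: ge0_ler_powR; rewrite ?nnegrE ?(ltW r0)//.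
  by apply: le_trans (fM x) _; exact: ler_norm.
pose J := (Num.trunc (`|M| `^ r / a)).
have sJ x : s x <= 2 ^+ J.+1 * a.
  apply: le_trans (sM x) _; rewrite -ler_pdivrMr//.
  apply: le_trans (ltW (truncnS_gt _)) _.
  by rewrite -natrX ler_nat; exact: ltnW (ltn_expl _ _).
have avgs : (avg (mu:=mu) (stars k Q) (Max k (EFin \o s)) <= e%:E)%E.
  apply: le_trans avge; apply: (le_avg (iter_star_ball k bQ)) => x _.
    by apply: iter_maximal_ge0 => y /=; rewrite lee_fin.
  by apply: le_iter_maximal => y /=; rewrite lee_fin.
have ca : 4 ^+ k * C0 ^+ k.+1 * e < a by rewrite /a -/c ltrDl.
have LL := HK Q s a e J bQ ms s0 sQ a0 e0 avgs ca.
have mE : measurable_fun setT (fun x => expR (beta x)) by exact: measurable_expR_osc.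
have mL : measurable_fun setT (fun x => s x * levels a J (s x) ^+ k).
  apply: measurable_funM => //; apply: measurable_funX; exact: measurable_levels.
have L0 x : 0 <= s x * levels a J (s x) ^+ k.
  by rewrite mulr_ge0// exprn_ge0// levels_ge0.
have aE0 x : 0 <= a * expR (beta x) by rewrite mulr_ge0 ?expR_ge0// ltW.
apply: (@le_trans _ _ (\int[mu]_(x in Q)
   (K%:E * ((a * expR (beta x))%:E + (s x * levels a J (s x) ^+ k)%:E)))%E).
  apply: le_lower_integral => x Qx.
    by rewrite lee_fin mulr_ge0// powR_ge0.
  have := powR_levels_le hr rk (beta0 x) a0 (s0 x) (sJ x).
  rewrite -EFinD -EFinM lee_fin; apply: le_trans.
  by rewrite /s indicE mem_set// mulr1.
rewrite ge0_integralZl_EFin ?(ltW K0)//; last 2 first.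
- by move=> x _; rewrite -EFinD lee_fin addr_ge0.
- apply: measurable_funTS; apply: emeasurable_funD; last exact/measurable_EFinP.
  by apply/measurable_EFinP; exact: measurable_funM.
rewrite ge0_integralD//; last first.
- by apply: measurable_funTS; exact/measurable_EFinP.
- by move=> x _; rewrite lee_fin.
- by apply: measurable_funTS; apply/measurable_EFinP; exact: measurable_funM.
- by move=> x _; rewrite lee_fin.
have h1 : (\int[mu]_(x in Q) (a * expR (beta x))%:E <= (a * 2 * ballm mu Q)%:E)%E.
  under eq_integral do rewrite EFinM.
  rewrite ge0_integralZl_EFin ?(ltW a0)//; last first.
    by apply: measurable_funTS; exact/measurable_EFinP.
  rewrite -mulrA EFinM; apply: lee_wpmul2l; first by rewrite lee_fin ltW.
  by rewrite EFinM -(ballmE bQ); exact: (osc_exp bn).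
have h2 : (\int[mu]_(x in Q) (s x * levels a J (s x) ^+ k)%:E <=
    (Kk * (C0 ^+ k * ballm mu Q * e))%:E)%E.
  apply: le_trans LL _; rewrite EFinM; apply: lee_wpmul2l; first by rewrite lee_fin.
  have bk := iter_star_ball k bQ; have k0 := ballm_gt0 bk.
  rewrite (avgE _ bk) lee_pdivrMl// in avgs; apply: le_trans avgs _.
  by rewrite -EFinM lee_fin ler_wpM2r// (ballm_iter_star k bQ).
apply: le_trans (lee_wpmul2l _ (leeD h1 h2)) _; first by rewrite lee_fin ltW.
rewrite -!EFinD -EFinM lee_fin.
have -> : e' = K * (2 * eps * ballm mu Q).
  by rewrite /eps; field; rewrite !gt_eqF.
rewrite le_eqVlt; apply/orP; left; apply/eqP; rewrite /a.
by move: (C0 ^+ k) => z; ring.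
Qed.

Lemma avgr_fstar (B : set T) (f : T -> R) :
  avgr (mu:=mu) r B (fstar BB r f) =
  (avg (mu:=mu) B (Max `|Num.ceil r|%N (fun y => (`|f y| `^ r)%:E)) `^ r^-1)%E.
Proof.
rewrite /avgr; congr (poweR (avg _ _) _); apply/funext => x.
have F0 : (0 <= Max `|Num.ceil r|%N (fun y => (`|f y| `^ r)%:E) x)%E.
  by apply: iter_maximal_ge0 => y; rewrite lee_fin powR_ge0.
rewrite /fstar gee0_abs ?poweR_ge0// -poweRrM mulVf ?gt_eqF//.
by rewrite poweRe1.
Qed.

Lemma le_powR_inv (x y : R) : 0 <= x -> x `^ r <= y -> x <= y `^ r^-1.
Proof.
move=> x0 xy; have y0 : 0 <= y by exact: le_trans (powR_ge0 _ _) xy.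
have := @ge0_ler_powR R r^-1 _ _ _ _ _ xy; rewrite !nnegrE invr_ge0 (ltW r0) powR_ge0 y0.
by rewrite -powRrM mulfV ?gt_eqF// powRr1//; apply.
Qed.

Section Amplitude.
Variable m : nat.

(** The normalized oscillation of a multiplier is exponentially integrable, so
    weighting [|f_i|^r] with its power [r] costs [r] logarithms, that is [r]
    iterations of the maximal function. *)
Lemma amplitude_le_fstar (C1 : R) : gap_bound BB C1 ->
  exists2 C3 : R, 0 < C3 & forall (tau : {set 'I_m}) (b f : 'I_m -> T -> R)
    (n M : 'I_m -> R) (B0 P : set T) (i : 'I_m),
    (forall i, i \in tau -> osc_le BB (b i) (n i)) -> balls BB B0 ->
    (forall i, measurable_fun setT (f i)) -> (forall i x, `|f i x| <= M i) ->
    (forall i x, f i x != 0 -> B0 x) -> balls BB P ->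
    ((amplitude (mu:=mu) r tau b n f P i)%:E <=
     C3%:E * avgr (mu:=mu) r (stars `|Num.ceil r|%N P) (fstar BB r (f i)))%E.
Proof.
move=> gapC; pose k := `|Num.ceil r|%N.
have rk : r <= k%:R.
  rewrite /k natr_absz ger0_norm; first exact: ceil_ge.
  by rewrite ceil_ge0 (lt_trans _ r0)// ltrN10.
have gapC' : gap_bound BB `|C1|.
  move=> G bG GT; have [P [bP GP nP le]] := gapC G bG GT; exists P; split => //.
  by apply: le_trans le _; rewrite ler_wpM2r ?ler_norm// ltW// (ballm_gt0 bG).
have [C2 C20 HC2] := osc_powR_maximal rk gapC' (normr_ge0 C1).
pose A := (C0 ^+ k) `^ r^-1; pose B := C2 `^ r^-1.
have A0 : 0 < A by rewrite powR_gt0// exprn_gt0.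
have B0' : 0 < B by rewrite powR_gt0.
exists (A + (A + B)); first by rewrite !addr_gt0.
move=> tau b f n M B0 P i bn bB0 mf fM fB0 bP.
have P0 := ballm_gt0 bP; have mP := ball_measurable bP.
have fL : f i \in Lfun mu r%:E.
  exact: (dominated_Lr hr bB0 fM fB0 i (dominated_self mf)).
rewrite avgr_fstar -/k.
set E := avg _ _.
have fE0 y : (0 <= (`|f i y| `^ r)%:E)%E by rewrite lee_fin powR_ge0.
have E0 : (0 <= E)%E by apply: avg_ge0 => x _; exact: iter_maximal_ge0.
have [Efin|] := boolP (E \is a fin_num); last first.
  rewrite fin_numE gt_eqF ?(lt_le_trans _ E0)// negbK => /eqP ->.
  by rewrite poweRyr ?invr_eq0 ?gt_eqF// gt0_muley ?leey// lte_fin !addr_gt0.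
pose e := fine E; have EE : E = e%:E by rewrite /e fineK.
have e0 : 0 <= e by rewrite -lee_fin -EE.
rewrite EE poweR_EFin -EFinM lee_fin.
have lf : lavg mu r P (f i) <= A * e `^ r^-1.
  rewrite -powRM ?exprn_ge0 ?(ltW C00)//; apply: le_powR_inv; first exact: lavg_ge0.
  rewrite -(ler_pM2r P0) -lee_fin -(integral_lavg hr bP fL).
  have := avg_iter_le k bP fE0; rewrite -/E EE (avgE _ bP) lee_pdivrMl// => /le_trans; apply.
  by rewrite -!EFinM lee_fin mulrC.
rewrite mulrDl; apply: lerD => //.
rewrite mulrDl /scale; case: ifPn => [itau|itau]; last first.
  rewrite invr1 mul1r (_ : frozen _ _ _ _ _ = f i); last first.
    by apply/funext => x; rewrite /frozen (negbTE itau) mul1r.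
  by apply: le_trans lf _; rewrite lerDl mulr_ge0 ?powR_ge0.
have bi := bn i itau; have [n0 mb _ _] := bi.
apply: (@le_trans _ _ (B * e `^ r^-1)); last by rewrite lerDr mulr_ge0 ?powR_ge0// ltW.
have frL : frozen tau b (means (mu:=mu) b P) f i \in Lfun mu r%:E.
  exact: (frozen_Lr hr bn bB0 fM fB0 _ i (dominated_self mf)).
rewrite -powRM ?(ltW C20)//; apply: le_powR_inv; first by rewrite mulr_ge0 ?lavg_ge0// invr_ge0 ltW.
rewrite powRM ?lavg_ge0 ?invr_ge0 ?(ltW n0)// -(ler_pM2r P0) -mulrA -lee_fin EFinM.
rewrite -(integral_lavg hr bP frL).
have Ee : (E <= e%:E)%E by rewrite EE.
apply: le_trans (HC2 (f i) (b i) (M i) (n i) e P bi bP (mf i) (fM i) e0 Ee).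
rewrite -(ge0_integralZl_EFin mu mP) ?powR_ge0//; last first.
  by apply: measurable_funTS; apply: measurable_normr_powR; exact: Lfun_measurable frL.
apply: le_lower_integral => x Px; first by rewrite -EFinM lee_fin mulr_ge0 ?powR_ge0.
rewrite -EFinM lee_fin /frozen itau normrM powRM// mulrA ler_wpM2r ?powR_ge0//.
by rewrite -powRM ?invr_ge0 ?(ltW n0)// mulrC distrC.
Qed.

(** The averages of the different entries are over the same ball, so their
    product is one of those in the multilinear maximal function. *)
Lemma prod_amplitude_le (C1 : R) : gap_bound BB C1 ->
  exists2 C4 : R, 0 < C4 & forall (tau : {set 'I_m}) (b f : 'I_m -> T -> R)
    (n M : 'I_m -> R) (B0 P : set T) (x : T),
    (forall i, i \in tau -> osc_le BB (b i) (n i)) -> balls BB B0 ->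
    (forall i, measurable_fun setT (f i)) -> (forall i x, `|f i x| <= M i) ->
    (forall i x, f i x != 0 -> B0 x) -> balls BB P -> P x ->
    ((\prod_(i < m) amplitude (mu:=mu) r tau b n f P i)%:E <=
     C4%:E * maximal BB r (fun i => fstar BB r (f i)) x)%E.
Proof.
move=> gapC; have [C3 C30 HC3] := amplitude_le_fstar gapC.
exists (C3 ^+ m); first exact: exprn_gt0.
move=> tau b f n M B0 P x bn bB0 mf fM fB0 bP Px.
pose P' := stars `|Num.ceil r|%N P; have bP' : balls BB P' by exact: iter_star_ball.
apply: (@le_trans _ _ ((C3 ^+ m)%:E * \prod_(i < m) avgr (mu:=mu) r P' (fstar BB r (f i)))%E); last first.
  apply: lee_wpmul2l; first by rewrite lee_fin exprn_ge0// ltW.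
  rewrite /maximal mem_set; last by exists P.
  by apply: ereal_sup_ubound; exists P' => //; split => //; exact: sub_iter_star.
rewrite -prodEFin.
have -> : ((C3 ^+ m)%:E = \prod_(i < m) C3%:E)%E by rewrite prodEFin prodr_const card_ord.
rewrite -big_split/=.
have : (0 <= \prod_(i < m) (amplitude (mu:=mu) r tau b n f P i)%:E <=
  \prod_(i < m) (C3%:E * avgr (mu:=mu) r P' (fstar BB r (f i))))%E; last by case/andP.
elim/big_ind2: _ => [|x1 x2 y1 y2 /andP[h1 h2] /andP[h3 h4]|i _].
- by rewrite lee01 lexx.
- by rewrite mule_ge0//= lee_pmul.
- by rewrite (HC3 _ _ _ _ M B0)// lee_fin andbT; exact: (amplitude_ge0 (BB:=BB)).
Qed.

End Amplitude.
End MaximalBound.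

(** * Exponential decay *)

Section Rate.
Set Implicit Arguments.
Unset Strict Implicit.
Context {d : measure_display} {T : measurableType d} {R : realType}.
Context {mu : {measure set T -> \bar R}} (BB : ball_basis mu).
Variables (r : R) (m : nat).
Hypothesis hr : 1 <= r.
Hypothesis hm : (0 < m)%N.
Local Notation C0 := (star_cst BB).
Variables (V : completeNormedModType R) (S : operator (T:=T) (R:=R) m R).
Hypothesis hS : bounded_oscillation BB r V S.
Hypothesis hbd : weak_bounded (mu:=mu) r S.

Lemma commutator_decay : exists Cs Cb : R, [/\ 0 < Cs, 0 <= Cb &
  forall (tau : {set 'I_m}) (b f : 'I_m -> T -> R) (n M : 'I_m -> R) (B : set T)
    (W : T -> \bar R) (k : nat) (u : R),
    (forall i, i \in tau -> osc_le BB (b i) (n i)) -> balls BB B ->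
    (forall i, measurable_fun setT (f i)) -> (forall i x, `|f i x| <= M i) ->
    (forall i x, f i x != 0 -> B x) ->
    (forall x P, balls BB P -> P x ->
      ((\prod_(i < m) amplitude (mu:=mu) r tau b n f P i)%:E <= W x)%E) ->
    1 <= u ->
    ((mu^*)%mu [set x | B x /\
       ((Cs * (\prod_(i in tau) n i * u ^+ #|tau|) * k%:R)%:E * W x <
        (`|S (frozen tau b (fun i => b i x) f) x|)%:E)%E] <=
     (expR (- k%:R) + Cb * expR (- u))%:E * mu B)%E].
Proof.
have [U [A [subA SA [k1 [k2 [k10 k20 HT]]]]]] := bounded_oscillation_sublinear hr hS.
have C01 : 1 <= C0 by exact: star_cst_ge1.
have C00 : 0 < C0 by exact: star_cst_gt0.
pose p : R := #|{: {ffun 'I_m -> bool} + ('I_m + ('I_m + 'I_m))}|%:R.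
have p0 : 0 <= p by exact: ler0n.
have p1 : 0 < p + 1 by rewrite ltr_wpDl.
have e10 : 0 < expR (- 1) :> R by exact: expR_gt0.
(* the measure of one piece of an exceptional set, small enough for both the
   stopping rule and the geometric decay *)
pose e1 := expR (- 1) / (2 * C0 ^+ 2 * (p + 1)).
have e1gt0 : 0 < e1 by rewrite divr_gt0// !mulr_gt0 ?exprn_gt0.
have small2 : C0 * (2 * (p * (e1 * C0))) <= expR (- 1).
  have -> : C0 * (2 * (p * (e1 * C0))) = expR (- 1) * (p / (p + 1)).
    by rewrite /e1; move: (expR _) => z; field; rewrite !gt_eqF.
  by rewrite ler_piMr ?(ltW e10)// ler_pdivrMr// mul1r lerDl.
have small : p * (e1 * C0) <= 2^-1.
  have h0 : 0 <= 2 * (p * (e1 * C0)).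
    by apply: mulr_ge0 => //; apply: mulr_ge0 => //; apply: mulr_ge0; exact: ltW.
  have h1 : 2 * (p * (e1 * C0)) <= C0 * (2 * (p * (e1 * C0))) by rewrite ler_peMl.
  have h2 : expR (- 1) <= 1 :> R by rewrite -expR0 ler_expR oppr_le0.
  have h3 := le_trans h1 (le_trans small2 h2).
  by move: h3; move: (p * (e1 * C0)) => z; lra.
have [lam lam0 Hlam] := weak_level BB hr hm hbd e1gt0.
pose K := 1 + 2 * C0 ^+ 6 / e1.
have K1 : 1 <= K by rewrite lerDl divr_ge0 ?(ltW e1gt0)// mulr_ge0// exprn_ge0// ltW.
have HK : 2 * C0 ^+ 6 <= e1 * K.
  by rewrite /K mulrDr mulr1 [X in _ + X]mulrC divfK ?gt_eqF// lerDr ltW.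
exists (step_cst m lam K k1 k2), (bad_cst BB m); split.
- exact: step_cst_gt0.
- by rewrite /bad_cst divr_ge0 ?subr_ge0// ?mulr_ge0// ?(ltW C00)// -expR0 ler_expR oppr_le0.
move=> tau b f n M B W k u bn bB mf fM fB HW u1.
have mB := ball_measurable bB.
have fBE : restr f B = f.
  apply/funext => i; apply/funext => y; rewrite /restr.
  have [->|/fB By] := eqVneq (f i y) 0; first by rewrite mul0r.
  by rewrite indicE mem_set// mulr1.
have := decay hr subA SA e1gt0 lam0 Hlam K1 HK bn bB mf fM fB k10 k20 HT small HW small2
  k u1 bB mB (sub_star_self bB).
rewrite fBE; apply: le_trans; apply: le_mu_ext => x [Bx Wx]; split => //.
rewrite -SA// => i.
exact: (frozen_Lr hr bn bB fM fB _ i (dominated_self mf)).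
Qed.

(** Choosing the number of steps and the truncation level of the multipliers
    equal to the largest integer below [t^(1/(|tau|+1))]. *)
Lemma commutator_rate : exists Cs C : R, [/\ 0 < Cs, 1 <= C &
  forall (tau : {set 'I_m}) (b f : 'I_m -> T -> R) (n M : 'I_m -> R) (B : set T)
    (W : T -> \bar R) (t : R),
    (forall i, i \in tau -> osc_le BB (b i) (n i)) -> balls BB B ->
    (forall i, measurable_fun setT (f i)) -> (forall i x, `|f i x| <= M i) ->
    (forall i x, f i x != 0 -> B x) ->
    (forall x P, balls BB P -> P x ->
      ((\prod_(i < m) amplitude (mu:=mu) r tau b n f P i)%:E <= W x)%E) ->
    0 < t ->
    ((mu^*)%mu [set x | B x /\
       ((Cs * \prod_(i in tau) n i * t)%:E * W x <
        (`|S (frozen tau b (fun i => b i x) f) x|)%:E)%E] <=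
     (C * expR (- (t `^ #|tau|.+1%:R^-1)))%:E * mu B)%E].
Proof.
have [Cs [Cb [Cs0 Cb0 H]]] := commutator_decay.
exists Cs, ((1 + Cb) * expR 1); split => //.
  have e1 : 1 <= expR 1 :> R by rewrite -expR0 ler_expR.
  by rewrite -[leLHS]mulr1 ler_pM// lerDl.
move=> tau b f n M B W t bn bB mf fM fB HW t0.
set q : R := #|tau|.+1%:R; have q0 : 0 < q by rewrite ltr0n.
set y := t `^ q^-1; have y0 : 0 < y by exact: powR_gt0.
have yq : y ^+ #|tau|.+1 = t.
  by rewrite -powR_mulrn ?(ltW y0)// -powRrM mulVf ?gt_eqF// powRr1// ltW.
have mB := ball_measurable bB.
(* below the first step the bound by the measure of [B] is enough *)
have [y1|y1] := ltP y 1.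
  apply: (@le_trans _ _ (mu B)).
    by rewrite -(measurable_mu_extE mu mB); apply: le_mu_ext => x [].
  rewrite (ballmE bB) -EFinM lee_fin ler_peMl ?(ltW (ballm_gt0 bB))//.
  rewrite -mulrA -expRD; apply: mulr_ege1; first by rewrite lerDl.
  by rewrite -[leLHS]expR0 ler_expR subr_ge0 ltW.
set k := Num.trunc y.
have ky : k%:R <= y by rewrite truncn_le ltW.
have yk : y < k.+1%:R by exact: truncnS_gt.
have k1 : 1 <= k%:R :> R.
  rewrite (ler_nat _ 1%N) -ltnS -(ltr_nat R); exact: le_lt_trans yk.
have N0 : 0 < \prod_(i in tau) n i by apply: prodr_gt0 => i /bn[].
have kt : k%:R ^+ #|tau|.+1 <= t by rewrite -yq lerXn2r ?nnegrE ?(ltW y0).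
apply: (@le_trans _ _ ((expR (- k%:R) + Cb * expR (- k%:R))%:E * mu B)%E); last first.
  apply: lee_wpmul2r => //; rewrite lee_fin -[X in X + _ <= _]mul1r -mulrDl -mulrA.
  rewrite ler_wpM2l ?addr_ge0// -expRD ler_expR.
  by move: yk; rewrite -natr1; lra.
apply: le_trans (H tau b f n M B W k k%:R bn bB mf fM fB HW k1).
apply: le_mu_ext => x [Bx lt]; split => //; apply: le_lt_trans lt.
have W0 : (0 <= W x)%E.
  apply: le_trans (HW x B bB Bx); rewrite lee_fin; apply: prodr_ge0 => i _.
  exact: (amplitude_ge0 (BB:=BB)).
apply: lee_wpmul2r => //; rewrite lee_fin -!mulrA ler_wpM2l ?(ltW Cs0)//.
by rewrite ler_wpM2l ?(ltW N0)// -exprSr.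
Qed.

Lemma maximal_ge_amplitude (f : 'I_m -> T -> R) (B0 P : set T) (b : 'I_m -> T -> R)
    (n M : 'I_m -> R) x : balls BB B0 ->
  (forall i, measurable_fun setT (f i)) -> (forall i x, `|f i x| <= M i) ->
  (forall i x, f i x != 0 -> B0 x) -> balls BB P -> P x ->
  ((\prod_(i < m) amplitude (mu:=mu) r finset.set0 b n f P i)%:E <=
   (2 ^+ m)%:E * maximal BB r (fun i => EFin \o f i) x)%E.
Proof.
move=> bB0 mf fM fB0 bP Px.
rewrite (eq_bigr (fun i => 2 * lavg mu r P (f i))); last first.
  move=> i _; rewrite /amplitude /scale finset.in_set0 invr1 mul1r.
  rewrite (_ : frozen _ _ _ _ _ = f i) ?mulr_natl ?mulr2n//.
  by apply/funext => y; rewrite /frozen finset.in_set0 mul1r.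
rewrite big_split/= prodr_const card_ord EFinM; apply: lee_wpmul2l.
  by rewrite lee_fin exprn_ge0.
rewrite /maximal mem_set; last by exists P.
apply: ereal_sup_ubound; exists P => //; rewrite -prodEFin; apply: eq_bigr => i _.
rewrite (lavgE hr bP)//; exact: (dominated_Lr hr bB0 fM fB0 i (dominated_self mf)).
Qed.

Lemma operator_rate : exists2 gamma : R, 0 < gamma & exists2 C : R, 0 < C &
  forall (B : set T) (f : 'I_m -> T -> R) (M : 'I_m -> R) (t : R), balls BB B ->
    (forall i, measurable_fun setT (f i)) -> (forall i x, `|f i x| <= M i) ->
    (forall i x, f i x != 0 -> B x) -> 0 < t ->
    ((mu^*)%mu [set x | B x /\
         t%:E * maximal BB r (fun i => EFin \o f i) x < (`|S f x|)%:E]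
       <= C%:E * (expR (- (gamma * t)))%:E * mu B)%E.
Proof.
have [Cs [C [Cs0 C1 H]]] := commutator_rate.
have m20 : 0 < 2 ^+ m :> R by rewrite exprn_gt0.
exists (Cs * 2 ^+ m)^-1; first by rewrite invr_gt0 mulr_gt0.
exists C => [|B f M t bB mf fM fB t0]; first exact: lt_le_trans C1.
pose b (i : 'I_m) (x : T) : R := 0.
have bn i : i \in finset.set0 -> osc_le BB (b i) 1 by rewrite finset.in_set0.
have t'0 : 0 < (Cs * 2 ^+ m)^-1 * t by rewrite mulr_gt0// invr_gt0 mulr_gt0.
have := H finset.set0 b f (fun=> 1) M B _ _ bn bB mf fM fB
  (fun x P => maximal_ge_amplitude b (fun=> 1) (x:=x) (P:=P) bB mf fM fB) t'0.
rewrite cards0 invr1 powRr1 ?(ltW t'0)// EFinM; apply: le_trans.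
apply: le_mu_ext => x [Bx lt]; split => //.
rewrite big_set0 muleA -EFinM [X in (X%:E * _ < _)%E](_ : _ = t); last first.
  by move: (2 ^+ m) m20 => z z0; field; rewrite !gt_eqF.
rewrite [frozen _ _ _ _](_ : _ = f)//.
by apply/funext => i; apply/funext => y; rewrite /frozen finset.in_set0 mul1r.
Qed.

End Rate.

Section CommutatorRate.
Set Implicit Arguments.
Unset Strict Implicit.
Context {d : measure_display} {T : measurableType d} {R : realType}.
Context {mu : {measure set T -> \bar R}} (BB : ball_basis mu).
Variables (r : R) (m : nat).
Hypothesis hr : 1 <= r.
Hypothesis hm : (0 < m)%N.
Variables (V : completeNormedModType R) (S : operator (T:=T) (R:=R) m R).
Hypothesis hS : bounded_oscillation BB r V S.
Hypothesis hbd : weak_bounded (mu:=mu) r S.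

Lemma osc_norm_ge0 (b : T -> R) (B : set T) : balls BB B -> (0 <= osc_norm BB b)%E.
Proof.
move=> bB; apply: le_trans (ereal_sup_ubound _); last by exists B.
by apply: le_ereal_inf_tmp => _ [l [l0 _] <-]; rewrite lee_fin ltW.
Qed.

Lemma commutator_frozen (b : 'I_m -> T -> R) (alpha : 'I_m -> nat) (f : 'I_m -> T -> R) x :
  (forall i, (alpha i <= 1)%N) ->
  commutator S b alpha f x =
  S (frozen [set i | alpha i != 0%N]%SET b (fun i => b i x) f) x.
Proof.
move=> a1; congr (S _ x); apply/funext => i; apply/funext => y; rewrite /frozen finset.inE.
by case: (alpha i) (a1 i) => [|[|//]] _; rewrite ?expr0 ?expr1.
Qed.

(** The scales n_i have to be strictly larger than the norms of the multipliers;
    twice the norms will do, at the price of a power of 2 in the rate. *)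
Lemma commutator_maximal_rate (C1 : R) : gap_bound BB C1 ->
  exists2 gamma : R, 0 < gamma & exists2 C : R, 0 < C &
  forall (tau : {set 'I_m}) (b f : 'I_m -> T -> R) (M : 'I_m -> R) (B : set T) (t : R),
    balls BB B -> (forall i, measurable_fun setT (f i)) ->
    (forall i x, `|f i x| <= M i) -> (forall i x, f i x != 0 -> B x) -> 0 < t ->
    ((mu^*)%mu [set x | B x /\
         t%:E * maximal BB r (fun i => fstar BB r (f i)) x
           < (`|S (frozen tau b (fun i => b i x) f) x|)%:E]
       <= C%:E * expeR (- (((gamma * t)%:E * (osc_norm_prod BB b tau)^-1)
                             `^ (#|tau|.+1%:R^-1))) * mu B)%E.
Proof.
move=> gapC; have [Cs [C [Cs0 C1' H]]] := commutator_rate hr hm hS hbd.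
have [C4 C40 HC4] := prod_amplitude_le hr m gapC.
have C0 : 0 < C by exact: lt_le_trans C1'.
have CC0 : 0 < Cs * C4 by rewrite mulr_gt0.
have G0 : 0 < (Cs * C4 * 2 ^+ m)^-1 by rewrite invr_gt0 mulr_gt0// exprn_gt0.
exists (Cs * C4 * 2 ^+ m)^-1 => //.
exists C => // tau b f M B t bB mf fM fB t0.
have mB := ball_measurable bB; have B0 := ballm_gt0 bB.
set q : R := #|tau|.+1%:R; have q0 : 0 < q by rewrite ltr0n.
set X := [set x | _ /\ _].
have XB : ((mu^*)%mu X <= mu B)%E.
  by rewrite -(measurable_mu_extE mu mB); apply: le_mu_ext => x [].
have core n : (forall i, i \in tau -> osc_le BB (b i) (n i)) ->
    ((mu^*)%mu X <= (C * expR (- ((t / (Cs * C4 * \prod_(i in tau) n i)) `^ q^-1)))%:E * mu B)%E.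
  move=> bn; have N0 : 0 < \prod_(i in tau) n i by apply: prodr_gt0 => i /bn[].
  set N := \prod_(i in tau) _ in N0 *.
  have t'0 : 0 < t / (Cs * C4 * N) by rewrite divr_gt0// mulr_gt0.
  apply: le_trans (H tau b f n M B _ _ bn bB mf fM fB
    (fun x P bP Px => HC4 tau b f n M B P x bn bB mf fM fB bP Px) t'0).
  apply: le_mu_ext => x [Bx lt]; split => //; rewrite -/N muleA -EFinM.
  rewrite [X in (X%:E * _ < _)%E](_ : _ = t)//.
  by field; rewrite !gt_eqF.
rewrite /osc_norm_prod; case: asboolP => [oscb|_]; last first.
  rewrite invey mule0 poweR0r ?invr_eq0 ?gt_eqF//= oppr0 expR0 mule1.
  by apply: le_trans XB _; rewrite -[leLHS]mul1e; apply: lee_wpmul2r.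
pose nu i := fine (osc_norm BB (b i)).
have nuE i : i \in tau -> osc_norm BB (b i) = (nu i)%:E.
  move=> /oscb[_ _ lt]; rewrite /nu fineK// ge0_fin_numE//.
  exact: osc_norm_ge0 bB.
have nu0 i : i \in tau -> 0 <= nu i.
  by move=> itau; rewrite -lee_fin -nuE//; exact: osc_norm_ge0 bB.
have bn i z : i \in tau -> nu i < z -> osc_le BB (b i) z.
  move=> itau lt; apply: (osc_expL_osc_le bB (oscb i itau)).
  by rewrite nuE// lte_fin.
rewrite (eq_bigr (fun i => (nu i)%:E))//.
rewrite prodEFin; set N := \prod_(i in tau) nu i.
have [N0|N0] := eqVneq N 0; last first.
  have nupos i : i \in tau -> 0 < nu i.
    move=> itau; rewrite lt_neqAle nu0// andbT eq_sym; apply: contra_neq N0 => nui.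
    by rewrite /N (bigD1 i)//= nui mul0r.
  have Npos : 0 < N by apply: prodr_gt0 => i /nupos.
  rewrite inver (negbTE N0) -EFinM.
  have bn2 i : i \in tau -> osc_le BB (b i) (2 * nu i).
    by move=> itau; apply: bn => //; have := nupos i itau; lra.
  apply: le_trans (core _ bn2) _; apply: lee_wpmul2r => //.
  rewrite lee_fin ler_wpM2l ?(ltW C0)// ler_expR lerN2; apply: ge0_ler_powR.
  - by rewrite invr_ge0 ltW.
  - by rewrite nnegrE !mulr_ge0 ?invr_ge0 ?(ltW t0) ?(ltW Npos)// !mulr_ge0 ?exprn_ge0 ?(ltW Cs0) ?(ltW C40).
  - rewrite nnegrE divr_ge0 ?(ltW t0)// mulr_ge0 ?(ltW CC0)//; apply: prodr_ge0 => i /nu0 ?.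
    by rewrite mulr_ge0.
  rewrite big_split/= prodr_const -/N mulrAC mulrC ler_wpM2l ?(ltW t0)//.
  rewrite -invfM lef_pV2 ?posrE ?mulr_gt0 ?exprn_gt0//.
  rewrite -!mulrA ler_wpM2l ?(ltW Cs0)// ler_wpM2l ?(ltW C40)// ler_wpM2r ?(ltW Npos)//.
  by rewrite ler_weXn2l ?ler1n// (leq_trans (max_card _))// card_ord.
(* a multiplier of norm 0 admits every positive scale, so the set is null *)
rewrite N0 inve0 gt0_muley ?lte_fin ?(mulr_gt0 G0 t0)//.
rewrite poweRyr ?invr_eq0 ?gt_eqF//= mule0 mul0e.
have [i0 i0tau nui0] : exists2 i0, i0 \in tau & nu i0 = 0.
  apply: contrapT => h; have : 0 < N; last by rewrite N0 ltxx.
  apply: prodr_gt0 => i itau; rewrite lt_neqAle nu0// andbT eq_sym; apply/eqP => nui.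
  by apply: h; exists i.
apply/lee_addgt0Pr => e e0; rewrite add0e.
pose y := C * ballm mu B / e; have y0 : 0 < y by rewrite divr_gt0// mulr_gt0.
pose K := \prod_(i in tau | i != i0) (nu i + 1).
have K0 : 0 < K by apply: prodr_gt0 => i /andP[itau _]; rewrite ltr_wpDl// nu0.
pose del := t / (Cs * C4 * K * y ^+ #|tau|.+1).
have del0 : 0 < del by rewrite divr_gt0// !mulr_gt0// exprn_gt0.
pose n i := if i == i0 then del else nu i + 1.
have bn' i : i \in tau -> osc_le BB (b i) (n i).
  move=> itau; apply: bn => //; rewrite /n; case: eqP => [->|_]; first by rewrite nui0.
  by rewrite ltrDl.
apply: le_trans (core _ bn') _.
have -> : \prod_(i in tau) n i = del * K.
  rewrite (bigD1 i0)//= {1}/n eqxx; congr (_ * _); apply: eq_bigr => i /andP[_ /negbTE h].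
  by rewrite /n h.
have -> : t / (Cs * C4 * (del * K)) = y ^+ #|tau|.+1.
  rewrite /del; have := exprn_gt0 #|tau|.+1 y0; move: (y ^+ _) => z z0.
  by field; rewrite !gt_eqF.
rewrite -powR_mulrn ?(ltW y0)// -powRrM mulfV ?gt_eqF// powRr1 ?(ltW y0)//.
rewrite (ballmE bB) -EFinM lee_fin expRN.
rewrite mulrAC ler_pdivrMr ?expR_gt0//.
have := expR_ge1Dx y; rewrite -ler_pdivrMl// mulrC -/y; lra.
Qed.

End CommutatorRate.

Theorem theorem1p6 (R : realType) (d : measure_display) (T : measurableType d)
    (mu : {measure set T -> \bar R}) (BB : ball_basis mu)
    (m : nat) (hm : (0 < m)%N) (V : completeNormedModType R)
    (r : R) (hr : 1 <= r) (S : operator m R)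
    (hS : bounded_oscillation BB r V S)
    (hbd : weak_bounded (mu := mu) r S) :
  exists2 gamma : R, 0 < gamma &
    (exists2 C : R, 0 < C &
      forall (B : set T) (f : 'I_m -> T -> R) (t : R),
        balls BB B ->
        (forall i, Linfc BB (f i)) ->
        (forall i, [set x | f i x != 0] `<=` B) ->
        0 < t ->
        ((mu^*)%mu [set x | B x /\
             t%:E * maximal BB r (fun i => EFin \o f i) x < (`|S f x|)%:E]
           <= C%:E * (expR (- (gamma * t)))%:E * mu B)%E)
    /\
    (sharp_reverse_Holder BB ->
      forall alpha : 'I_m -> nat,
        (forall i, (alpha i <= 1)%N) ->
        let tau := [set i | alpha i != 0%N]%SET in
        exists2 C : R, 0 < C &
          forall (b : 'I_m -> T -> R) (B : set T) (f : 'I_m -> T -> R) (t : R),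
            (forall i, measurable_fun setT (b i)) ->
            balls BB B ->
            (forall i, Linfc BB (f i)) ->
            (forall i, [set x | f i x != 0] `<=` B) ->
            0 < t ->
            ((mu^*)%mu [set x | B x /\
                 t%:E * maximal BB r (fun i => fstar BB r (f i)) x
                   < (`|commutator S b alpha f x|)%:E]
               <= C%:E * expeR (- (((gamma * t)%:E * (osc_norm_prod BB b tau)^-1)
                                     `^ (#|tau|.+1%:R^-1)))
                       * mu B)%E).
Proof.
have [g1 g10 [Ca Ca0 Ha]] := operator_rate hr hm hS hbd.
have bound (f : 'I_m -> T -> R) : (forall i, Linfc BB (f i)) ->
    exists M : 'I_m -> R, forall i x, `|f i x| <= M i.
  move=> fL; suff /choice[M fM] : forall i, exists M : R, forall x, `|f i x| <= M by exists M.
  by move=> i; case: (fL i).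
have part1 g : 0 < g -> g <= g1 -> exists2 C : R, 0 < C &
      forall (B : set T) (f : 'I_m -> T -> R) (t : R),
        balls BB B -> (forall i, Linfc BB (f i)) ->
        (forall i, [set x | f i x != 0] `<=` B) -> 0 < t ->
        ((mu^*)%mu [set x | B x /\
             t%:E * maximal BB r (fun i => EFin \o f i) x < (`|S f x|)%:E]
           <= C%:E * (expR (- (g * t)))%:E * mu B)%E.
  move=> g0 gg1; exists Ca => // B f t bB fL fB t0.
  have [M fM] := bound f fL.
  have mf i : measurable_fun setT (f i) by case: (fL i).
  apply: le_trans (Ha B f M t bB mf fM (fun i x => fB i x) t0) _.
  apply: lee_wpmul2r => //; rewrite -!EFinM lee_fin ler_wpM2l ?(ltW Ca0)//.
  by rewrite ler_expR lerN2 ler_wpM2r// ltW.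
have [[C1 gapC]|nogap] := pselect (exists C, gap_bound BB C); last first.
  exists g1 => //; split; first exact: part1.
  by move=> /gap_bound_of_sharp.
have [g2 g20 [Cc Cc0 Hc]] := commutator_maximal_rate hr hm hS hbd gapC.
have g0 : 0 < Num.min g1 g2 by rewrite lt_min g10 g20.
exists (Num.min g1 g2) => //; split.
  by apply: part1 => //; rewrite ge_min lexx.
move=> _ alpha a1 tau; exists Cc => // b B f t mb bB fL fB t0.
have [M fM] := bound f fL.
have mf i : measurable_fun setT (f i) by case: (fL i).
under eq_set do rewrite (commutator_frozen S b f _ a1).
apply: le_trans (Hc tau b f M B t bB mf fM (fun i x => fB i x) t0) _.
have N0 : (0 <= (osc_norm_prod BB b tau)^-1)%E.
  rewrite inve_ge0 /osc_norm_prod; case: asboolP => _; last exact: leey.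
  by elim/big_ind: _ => [|u v u0 v0|i _]; [exact: lee01|exact: mule_ge0|exact: osc_norm_ge0 bB].
apply: lee_wpmul2r => //; apply: lee_wpmul2l; first by rewrite lee_fin ltW.
rewrite lee_expeR leeN2; apply: gt0_ler_poweR.
- by rewrite invr_ge0.
- by rewrite in_itv/= leey andbT mule_ge0// lee_fin mulr_ge0// ltW.
- by rewrite in_itv/= leey andbT mule_ge0// lee_fin mulr_ge0// ltW.
apply: lee_wpmul2r => //; rewrite lee_fin ler_wpM2r ?(ltW t0)//.
by rewrite ge_min lexx orbT.
Qed.
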